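(* Let $n\ge 1$, $a\ge 1$ and $s_0>0$. Let $\phi:\mathbb{R}^n\setminus\{0\}\to\mathbb{R}$ be smooth and positively homogeneous of degree $a$, i.e. $\phi(r\xi)=r^a\phi(\xi)$ for all $r>0$ and $\xi\neq 0$. Assume that for every multi-index $\alpha$ there is a constant $c_\alpha$ with $|\partial^\alpha\phi(\xi)|\le c_\alpha|\xi|^{a-|\alpha|}$ for all $\xi\in\mathbb{R}^n\setminus\{0\}$, and that $\min_{|\xi|=1}|\nabla\phi(\xi)|>0$. For a measurable function $t:\mathbb{R}^n\to\mathbb{R}$ and $f\in\mathcal{S}(\mathbb{R}^n)$ let $$T_{t(x)}f(x)=\int_{\mathbb{R}^n}e^{ix\cdot\xi+it(x)\phi(\xi)}\,\widehat f(\xi)\,d\xi,\qquad x\in\mathbb{R}^n.$$ Suppose that for every $s>s_0$ there is a constant $C_s$ such that, for all measurable functions $t:\mathbb{R}^n\to[0,1]$, $$\|T_{t(x)}f\|_{L^2(B(0,1))}\le C_s\|f\|_{H^s(\mathbb{R}^n)}\quad\text{for all }f\in\mathcal{S}(\mathbb{R}^n).$$ Then for every $s>as_0$ there is a constant $C'_s$ such that, for all measurable functions $t:\mathbb{R}^n\to[0,1]$, $$\|T_{t(x)}f\|_{L^2(\mathbb{R}^n)}\le C'_s\|f\|_{H^s(\mathbb{R}^n)}\quad\text{for all }f\in\mathcal{S}(\mathbb{R}^n).$$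
   Context: $\mathcal{S}(\mathbb{R}^n)$ is the Schwartz class, and $B(0,1)$ is the unit ball centred at the origin. The Fourier transform is $\widehat f(\xi)=\int_{\mathbb{R}^n}e^{-ix\cdot\xi}f(x)\,dx$ (no factor $(2\pi)^{-n}$ is included in the definition of $T_{t(x)}$). $H^s(\mathbb{R}^n)$ is the space of tempered distributions $f$ with $\langle\xi\rangle^s\widehat f\in L^2(\mathbb{R}^n)$, where $\langle\xi\rangle=(1+|\xi|^2)^{1/2}$, with norm $\|f\|_{H^s}=\|\langle\xi\rangle^s\widehat f\|_{L^2}$. The constants $C_s, C'_s$ are independent of the measurable function $t$. *)

(* Defs.v *)
From HB Require Import structures.
From mathcomp Require Import all_boot all_order all_algebra.
From mathcomp Require Import complex.
From mathcomp Require Import all_classical all_reals all_analysis.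

Set Implicit Arguments.
Unset Strict Implicit.
Unset Printing Implicit Defensive.
Import Order.TTheory GRing.Theory Num.Theory.
Import numFieldNormedType.Exports.

Local Open Scope classical_set_scope.
Local Open Scope ring_scope.
Local Open Scope complex_scope.

(* Product (= Borel) sigma-algebra on 'rV[R]_n, as for n.-tuple in the library. *)
Section measurable_rV.
Context {R : realType}.
Variable n : nat.

Let coords (i : 'I_n) (x : 'rV[R]_n) : measurableTypeR R := x ord0 i.

Let rV_set0 : g_sigma_preimage coords set0.
Proof. exact: sigma_algebra0. Qed.

Let rV_setC A : g_sigma_preimage coords A -> g_sigma_preimage coords (~` A).
Proof. exact: sigma_algebraC. Qed.

Let rV_bigcup (F : _^nat) : (forall i, g_sigma_preimage coords (F i)) ->
  g_sigma_preimage coords (\bigcup_i (F i)).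
Proof. exact: sigma_algebra_bigcup. Qed.

HB.instance Definition _ := @isMeasurable.Build default_measure_display
  'rV[R]_n (g_sigma_preimage coords) rV_set0 rV_setC rV_bigcup.

Lemma measurable_coord_rV (i : 'I_n) :
  measurable_fun [set: 'rV[R]_n] (fun x => x ord0 i : measurableTypeR R).
Proof.
move=> _ A mA; rewrite setTI; apply: sub_sigma_algebra.
by rewrite (bigD1 i)//=; left; exists A => //; rewrite setTI.
Qed.

Lemma measurable_fun_rV d (T : measurableType d) (f : T -> 'rV[R]_n) :
  (forall i, measurable_fun setT (fun t => f t ord0 i : measurableTypeR R)) ->
  measurable_fun setT f.
Proof.
move=> mf.
suff H : g_sigma_preimage (fun i => coords i \o f) `<=` measurable.
  move=> _ A mA; rewrite g_sigma_preimage_comp in H.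
  by apply: H; exists A.
apply: smallest_sub; first exact: sigma_algebra_measurable.
apply: (big_ind (fun X => X `<=` measurable)) => //.
- by move=> X Y XS YS A [/XS|/YS].
- by move=> i _ A [B mB <-]; exact: mf.
Qed.

End measurable_rV.

Section rV_cons.
Context {R : realType} {n : nat}.

Definition rV_cons (p : measurableTypeR R * 'rV[R]_n) : 'rV[R]_n.+1 :=
  \row_i (if unlift ord0 i is Some j then p.2 ord0 j else p.1).

Definition rV_uncons (x : 'rV[R]_n.+1) : measurableTypeR R * 'rV[R]_n :=
  (x ord0 ord0, \row_j x ord0 (lift ord0 j)).

Lemma rV_consK : cancel rV_cons rV_uncons.
Proof.
move=> [a v]; rewrite /rV_uncons /rV_cons mxE unlift_none; congr pair.
by apply/rowP => j; rewrite !mxE liftK.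
Qed.

Lemma measurable_rV_cons : measurable_fun setT rV_cons.
Proof.
apply: measurable_fun_rV => i; rewrite /rV_cons.
under eq_fun do rewrite mxE.
case: unliftP => [j _|_]; last exact: measurable_fst.
apply: (measurableT_comp (measurable_coord_rV j)).
exact: measurable_snd.
Qed.

HB.instance Definition _ :=
  isMeasurableFun.Build _ _ _ _ rV_cons measurable_rV_cons.

Lemma measurable_rV_uncons : measurable_fun setT rV_uncons.
Proof.
apply: measurable_fun_pair; first exact: measurable_coord_rV.
apply: measurable_fun_rV => j; under eq_fun do rewrite mxE.
exact: measurable_coord_rV.
Qed.

End rV_cons.

Section borel_lebesgue_rVS.
Context {R : realType} {n : nat}.
Variable mu : {sigma_finite_measure set 'rV[R]_n -> \bar R}.

Definition rV_cons_measure : set 'rV[R]_n.+1 -> \bar R :=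
  pushforward (@lebesgue_measure R \x mu)%E rV_cons.

Let rV_cons_measure0 : rV_cons_measure set0 = 0%E.
Proof. exact: measure0. Qed.

Let rV_cons_measure_ge0 A : (0 <= rV_cons_measure A)%E.
Proof. exact: measure_ge0. Qed.

Let rV_cons_measure_sigma_additive : semi_sigma_additive rV_cons_measure.
Proof. exact: measure_semi_sigma_additive. Qed.

HB.instance Definition _ := isMeasure.Build _ _ _ rV_cons_measure
  rV_cons_measure0 rV_cons_measure_ge0 rV_cons_measure_sigma_additive.

Let rV_cons_measure_sigma_finite : sigma_finite setT rV_cons_measure.
Proof.
have /sigma_finiteP[F [TF ndF Foo]] := sigma_finiteT (@lebesgue_measure R).
have /sigma_finiteP[G [TG ndG Goo]] := sigma_finiteT mu.
exists (fun k => rV_uncons @^-1` (F k `*` G k)) => [|k].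
  rewrite -preimage_bigcup (_ : \bigcup_k _ = setT) ?preimage_setT//.
  rewrite -setXTT TF TG predeqE => -[x y]; split.
    by move=> [k _ []/= ? ?]; split; exists k.
  move=> [/= [k _ Fkx] [l _ Gly]]; exists (maxn k l) => //; split.
  - by move: x Fkx; exact/subsetPset/ndF/leq_maxl.
  - by move: y Gly; exact/subsetPset/ndG/leq_maxr.
have [mF Fk] := Foo k; have [mG Gk] := Goo k; split.
  rewrite -[X in measurable X]setTI; apply: measurable_rV_uncons => //.
  exact: measurableX.
rewrite /rV_cons_measure /pushforward -comp_preimage.
rewrite (_ : rV_uncons \o rV_cons = idfun); last first.
  by apply/funext => p; exact: rV_consK.
by rewrite preimage_id product_measure1E// lte_mul_pinfty// ge0_fin_numE.
Qed.

HB.instance Definition _ := Measure_isSigmaFinite.Build _ _ _ rV_cons_measure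
  rV_cons_measure_sigma_finite.

End borel_lebesgue_rVS.

(* Iterated product of lebesgue_measure; see borel_lebesgue_box for boxes. *)
Fixpoint borel_lebesgue (R : realType) (n : nat) :
    {sigma_finite_measure set 'rV[R]_n -> \bar R} :=
  match n with
  | 0 => \d_(0 : 'rV[R]_0)
  | n'.+1 => rV_cons_measure (borel_lebesgue R n')
  end.

Lemma borel_lebesgue_box (R : realType) (n : nat)
    (A : 'I_n -> set (measurableTypeR R)) :
  (forall i, measurable (A i)) ->
  borel_lebesgue R n [set x | forall i, A i (x ord0 i)] =
  (\prod_(i < n) lebesgue_measure (A i))%E.
Proof.
elim: n A => [|n IHn] A mA.
  rewrite big_ord0 /= diracE mem_set//=; last by move=> [].
rewrite big_ord_recl -IHn// -product_measure1E//; last first.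
  rewrite [X in measurable X](_ : _ = \bigcap_(i in [set: 'I_n])
     ((fun x : 'rV[R]_n => x ord0 i) @^-1` A (lift ord0 i))); last first.
    apply/seteqP; split => x /= H i; first by move=> _; exact: H.
    exact: (H i I).
  apply: fin_bigcap_measurable => // i _.
  by rewrite -[X in measurable X]setTI; exact: measurable_coord_rV.
rewrite /= /rV_cons_measure /pushforward; congr (_ _).
apply/seteqP; split => -[x v] /=.
  move=> H; split; first by have := H ord0; rewrite mxE unlift_none.
  by move=> i; have := H (lift ord0 i); rewrite mxE liftK.
move=> [Ax Av] i; rewrite mxE; case: unliftP => [j ->|->] //.
Qed.

(* R^n with its Lebesgue-measurable sets, i.e., the domain of the completed
   Lebesgue measure (cf. completed_lebesgue_measure). *)
Definition lebesgue_rVType (R : realType) (n : nat) : measurableType _ :=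
  caratheodory_type ((borel_lebesgue R n)^*)%mu.

Definition lebesgue_rV (R : realType) (n : nat) :
    {measure set (lebesgue_rVType R n) -> \bar R} :=
  @completed_measure_extension _ _ _ (borel_lebesgue R n).

Section euclidean.
Context {R : realType} {n : nat}.

Definition dotprod (x y : 'rV[R]_n) : R := \sum_i x ord0 i * y ord0 i.

(* `|x| on 'rV[R]_n is the max norm. *)
Definition enorm (x : 'rV[R]_n) : R := Num.sqrt (\sum_i x ord0 i ^+ 2).

Definition unit_ball : set 'rV[R]_n := [set x | enorm x < 1].

Definition unit_sphere : set 'rV[R]_n := [set x | enorm x = 1].

Definition lebesgue_measurable (t : 'rV[R]_n -> R) : Prop :=
  measurable_fun [set: lebesgue_rVType R n] t.

End euclidean.

Section smooth.
Context {R : realType} {n : nat}.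
Implicit Types (g : 'rV[R]_n -> R) (f : 'rV[R]_n -> R[i]) (alpha : 'I_n -> nat).

Definition partial (i : 'I_n) g : 'rV[R]_n -> R :=
  'D_(delta_mx ord0 i : 'rV[R]_n) g.

Definition partials (s : seq 'I_n) g : 'rV[R]_n -> R := foldr partial g s.

(* All iterated partial derivatives, in any order of the variables, are
   differentiable on U; U is meant to be open, and the values of g outside U
   are irrelevant. *)
Definition smooth_on (U : set 'rV[R]_n) g : Prop :=
  forall s x, U x -> differentiable (partials s g) x.

(* The order in which the variables are taken is immaterial for smooth g. *)
Definition mderiv alpha g : 'rV[R]_n -> R :=
  partials (flatten [seq nseq (alpha i) i | i <- enum 'I_n]) g.

Definition mdegree alpha : nat := (\sum_i alpha i)%N.

Definition monomial alpha (x : 'rV[R]_n) : R := \prod_i x ord0 i ^+ alpha i.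

Definition grad g (x : 'rV[R]_n) : 'rV[R]_n := \row_i partial i g x.

Definition mderivC alpha f (x : 'rV[R]_n) : R[i] :=
  mderiv alpha (fun y => complex.Re (f y)) x +i*
  mderiv alpha (fun y => complex.Im (f y)) x.

Definition schwartz f : Prop :=
  [/\ smooth_on setT (fun y => complex.Re (f y)),
      smooth_on setT (fun y => complex.Im (f y)) &
      forall alpha beta, exists C : R,
        forall x, `|monomial alpha x| * Normc.normc (mderivC beta f x) <= C].

End smooth.

Definition is_minimum (R : realType) (A : set R) (m : R) : Prop :=
  A m /\ lbound A m.

Section fourier.
Context {R : realType} {n : nat}.
Implicit Types (f g : 'rV[R]_n -> R[i]).

Definition integralC g : R[i] :=
  (\int[lebesgue_rV R n]_x complex.Re (g x)) +i*
  (\int[lebesgue_rV R n]_x complex.Im (g x)).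

Definition expi (theta : R) : R[i] := cos theta +i* sin theta.

Definition fourier f (xi : 'rV[R]_n) : R[i] :=
  integralC (fun x => expi (- dotprod x xi) * f x).

(* The operator T_t(x), without any power of 2 pi in front. *)
Definition propagator (phi t : 'rV[R]_n -> R) f (x : 'rV[R]_n) : R[i] :=
  integralC (fun xi => expi (dotprod x xi + t x * phi xi) * fourier f xi).

Definition L2norm (E : set 'rV[R]_n) g : \bar R :=
  Lnorm (lebesgue_rV R n) 2%:E
    (EFin \o (fun x => Normc.normc (g x)) \_ E).

Definition bracket (xi : 'rV[R]_n) : R := Num.sqrt (1 + enorm xi ^+ 2).

(* H^s norm, used on Schwartz functions only, so that the Fourier transform
   is the integral above. *)
Definition sobolev_norm (s : R) f : \bar R :=
  L2norm setT (fun xi => (bracket xi `^ s)%:C * fourier f xi).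

End fourier.

(* Main.v *)
Require Import Defs.
From HB Require Import structures.
From mathcomp Require Import all_boot all_order all_algebra.
From mathcomp Require Import complex.
From mathcomp Require Import all_classical all_reals all_analysis.
From mathcomp Require Import measurable_realfun ring lra.

(* Cut the Fourier transform of [f] with a smooth dyadic partition of unity.
   The part [|xi| <~ 1] is controlled by the fundamental theorem of calculus in
   the time variable and by Plancherel.  For the part [|xi| ~ l = 2^k] put
   [x = L y] with [L = l^(a - 1 + eps)].  By homogeneity of [phi] the
   frequencies become [~ L l = l^(a + eps)] and the times lie in [[0, L^-a]], so
   the group velocity [t |grad phi|] is [O(l^-eps)]: integrating by parts
   sufficiently often, the kernel at distance at least 1 is bounded, uniformly
   in [l], by a fixed integrable weight.  On a set of diameter less than 1 only
   the data within distance 2 then matters, up to a tail handled by Young's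
   inequality; the local hypothesis with exponent [s1 > s0] applies to the
   translated localized data, and averaging over translations yields a global
   bound for the piece, with loss [(L l)^s1 = l^((a + eps) s1)].  Since
   [(a + eps) s1 < s] for suitable [eps] and [s1], the pieces sum
   geometrically. *)

Set Implicit Arguments.
Unset Strict Implicit.
Unset Printing Implicit Defensive.
Import Order.TTheory GRing.Theory Num.Theory.
Import numFieldNormedType.Exports.

Local Open Scope classical_set_scope.
Local Open Scope ring_scope.

(** * Affine changes of variables and completion *)

(** Since [t] is arbitrary, Plancherel does not apply to [x |-> wave phi (t x) g x] itself. Each
    estimate is therefore either uniform in a frozen time and inserted pointwise at [t x], or an
    instance of the local hypothesis, whose constant does not see [t]. This needs the admissible [t]
    to be stable under translation and under [t (L y) * L^-a], which stays in [[0, 1]] because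
    [L >= 1]. The margin [eps] pays for the integrations by parts: at frequency [L l] the kernel
    costs [(L l)^n = l^((a + eps) n)] and each integration by parts gains [l^a / (L l) = l^-eps], so
    [N >= (a + eps) n / eps] of them make it bounded independently of [l]. Functions of [x] that
    involve [t] are measurable only for the completed measure [nu] ([lebesgue_rV]), while Fubini in
    the data and frequency variables is used for the Borel product measure [mu] ([borel_lebesgue]);
    the two integrals agree on Borel functions. The Fourier normalization enters through a single
    positive constant [fmass]. *)

Section affine1.
Context {R : realType}.
Notation lam := (@lebesgue_measure R).

Lemma measurable_affine1 (c y : R) :
  measurable_fun [set: measurableTypeR R]
    (fun x => c * x + y : measurableTypeR R).
Proof.
by apply: measurable_funD => //; exact: measurable_funM.
Qed.

(** Uniqueness of Lebesgue measure: [c] times the push-forward under the affine map takes the same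
    values on half-open intervals. *)
Lemma lebesgue_measure_affine_gt0 (c y : R) (c0 : 0 < c) (A : set (measurableTypeR R)) :
  measurable A ->
  (lam ((fun x : measurableTypeR R => (c * x + y)%R) @^-1` A) =
   (c^-1)%:E * lam A)%E.
Proof.
move=> mA.
pose g : measurableTypeR R -> measurableTypeR R := (fun x => c * x + y).
have mg : measurable_fun setT g by exact: measurable_affine1.
pose k := NngNum (ltW c0).
pose m : {measure set (measurableTypeR R) -> \bar R} := mscale k (pushforward lam g).
rewrite (@lebesgue_measure_unique _ (m mg) _ A mA); last first.
  move=> _ [[a b]] _ <-.
  rewrite /m /= /mscale /= /pushforward /=.
  have -> : g @^-1` `]a, b] = `](a - y) / c, (b - y) / c]%classic.
    apply/seteqP; split => x /=; rewrite !in_itv /= /g.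
      by rewrite ltr_pdivrMr// ler_pdivlMr// ltrBlDr lerBrDr mulrC.
    by rewrite ltr_pdivrMr// ler_pdivlMr// ltrBlDr lerBrDr mulrC.
  rewrite !lebesgue_measure_itv/= !lte_fin.
  rewrite ltr_pM2r ?invr_gt0// ltrD2r; case: ifPn => _; last by rewrite mule0.
  by rewrite -!EFinB -EFinM; congr _%:E; field; rewrite gt_eqF.
by rewrite /m /= /mscale /= /pushforward /= muleA -EFinM mulVf ?gt_eqF// mul1e.
Qed.

Lemma lebesgue_measure_affine (c y : R) (A : set (measurableTypeR R)) : c != 0 -> measurable A ->
  (lam ((fun x : measurableTypeR R => (c * x + y)%R) @^-1` A) =
   (`|c|^-1)%:E * lam A)%E.
Proof.
move=> c0 mA; have [cp|cn] := ltrP 0 c.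
  by rewrite (gtr0_norm cp) lebesgue_measure_affine_gt0.
have {}cn : 0 < - c by rewrite oppr_gt0 lt_neqAle c0.
rewrite -normrN (gtr0_norm cn) -(lebesgue_measure_affine_gt0 y cn mA).
rewrite -[RHS]lebesgue_measureN; last first.
  by rewrite -[X in measurable X]setTI; exact: measurable_affine1.
rewrite /pushforward; congr (lam _); apply/seteqP; split => x /=;
  by rewrite mulrNN.
Qed.

Lemma ge0_integral_affine1 (c y : R) (f : measurableTypeR R -> \bar R) :
  c != 0 -> measurable_fun setT f -> (forall x, 0 <= f x)%E ->
  (\int[lam]_x f (c * x + y)%R = (`|c|^-1)%:E * \int[lam]_x f x)%E.
Proof.
move=> c0 mf f0.
pose g : measurableTypeR R -> measurableTypeR R := (fun x => c * x + y).
have mg : measurable_fun setT g by exact: measurable_affine1.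
have i0 : 0 <= `|c|^-1 by rewrite invr_ge0.
have /= <- := ge0_integral_mscale lam measurableT (NngNum i0) mf (fun x _ => f0 x).
rewrite -[LHS](ge0_integral_pushforward mg lam measurableT mf) //.
apply: eq_measure_integral => A mA _; rewrite /mscale /=.
exact: lebesgue_measure_affine.
Qed.
End affine1.

Section affine.
Context {R : realType}.

Definition affine_rV n (c : R) (y x : 'rV[R]_n) : 'rV[R]_n := c *: x + y.

Lemma measurable_affine_rV n (c : R) (y : 'rV[R]_n) :
  measurable_fun setT (affine_rV c y).
Proof.
apply: measurable_fun_rV => i; under eq_fun do rewrite !mxE.
apply: measurable_funD => //; apply: measurable_funM => //.
exact: measurable_coord_rV.
Qed.

Lemma borel_lebesgueS n (A : set 'rV[R]_n.+1) :
  borel_lebesgue R n.+1 A =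
  (\int[lebesgue_measure]_x borel_lebesgue R n [set v | A (rV_cons (x, v))])%E.
Proof.
rewrite /= /rV_cons_measure /pushforward /= /product_measure1 /=.
apply: eq_integral => x _; congr (_ _).
by apply/seteqP; split => v; rewrite /xsection /= in_setE.
Qed.

Lemma measurable_section_cons n (A : set 'rV[R]_n.+1) : measurable A ->
  measurable_fun setT (fun x : measurableTypeR R =>
     borel_lebesgue R n [set v | A (rV_cons (x, v))]).
Proof.
move=> mA; have mB : measurable (rV_cons @^-1` A).
  by rewrite -[X in measurable X]setTI; exact: measurable_rV_cons.
have := measurable_fun_xsection (borel_lebesgue R n) mB.
congr (measurable_fun _ _); apply/funext => x /=; congr (_ _).
by apply/seteqP; split => v; rewrite /xsection /= in_setE.
Qed.

Lemma measurable_rV_section n (A : set 'rV[R]_n.+1) (x : measurableTypeR R) :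
  measurable A -> measurable [set v | A (rV_cons (x, v))].
Proof.
move=> mA; have mB : measurable (rV_cons @^-1` A).
  by rewrite -[X in measurable X]setTI; exact: measurable_rV_cons.
have := measurable_xsection x mB; congr (measurable _).
by apply/seteqP; split => v; rewrite /xsection /= in_setE.
Qed.

(** Induction on the dimension by slicing: each slice contributes [|c|^-n], and the one-variable
    change of variables the remaining factor. *)
Lemma borel_lebesgue_affine n (c : R) (y : 'rV[R]_n) A : c != 0 ->
  measurable A ->
  (borel_lebesgue R n (affine_rV c y @^-1` A) =
   (`|c| ^- n)%:E * borel_lebesgue R n A)%E.
Proof.
move=> c0; elim: n y A => [|n IHn] y A mA.
  rewrite expr0 invr1 mul1e /=; congr (\d_ _ _).
  apply/seteqP; split => x /=; by rewrite (_ : affine_rV c y x = x)// thinmx0 [RHS]thinmx0.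
rewrite !borel_lebesgueS.
pose y' : 'rV[R]_n := \row_j y ord0 (lift ord0 j).
pose F (x : measurableTypeR R) := borel_lebesgue R n [set v | A (rV_cons (x, v))].
transitivity (\int[lebesgue_measure]_x
    ((`|c| ^- n)%:E * F (c * x + y ord0 ord0)%R))%E.
  apply: eq_integral => x _.
  rewrite -(IHn y') //; last exact: measurable_rV_section.
  congr (_ _); apply/seteqP; split => v /=.
    congr (A _); apply/rowP => j; rewrite !mxE.
    by case: unliftP => [k ->|->] //=; rewrite !mxE ?eqxx//.
  congr (A _); apply/rowP => j; rewrite !mxE.
  by case: unliftP => [k ->|->] //=; rewrite !mxE ?eqxx//.
have mF : measurable_fun setT F by exact: measurable_section_cons.
rewrite ge0_integralZl//.
  rewrite (ge0_integral_affine1 _ c0 mF)// muleA -EFinM; congr (_%:E * _)%E.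
  by rewrite exprS invfM mulrC.
by apply: (measurableT_comp mF); exact: measurable_affine1.
Qed.

Lemma ge0_integral_affine n (c : R) (y : 'rV[R]_n) (f : 'rV[R]_n -> \bar R) :
  c != 0 -> measurable_fun setT f -> (forall x, 0 <= f x)%E ->
  (\int[borel_lebesgue R n]_x f (c *: x + y)%R =
   (`|c| ^- n)%:E * \int[borel_lebesgue R n]_x f x)%E.
Proof.
move=> c0 mf f0.
have i0 : 0 <= `|c| ^- n by rewrite invr_ge0 exprn_ge0.
have /= <- := ge0_integral_mscale (borel_lebesgue R n) measurableT (NngNum i0)
  mf (fun x _ => f0 x).
rewrite -[LHS](ge0_integral_pushforward (measurable_affine_rV c y)
  (borel_lebesgue R n) measurableT mf) //.
apply: eq_measure_integral => [|mg A mA _]; first exact: measurable_affine_rV.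
exact: borel_lebesgue_affine.
Qed.
End affine.

(** * Borel measure and its completion *)

Section completion.
Context {R : realType} {n : nat}.
Notation mu := (borel_lebesgue R n).
Notation nu := (lebesgue_rV R n).

Lemma lebesgue_rVE (A : set 'rV[R]_n) : measurable A -> nu A = mu A.
Proof. by move=> mA; exact: (measurable_mu_extE mu mA). Qed.

Lemma measurable_lebesgue_rV (A : set 'rV[R]_n) : measurable A ->
  measurable (A : set (lebesgue_rVType R n)).
Proof. exact: caratheodory_measurable_mu_ext. Qed.

Lemma measurable_id_lebesgue_rV :
  measurable_fun setT (fun x : lebesgue_rVType R n => x : 'rV[R]_n).
Proof.
by move=> _ A mA; rewrite setTI; exact: measurable_lebesgue_rV.
Qed.

Lemma lebesgue_measurable_borel d (T : measurableType d) (f : 'rV[R]_n -> T) :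
  measurable_fun setT f ->
  measurable_fun [set: lebesgue_rVType R n] f.
Proof.
by move=> mf; exact: (measurableT_comp mf measurable_id_lebesgue_rV).
Qed.

Lemma ge0_integral_lebesgue_rV (f : 'rV[R]_n -> \bar R) :
  measurable_fun setT f -> (forall x, 0 <= f x)%E ->
  (\int[nu]_x f x = \int[mu]_x f x)%E.
Proof.
move=> mf f0.
rewrite -[LHS](ge0_integral_pushforward measurable_id_lebesgue_rV nu measurableT mf) //.
apply: eq_measure_integral => [|mg A mA _]; last exact: lebesgue_rVE.
exact: measurable_id_lebesgue_rV.
Qed.

Lemma integral_lebesgue_rV (f : 'rV[R]_n -> \bar R) :
  measurable_fun setT f -> (\int[nu]_x f x = \int[mu]_x f x)%E.
Proof.
move=> mf; rewrite integralE [RHS]integralE; congr (_ - _)%E.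
  by apply: ge0_integral_lebesgue_rV => //; exact: measurable_funepos.
by apply: ge0_integral_lebesgue_rV => //; exact: measurable_funeneg.
Qed.

Lemma Rintegral_lebesgue_rV (f : 'rV[R]_n -> R) :
  measurable_fun setT f -> \int[nu]_x f x = \int[mu]_x f x.
Proof.
by move=> mf; congr fine; apply: integral_lebesgue_rV; exact/measurable_EFinP.
Qed.

HB.instance Definition _ := @Measure_isSigmaFinite.Build _ _ _
  (@completed_measure_extension _ _ _ mu) (completed_measure_extension_sigma_finite (sigma_finiteT mu)).

(** Countable covers are transported by preimage, which gives one inequality; the other is the same
    inequality for the inverse affine map. *)
Lemma mu_ext_affine (c : R) (y : 'rV[R]_n) (X : set 'rV[R]_n) : c != 0 ->
  ((mu^*)%mu (affine_rV c y @^-1` X) = (`|c| ^- n)%:E * (mu^*)%mu X)%E.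
Proof.
have le c' y' X' : c' != 0 -> ((mu^*)%mu (affine_rV c' y' @^-1` X') <=
    (`|c'| ^- n)%:E * (mu^*)%mu X')%E.
  move=> c0; have n0 : 0 < `|c'| ^+ n by rewrite exprn_gt0// normr_gt0.
  rewrite -lee_pdivrMl ?invr_gt0// invrK.
  apply: le_ereal_inf_tmp => _ [F [mF XF] <-].
  rewrite -lee_pdivlMl// -nneseriesZl//.
  apply: ereal_inf_lbound; exists (fun k => affine_rV c' y' @^-1` F k).
    split=> [k|x /XF [k _ Fk]]; last by exists k.
    by rewrite -[X in measurable X]setTI; exact: measurable_affine_rV.
  by apply: eq_eseriesr => k _; rewrite borel_lebesgue_affine.
move=> c0; apply/eqP; rewrite eq_le le//=.
have n0 : 0 < `|c| ^+ n by rewrite exprn_gt0// normr_gt0.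
rewrite -lee_pdivlMl ?invr_gt0//.
have {1}-> : X = affine_rV c^-1 (- (c^-1 *: y)) @^-1` (affine_rV c y @^-1` X).
  rewrite -comp_preimage (_ : _ \o _ = id) ?preimage_id//.
  apply/funext => x /=; rewrite /affine_rV scalerDr scalerN !scalerA mulfV//.
  by rewrite !scale1r subrK.
apply: (le_trans (le _ _ _ _)); first by rewrite invr_eq0.
by rewrite normfV exprVn invrK.
Qed.

(** Borel measurability of an affine map says nothing about preimages of sets of the completion. The
    Caratheodory criterion itself is transported, because the outer measure scales by a constant on
    all sets. This is what keeps [t] admissible after translation and dilation. *)
Lemma measurable_affine_lebesgue (c : R) (y : 'rV[R]_n) : c != 0 ->
  measurable_fun setT
    (affine_rV c y : lebesgue_rVType R n -> lebesgue_rVType R n).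
Proof.
move=> c0 _ A mA; rewrite setTI.
suff H : (mu^*)%mu.-caratheodory (affine_rV c y @^-1` A) by [].
move=> X.
pose Y := affine_rV c^-1 (- (c^-1 *: y)) @^-1` X.
have XY : X = affine_rV c y @^-1` Y.
  rewrite /Y -comp_preimage (_ : _ \o _ = id) ?preimage_id//.
  apply/funext => x /=; rewrite /affine_rV scalerDr !scalerA mulVf//.
  by rewrite !scale1r addrK.
have := mA Y; rewrite XY => /(congr1 (mule (`|c| ^- n)%:E)).
rewrite -(mu_ext_affine y Y c0) => ->.
rewrite ge0_muleDr; try exact: outer_measure_ge0.
by rewrite -!(mu_ext_affine y _ c0).
Qed.

Lemma ge0_integral_affine_lebesgue (c : R) (y : 'rV[R]_n)
    (f : lebesgue_rVType R n -> \bar R) :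
  c != 0 -> measurable_fun setT f -> (forall x, 0 <= f x)%E ->
  (\int[nu]_x f (c *: (x : 'rV[R]_n) + y)%R = (`|c| ^- n)%:E * \int[nu]_x f x)%E.
Proof.
move=> c0 mf f0.
have i0 : 0 <= `|c| ^- n by rewrite invr_ge0 exprn_ge0.
have /= <- := ge0_integral_mscale nu measurableT (NngNum i0)
  mf (fun x _ => f0 x).
rewrite -[LHS](ge0_integral_pushforward (measurable_affine_lebesgue y c0)
  nu measurableT mf) //.
apply: eq_measure_integral => [|mg A mA _]; last exact: mu_ext_affine.
exact: measurable_affine_lebesgue.
Qed.

(** The sigma-algebra is generated by coordinates, not by open sets. Max-norm balls are finite
    intersections of coordinate conditions, and balls with rational centre and radius [1 / (m + 1)]
    form a countable base. *)
Lemma measurable_rV_open (U : set 'rV[R]_n) : open U -> measurable U.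
Proof.
move=> oU.
pose q (v : 'rV[rat]_n * nat) : 'rV[R]_n := map_mx ratr v.1.
pose B (v : 'rV[rat]_n * nat) : set 'rV[R]_n := ball (q v) v.2.+1%:R^-1.
have mB v : measurable (B v).
  rewrite /B (_ : ball _ _ = \bigcap_(i in [set: 'I_n])
     ((fun x : 'rV[R]_n => x ord0 i) @^-1` ball (q v ord0 i) (v.2.+1%:R^-1))).
    apply: fin_bigcap_measurable => // i _.
    rewrite -[X in measurable X]setTI; apply: measurable_coord_rV => //.
    exact: measurable_ball.
  apply/seteqP; split => x /=; first by move=> [? H] i _; exact: H.
  by move=> H; split => // i j; rewrite (ord1 i); exact: H.
have -> : U = \bigcup_(v in [set v | B v `<=` U]) B v.
  apply/seteqP; split => [x Ux|x [v /= + ]]; last exact.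
  have [e /= e0 eU] : nbhs_ball x U by apply/nbhs_ballP; apply: oU.
  (* The radius is taken below [e / 2], so that a ball of this radius whose centre is that close to
     [x] lies in the [e]-ball about [x]. *)
  have [m] := ltr_add_invr (divr_gt0 e0 (ltr0Sn R 1)); rewrite add0r => me.
  have m0 : 0 < m.+1%:R^-1 :> R by rewrite invr_gt0.
  have qx i : exists r : rat, x ord0 i - m.+1%:R^-1 < ratr r < x ord0 i + m.+1%:R^-1.
    have [r] := @rat_in_itvoo _ (x ord0 i - m.+1%:R^-1) (x ord0 i + m.+1%:R^-1)
       ltac:(by rewrite ltrD2l gtrN).
    by rewrite in_itv /=; exists r.
  have [r xr] := fin_all_exists qx.
  have Bx : B (\row_i r i, m) x.
    split => // i j; rewrite (ord1 i) /q !mxE /= /ball /= ltr_distl.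
    exact: (xr j).
  exists (\row_i r i, m) => //= z Bz; apply: eU.
  apply: (@ball_splitr _ _ (q (\row_i r i, m))); last first.
    by apply: le_ball Bz; exact: ltW.
  by apply: le_ball Bx; exact: ltW.
rewrite bigcup_mkcond; apply: countable_bigcupT_measurable => [|v].
  exact: countableP.
by case: ifP.
Qed.

Lemma measurable_rV_continuous (f : 'rV[R]_n -> R) :
  continuous f -> measurable_fun setT f.
Proof.
move=> cf; apply: (measurability _ (RGenOpens.measurableE R)).
move=> _ [_ [a [b ->]] <-]; rewrite setTI; apply: measurable_rV_open.
by move/continuousP : cf; apply; exact: interval_open.
Qed.

End completion.

(** * Smooth functions and bump functions *)

Section quadratic_differentiability.
Context {R : realType} {V : normedModType R}.

(** Differentiability that does not come from algebraic rules is obtained here from an explicit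
    quadratic remainder: for the flat function at 0 and for integrals depending on a parameter. *)
Lemma is_diff_quadratic (f : V -> R) (L : {linear V -> R}) (C : R) (x : V) :
  continuous L ->
  (\forall h \near (0 : V), `|f (h + x) - f x - L h| <= C * `|h| ^+ 2) ->
  is_diff x f L.
Proof.
move=> cL fL.
have E : f \o shift x = cst (f x) + L +o_ (0 : V) id.
  apply/eqaddoP => _/posnumP[e].
  have C0 : 0 < `|C| + 1 by rewrite ltr_wpDl.
  have : \forall h \near (0 : V), `|h| <= e%:num / (`|C| + 1).
    apply/nbhs_ballP; exists (e%:num / (`|C| + 1)) => /=; first by rewrite divr_gt0.
    by move=> h; rewrite -ball_normE /= sub0r normrN => /ltW.
  apply: filterS2 fL => h fh hs /=.
  have -> : (f \o shift x - (cst (f x) + L)) h = f (h + x) - f x - L h.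
    by rewrite /= !fctE /= opprD addrA.
  apply: (le_trans fh); rewrite expr2 mulrA ler_wpM2r//.
  apply: (@le_trans _ _ ((`|C| + 1) * `|h|)).
    by rewrite ler_wpM2r// (le_trans (ler_norm _))// lerDl.
  by rewrite mulrC -ler_pdivlMr.
have dE := diff_unique cL E.
apply: DiffDef => //; apply/diff_locallyP; rewrite dE; split => //.
Qed.

Lemma differentiable_near0 (f g : V -> R) (x : V) :
  (\forall y \near x, f y = g y) -> differentiable f x -> differentiable g x.
Proof.
move=> fg df.
have -> : g = f + (g - f) by apply/funext => y; rewrite !fctE addrC subrK.
apply: differentiableD => //.
suff : is_diff x (g - f) (\0 : {linear V -> R}) by move=> H; exact: ex_diff.
apply: (@is_diff_quadratic _ _ 0); first by move=> y; exact: cst_continuous.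
have fgx0 := nbhs_singleton fg.
have fgx := fg; rewrite (near_shift 0) /= subr0 in fgx.
apply: filterS fgx => h /= fh.
by rewrite !fctE fh fgx0 !subrr normr0 mul0r.
Qed.
End quadratic_differentiability.

(** * Calculus of iterated partial derivatives *)

Section smooth.
Context {R : realType} {n : nat}.
Notation V := 'rV[R]_n.
Implicit Types (f g h : V -> R) (U : set V) (i j : 'I_n).

Lemma partial_near i f g (x : V) :
  (\forall y \near x, f y = g y) -> partial i f x = partial i g x.
Proof. exact: near_eq_derive. Qed.

Lemma partials_rcons s i g : partials (rcons s i) g = partials s (partial i g).
Proof. by rewrite /partials foldr_rcons. Qed.

(** A truncation of [smooth_on] at order [k]: a derivative of a product or composition involves the
    factors again, so closure is proved by induction on the order. *)
Definition smooth_upto (k : nat) U g : Prop :=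
  forall s : seq 'I_n, (size s <= k)%N ->
  forall x, U x -> differentiable (partials s g) x.

Lemma smooth_uptoP U g : smooth_on U g <-> forall k, smooth_upto k U g.
Proof.
by split=> [H k s _ x /H|H s x]; [exact|exact: (H (size s))].
Qed.

Lemma smooth_upto_diff k U g x : smooth_upto k U g -> U x -> differentiable g x.
Proof. by move=> /(_ [::] isT); exact. Qed.

Lemma smooth_upto_partial k U g i : smooth_upto k.+1 U g ->
  smooth_upto k U (partial i g).
Proof.
by move=> H s sk x Ux; rewrite -partials_rcons; apply: H; rewrite ?size_rcons.
Qed.

Lemma smooth_uptoW k U g : smooth_upto k.+1 U g -> smooth_upto k U g.
Proof. by move=> H s sk; apply: H; rewrite ltnW. Qed.

Lemma smooth_upto0 U g : (forall x, U x -> differentiable g x) ->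
  smooth_upto 0 U g.
Proof. by move=> H [|//] _. Qed.

Lemma smooth_uptoS k U g : (forall x, U x -> differentiable g x) ->
  (forall i, smooth_upto k U (partial i g)) -> smooth_upto k.+1 U g.
Proof.
move=> H0 H s; elim/last_ind: s => [|s i _]; first by [].
by rewrite size_rcons ltnS partials_rcons; exact: H.
Qed.

Lemma smooth_on_diff U g x : smooth_on U g -> U x -> differentiable g x.
Proof. by move=> /(_ [::]); exact. Qed.

Lemma smooth_on_partial U g i : smooth_on U g -> smooth_on U (partial i g).
Proof. by move=> H s x Ux; rewrite -partials_rcons; exact: H. Qed.

Lemma smooth_on_partials U g s : smooth_on U g -> smooth_on U (partials s g).
Proof. by move=> H t x Ux; rewrite /partials -foldr_cat; exact: (H (t ++ s)). Qed.

Lemma smooth_onS U U' g : U' `<=` U -> smooth_on U g -> smooth_on U' g.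
Proof. by move=> UU H s x /UU; exact: H. Qed.

Lemma smooth_onU U U' g : smooth_on U g -> smooth_on U' g ->
  smooth_on (U `|` U') g.
Proof. by move=> H H' s x [/H|/H']. Qed.

Section open.
Variables (U : set V) (oU : open U).

Lemma partials_eq_on s f g : (forall x, U x -> f x = g x) ->
  forall x, U x -> partials s f x = partials s g x.
Proof.
move=> fg; elim: s => [|i s IH] x Ux /=; first exact: fg.
by apply: partial_near; apply: (filterS IH); exact: oU.
Qed.

Lemma smooth_upto_eq k f g : (forall x, U x -> f x = g x) ->
  smooth_upto k U f -> smooth_upto k U g.
Proof.
move=> fg H s sk x Ux; apply: differentiable_near0 (H s sk x Ux).
by apply: (filterS (partials_eq_on s fg)); exact: oU.
Qed.

Lemma smooth_on_eq f g : (forall x, U x -> f x = g x) ->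
  smooth_on U f -> smooth_on U g.
Proof.
by move=> fg /smooth_uptoP H; apply/smooth_uptoP => k; apply: smooth_upto_eq (H k).
Qed.

Lemma partial_cst i (c : R) : partial i (cst c) = cst 0.
Proof. by apply/funext => x; rewrite /partial derive_cst. Qed.

Lemma smooth_upto_cst k (c : R) : smooth_upto k U (cst c).
Proof.
elim: k c => [|k IH] c; first by apply: smooth_upto0.
by apply: smooth_uptoS => // i; rewrite partial_cst.
Qed.

Lemma partialD i f g x : differentiable f x -> differentiable g x ->
  partial i (f + g) x = partial i f x + partial i g x.
Proof. by move=> df dg; rewrite /partial deriveD//; exact: diff_derivable. Qed.

Lemma partialM i f g x : differentiable f x -> differentiable g x ->
  partial i (f * g) x = f x * partial i g x + g x * partial i f x.
Proof. by move=> df dg; rewrite /partial deriveM//; exact: diff_derivable. Qed.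

Lemma smooth_uptoD k f g : smooth_upto k U f -> smooth_upto k U g ->
  smooth_upto k U (f + g).
Proof.
elim: k f g => [|k IH] f g sf sg.
  apply: smooth_upto0 => x Ux.
  by apply: differentiableD; [exact: smooth_upto_diff sf Ux|exact: smooth_upto_diff sg Ux].
apply: smooth_uptoS => [x Ux|i].
  by apply: differentiableD; [exact: smooth_upto_diff sf Ux|exact: smooth_upto_diff sg Ux].
apply: (@smooth_upto_eq _ (partial i f + partial i g)).
  move=> x Ux; rewrite partialD//; [exact: smooth_upto_diff sf Ux|exact: smooth_upto_diff sg Ux].
by apply: IH; exact: smooth_upto_partial.
Qed.

Lemma smooth_uptoM k f g : smooth_upto k U f -> smooth_upto k U g ->
  smooth_upto k U (f * g).
Proof.
elim: k f g => [|k IH] f g sf sg.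
  apply: smooth_upto0 => x Ux.
  by apply: differentiableM; [exact: smooth_upto_diff sf Ux|exact: smooth_upto_diff sg Ux].
apply: smooth_uptoS => [x Ux|i].
  by apply: differentiableM; [exact: smooth_upto_diff sf Ux|exact: smooth_upto_diff sg Ux].
apply: (@smooth_upto_eq _ (f * partial i g + g * partial i f)).
  move=> x Ux; rewrite partialM//; [exact: smooth_upto_diff sf Ux|exact: smooth_upto_diff sg Ux].
by apply: smooth_uptoD; apply: IH; (exact: smooth_upto_partial || exact: smooth_uptoW).
Qed.

Lemma differentiable_comp1 (F : R -> R) (F' : R) f x :
  is_derive (f x) 1 F F' -> differentiable f x -> differentiable (F \o f) x.
Proof.
move=> dF df; apply: differentiable_comp => //.
by apply/derivable1_diffP; case: dF.
Qed.

Lemma partial_comp1 (F : R -> R) (F' : R) f x i :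
  is_derive (f x) 1 F F' -> differentiable f x ->
  partial i (F \o f) x = F' * partial i f x.
Proof.
move=> dF df.
have DF : differentiable F (f x) by apply/derivable1_diffP; case: dF.
rewrite /partial deriveE; last exact: differentiable_comp.
rewrite diff_comp//= diff1E// derive1E (@derive_val _ _ _ _ _ _ _ dF).
by rewrite deriveE// mulrC.
Qed.

(* [P] is a class of one-variable functions closed under derivation on [D]. *)
Lemma smooth_upto_comp (P : (R -> R) -> Prop) (D : set R) :
  (forall F, P F -> exists2 F', P F' & forall t, D t -> is_derive t 1 F (F' t)) ->
  forall k F f, P F -> (forall x, U x -> D (f x)) -> smooth_upto k U f ->
  smooth_upto k U (F \o f).
Proof.
move=> PD; elim=> [|k IH] F f PF Df sf; have [F' PF' FF'] := PD F PF.
  apply: smooth_upto0 => x Ux; apply: differentiable_comp1 (smooth_upto_diff sf Ux).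
  by apply: FF'; exact: Df.
apply: smooth_uptoS => [x Ux|i].
  apply: differentiable_comp1 (smooth_upto_diff sf Ux).
  by apply: FF'; exact: Df.
apply: (@smooth_upto_eq _ ((F' \o f) * partial i f)).
  move=> x Ux; rewrite (partial_comp1 i (FF' _ (Df _ Ux)))//.
  exact: smooth_upto_diff sf Ux.
apply: smooth_uptoM; last exact: smooth_upto_partial.
by apply: IH => //; exact: smooth_uptoW.
Qed.

Lemma smooth_on_cst (c : R) : smooth_on U (cst c).
Proof. by apply/smooth_uptoP => k; exact: smooth_upto_cst. Qed.

Lemma smooth_onD f g : smooth_on U f -> smooth_on U g -> smooth_on U (f + g).
Proof.
move=> /smooth_uptoP sf /smooth_uptoP sg; apply/smooth_uptoP => k.
exact: smooth_uptoD.
Qed.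

Lemma smooth_onM f g : smooth_on U f -> smooth_on U g -> smooth_on U (f * g).
Proof.
move=> /smooth_uptoP sf /smooth_uptoP sg; apply/smooth_uptoP => k.
exact: smooth_uptoM.
Qed.

Lemma smooth_onZ (c : R) f : smooth_on U f -> smooth_on U (fun x => c * f x).
Proof. by move=> sf; apply: (@smooth_onM (cst c)) => //; exact: smooth_on_cst. Qed.

Lemma smooth_on_comp (P : (R -> R) -> Prop) (D : set R) F f :
  (forall F, P F -> exists2 F', P F' & forall t, D t -> is_derive t 1 F (F' t)) ->
  P F -> (forall x, U x -> D (f x)) -> smooth_on U f -> smooth_on U (F \o f).
Proof.
move=> PD PF Df /smooth_uptoP sf; apply/smooth_uptoP => k.
exact: (smooth_upto_comp PD).
Qed.

Lemma smooth_on_prod (I : Type) (r : seq I) (F : I -> V -> R) :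
  (forall k, smooth_on U (F k)) -> smooth_on U (fun x => \prod_(i <- r) F i x).
Proof.
move=> sF; elim: r => [|i r IH].
  by under [X in smooth_on _ X]eq_fun do rewrite big_nil; exact: smooth_on_cst.
under [X in smooth_on _ X]eq_fun do rewrite big_cons.
exact: smooth_onM.
Qed.

Lemma smooth_on_sum (I : Type) (r : seq I) (F : I -> V -> R) :
  (forall k, smooth_on U (F k)) -> smooth_on U (fun x => \sum_(i <- r) F i x).
Proof.
move=> sF; elim: r => [|i r IH].
  by under [X in smooth_on _ X]eq_fun do rewrite big_nil; exact: smooth_on_cst.
under [X in smooth_on _ X]eq_fun do rewrite big_cons.
exact: smooth_onD.
Qed.

Lemma partial_coord i j (x : V) :
  partial i (fun y : V => y ord0 j) x = (i == j)%:R.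
Proof.
rewrite /partial /derive; apply: cvg_lim => //.
apply: (@cvg_trans _ (cst (i == j)%:R @ (0 : R)^')); last exact: cvg_cst.
apply: near_eq_cvg; near=> h.
rewrite /cst /= !mxE eqxx /= addrK [_ *: _]mulrA mulVf ?mul1r//.
  by rewrite eq_sym.
near: h; exact: nbhs_dnbhs_neq.
Unshelve. all: by end_near. Qed.

Lemma smooth_on_coord j : smooth_on U (fun y : V => y ord0 j).
Proof.
apply/smooth_uptoP => -[|k].
  by apply: smooth_upto0 => x _; exact: differentiable_coord.
apply: smooth_uptoS => [x _|i]; first exact: differentiable_coord.
rewrite (_ : partial i _ = cst (i == j)%:R); first exact: smooth_upto_cst.
by apply/funext => x; rewrite partial_coord.
Qed.

Lemma smooth_on_dotprod (x : V) : smooth_on U (dotprod x).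
Proof.
apply: smooth_on_sum => j.
by apply: smooth_onZ; exact: smooth_on_coord.
Qed.

(** The shifted cosines [cos (t + d)] form a class closed under derivation, since differentiating
    adds [pi / 2] to the phase. *)
Lemma smooth_on_cos f : smooth_on U f -> smooth_on U (fun x => cos (f x)).
Proof.
move=> sf; apply: (@smooth_on_comp
  (fun F => exists d, F = fun t => cos (t + d)) setT cos) => //.
  move=> _ [d ->]; exists (fun t => cos (t + (d + pi / 2))).
    by exists (d + pi / 2).
  move=> t _; rewrite addrA cosDpihalf.
  have g1 : is_derive t (1 : R) (fun u : R => u + d) (1 + 0) by exact: is_deriveD.
  have := @is_derive1_comp R cos (fun u => u + d) t _ _ (is_derive_cos (t + d)) g1.
  by rewrite addr0 mulr1.
by exists 0; apply/funext => t; rewrite addr0.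
Qed.
End open.

Lemma partial_dotprod i (x y : V) : partial i (dotprod x) y = x ord0 i.
Proof.
rewrite /dotprod /partial.
have -> : (fun y0 : V => \sum_i0 x ord0 i0 * y0 ord0 i0) =
   \sum_(j < n) (fun y0 : V => x ord0 j * y0 ord0 j).
  by apply/funext => z; rewrite fct_sumE.
rewrite derive_sum; last first.
  move=> j; apply/diff_derivable/(smooth_on_diff (U := setT)) => //.
  by apply: smooth_onZ; [exact: openT|exact: smooth_on_coord].
rewrite (bigD1 i)//= big1 ?addr0.
  have := @partialM i (cst (x ord0 i)) (fun y : V => y ord0 i) y.
  rewrite /partial => ->; [|by []|exact: differentiable_coord].
  by rewrite derive_cst mulr0 addr0 /=; have := partial_coord i i y; rewrite /partial => ->; rewrite eqxx mulr1.
move=> j ji; have := @partialM i (cst (x ord0 j)) (fun y : V => y ord0 j) y.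
rewrite /partial => ->; [|by []|exact: differentiable_coord].
rewrite derive_cst mulr0 addr0 /=; have := partial_coord i j y; rewrite /partial => ->.
by rewrite eq_sym (negbTE ji) mulr0.
Qed.

Lemma smooth_on0 (U : set V) f : open U -> (forall x, U x -> f x = 0) ->
  smooth_on U f.
Proof.
move=> oU f0; apply: (@smooth_on_eq U oU (cst 0)); last exact: smooth_on_cst.
by move=> x /f0.
Qed.

Lemma smooth_on_continuous f : smooth_on setT f -> continuous f.
Proof. by move=> sf x; apply/differentiable_continuous/(smooth_on_diff sf). Qed.

End smooth.

(** * Flat functions and smooth cutoffs *)

Section bump.
Context {R : realType}.

(** [t^-m exp (- 1 / t)] on the positive axis: the powers [t^-m] are those created by
    differentiating the case [m = 0]. *)
Definition flat_exp (m : nat) (t : R) : R :=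
  if 0 < t then t^-1 ^+ m * expR (- t^-1) else 0.

Lemma flat_exp_ge0 m t : 0 <= flat_exp m t.
Proof.
rewrite /flat_exp; case: ifPn => // t0.
by rewrite mulr_ge0 ?expR_ge0// exprn_ge0// invr_ge0 ltW.
Qed.

(* [expR (k * y) = expR y ^+ k >= y ^+ k], at [y = (k t)^-1] with [k = m.+2]. *)
Lemma flat_exp_le m t : flat_exp m t <= (m.+2%:R ^+ m.+2) * t ^+ 2.
Proof.
rewrite /flat_exp; case: ifPn => t0; last first.
  by apply: mulr_ge0; [exact: exprn_ge0|exact: sqr_ge0].
have k0 : 0 < m.+2%:R :> R by [].
rewrite expRN ler_pdivrMr ?expR_gt0//.
have tE : t^-1 = m.+2%:R * (m.+2%:R * t)^-1 by field; rewrite !gt_eqF.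
rewrite [in X in _ * expR X]tE expRM_natl.
apply: (@le_trans _ _ ((m.+2%:R ^+ m.+2) * t ^+ 2 * ((m.+2%:R * t)^-1) ^+ m.+2)).
  rewrite !exprVn exprMn; have : m.+2%:R ^+ m.+2 != 0 :> R by rewrite expf_neq0// gt_eqF.
  set K := _ ^+ m.+2 => K0.
  have -> : t ^+ m.+2 = t ^+ 2 * t ^+ m by rewrite -exprD add2n.
  have tm : t ^+ m != 0 by rewrite expf_neq0// gt_eqF.
  rewrite le_eqVlt; apply/orP; left; apply/eqP; field.
  by rewrite K0 tm gt_eqF.
rewrite ler_wpM2l//; first by apply: mulr_ge0; [exact: exprn_ge0|exact: sqr_ge0].
rewrite lerXn2r ?nnegrE ?expR_ge0//; first by rewrite invr_ge0 mulr_ge0// ltW.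
by rewrite (le_trans _ (expR_ge1Dx _))// lerDr.
Qed.

Lemma is_derive_exprn m (t : R) :
  is_derive t (1 : R) (fun y : R => y ^+ m) (m%:R * t ^+ m.-1).
Proof.
apply: DeriveDef; first exact: exprn_derivable.
by rewrite exp_derive /GRing.scale /= mulr1.
Qed.

Lemma is_derive_inv (t : R) : t != 0 ->
  is_derive t (1 : R) (fun s : R => s^-1) (- t^-1 ^+ 2).
Proof.
move=> t0; apply: is_derive_eq.
  by apply: is_deriveV => //; exact: is_derive_id.
by rewrite /GRing.scale /= mulr1 exprVn.
Qed.

Lemma is_derive_flat_exp m (t : R) :
  is_derive t (1 : R) (flat_exp m) (- m%:R * flat_exp m.+1 t + flat_exp m.+2 t).
Proof.
have [t0|t0|->] := ltrgtP t 0.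
- rewrite /flat_exp !ifF ?ltNge ?(ltW t0)// mulr0 addr0.
  have d0 : is_derive t (1 : R) (cst (0 : R)) (0 : R) by exact: is_derive_cst.
  apply: near_eq_is_derive d0.
  near=> s; rewrite /flat_exp ifF//; apply/negbTE; rewrite -leNgt.
  apply: ltW; near: s; exact: lt_nbhsl.
- have tn0 : t != 0 by rewrite gt_eqF.
  rewrite /flat_exp !t0.
  apply: (@near_eq_is_derive _ _ _ (fun s : R => s^-1 ^+ m * expR (- s^-1))).
    near=> s; rewrite /flat_exp ifT//; near: s; exact: lt_nbhsr.
  have dV := is_derive_inv tn0.
  have dP : is_derive t^-1 (1 : R) (fun y : R => y ^+ m * expR (- y))
     ((m%:R * t^-1 ^+ m.-1 - t^-1 ^+ m) * expR (- t^-1)).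
    have dE : is_derive t^-1 (1 : R) (fun y : R => expR (- y)) (- expR (- t^-1)).
      have := @is_derive1_comp R expR (fun y => - y) t^-1 _ _ (is_derive_expR _)
         (is_deriveNid _ _).
      by rewrite mulrN1.
    have dX : is_derive t^-1 (1 : R) (fun y : R => y ^+ m) (m%:R * t^-1 ^+ m.-1).
      exact: is_derive_exprn.
    have dM : is_derive t^-1 (1 : R) (fun y : R => y ^+ m * expR (- y))
       (t^-1 ^+ m *: (- expR (- t^-1)) + expR (- t^-1) *: (m%:R * t^-1 ^+ m.-1)).
      exact: (is_deriveM dX dE).
    apply: (is_derive_eq dM).
    by rewrite /GRing.scale /=; ring.
  apply: (is_derive_eq (is_derive1_comp dP dV)).
  case: m {dP} => [|m] /=; rewrite ?expr0 !exprS; ring.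
(* At 0 both terms of the claimed derivative vanish, and [flat_exp_le] is the quadratic remainder
   bound for the zero linear map. *)
- rewrite /flat_exp !ltxx mulr0 addr0 -/(flat_exp m).
  have d0 : is_diff (0 : R) (flat_exp m) (\0 : {linear R -> R}).
    apply: (@is_diff_quadratic _ _ _ _ (m.+2%:R ^+ m.+2)).
      by move=> y; exact: cst_continuous.
    near=> h; rewrite addr0 {2}/flat_exp ltxx !subr0 ger0_norm ?flat_exp_ge0//.
    by rewrite real_normK ?num_real// flat_exp_le.
  have df : derivable (flat_exp m) 0 1 by apply/derivable1_diffP; exact: ex_diff.
  by apply: DeriveDef => //; rewrite deriveE ?diff_val//; exact: ex_diff.
Unshelve. all: by end_near. Qed.

(** The linear span of the [flat_exp m], used as the derivation-closed class required by
    [smooth_on_comp]. *)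
Inductive flat_class : (R -> R) -> Prop :=
| flat_class_exp m : flat_class (flat_exp m)
| flat_classD f g : flat_class f -> flat_class g -> flat_class (fun t => f t + g t)
| flat_classZ c f : flat_class f -> flat_class (fun t => c * f t).

Lemma flat_class_derive f : flat_class f ->
  exists2 f', flat_class f' & forall t, setT t -> is_derive t (1 : R) f (f' t).
Proof.
elim=> {f} [m|f g _ [f' cf ff'] _ [g' cg gg']|c f _ [f' cf ff']].
- exists (fun t => - m%:R * flat_exp m.+1 t + flat_exp m.+2 t).
    by apply: flat_classD; [apply: flat_classZ|]; exact: flat_class_exp.
  by move=> t _; exact: is_derive_flat_exp.
- exists (fun t => f' t + g' t); first exact: flat_classD.
  by move=> t _; apply: is_deriveD; [exact: ff'|exact: gg'].
- exists (fun t => c * f' t); first exact: flat_classZ.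
  by move=> t _; apply: is_deriveZ; exact: ff'.
Qed.

Definition step (t : R) : R := flat_exp 0 t / (flat_exp 0 t + flat_exp 0 (1 - t)).

Lemma flat_exp_gt0 m t : 0 < t -> 0 < flat_exp m t.
Proof.
by move=> t0; rewrite /flat_exp t0 mulr_gt0 ?expR_gt0// exprn_gt0// invr_gt0.
Qed.

Lemma step_den_gt0 t : 0 < flat_exp 0 t + flat_exp 0 (1 - t).
Proof.
have [t0|t0] := ltrP 0 t; first by rewrite ltr_wpDr ?flat_exp_gt0// flat_exp_ge0.
by rewrite ltr_wpDl ?flat_exp_ge0// flat_exp_gt0//; lra.
Qed.

Lemma step_ge0 t : 0 <= step t.
Proof. by rewrite /step divr_ge0 ?flat_exp_ge0// ltW// step_den_gt0. Qed.

Lemma step_le1 t : step t <= 1.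
Proof.
by rewrite /step ler_pdivrMr ?step_den_gt0// mul1r lerDl flat_exp_ge0.
Qed.

Lemma step0 t : t <= 0 -> step t = 0.
Proof. by move=> t0; rewrite /step /flat_exp ltNge t0 mul0r. Qed.

Lemma step1 t : 1 <= t -> step t = 1.
Proof.
move=> t1; have := step_den_gt0 t; rewrite /step.
have -> : flat_exp 0 (1 - t) = 0 by rewrite /flat_exp ifF//; apply/negbTE; lra.
by rewrite addr0 => ?; rewrite divff// gt_eqF.
Qed.

Definition bump1 (t : R) : R := step (2 - t) * step (2 + t).

Lemma bump1_ge0 t : 0 <= bump1 t.
Proof. by rewrite mulr_ge0 ?step_ge0. Qed.

Lemma bump1_le1 t : bump1 t <= 1.
Proof. by rewrite mulr_ile1 ?step_ge0 ?step_le1. Qed.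

Lemma bump1_eq1 t : `|t| <= 1 -> bump1 t = 1.
Proof. by rewrite ler_norml => /andP[? ?]; rewrite /bump1 !step1 ?mul1r//; lra. Qed.

Lemma bump1_eq0 t : 2 <= `|t| -> bump1 t = 0.
Proof.
rewrite /bump1 ler_normr => /orP[?|?]; first by rewrite step0 ?mul0r//; lra.
by rewrite (@step0 (2 + t)) ?mulr0//; lra.
Qed.

End bump.

Section bump_rV.
Context {R : realType} {n : nat}.
Notation V := 'rV[R]_n.

Lemma smooth_on_inv (U : set V) f : open U -> (forall x, U x -> f x != 0) ->
  smooth_on U f -> smooth_on U (fun x => (f x)^-1).
Proof.
move=> oU f0 sf; apply: (@smooth_on_comp R n U oU
  (fun F => exists c m, F = fun t => c * t^-1 ^+ m) [set t | t != 0]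
  (fun t => t^-1) f) => //; last first.
  by exists 1, 1%N; apply/funext => t; rewrite mul1r.
move=> _ [c [m ->]]; exists (fun t => (- m%:R * c) * t^-1 ^+ m.+1).
  by exists (- m%:R * c), m.+1.
move=> t /= t0.
have dX := is_derive1_comp (is_derive_exprn m t^-1) (is_derive_inv t0).
have dZ : is_derive t (1 : R) (fun t1 => c * t1^-1 ^+ m)
    (c * (m%:R * t^-1 ^+ m.-1 * - t^-1 ^+ 2)) by apply: is_deriveZ; exact: dX.
apply: (is_derive_eq dZ).
case: m {dX dZ} => [|m] /=; rewrite ?expr0 !exprS ?mulr0n; ring.
Qed.

Lemma smooth_on_subl (U : set V) (k : R) f : open U -> smooth_on U f ->
  smooth_on U (fun x => k - f x).
Proof.
move=> oU sf; apply: (@smooth_on_eq _ _ U oU (cst k + (fun x => -1 * f x))).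
  by move=> x _; rewrite !fctE mulN1r.
by apply: smooth_onD => //; [exact: smooth_on_cst|exact: smooth_onZ].
Qed.

Lemma smooth_on_step (U : set V) f : open U -> smooth_on U f ->
  smooth_on U (fun x => step (f x)).
Proof.
move=> oU sf.
have sE g : smooth_on U g -> smooth_on U (fun x => flat_exp 0 (g x)).
  move=> sg; apply: (@smooth_on_comp _ _ U oU _ setT (flat_exp 0) g flat_class_derive) => //.
  exact: flat_class_exp.
have s1f : smooth_on U (fun x => 1 - f x) by exact: smooth_on_subl.
apply: (smooth_onM oU (sE _ sf)); apply: smooth_on_inv => //.
  by move=> x _; rewrite gt_eqF// step_den_gt0.
by apply: smooth_onD; [|exact: sE|exact: sE].
Qed.

(** A product over the coordinates, so that plateau and support are cubes, that is, balls of the max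
    norm. *)
Definition bump (x : V) : R := \prod_i bump1 (x ord0 i).

Lemma smooth_on_bump (c : R) : smooth_on setT (fun x => bump (c *: x)).
Proof.
have oT : open [set: V] by exact: openT.
apply: smooth_on_prod => // i.
have sc : smooth_on setT (fun x : V => (c *: x) ord0 i).
  have -> : (fun x : V => (c *: x) ord0 i) = (fun x => c * x ord0 i).
    by apply/funext => x; rewrite mxE.
  by apply: smooth_onZ => //; exact: smooth_on_coord.
have sc2 : smooth_on setT (fun x : V => 2 + (c *: x) ord0 i).
  by apply: (@smooth_onD _ _ _ oT (cst 2)) => //; exact: smooth_on_cst.
have sc1 : smooth_on setT (fun x : V => 2 - (c *: x) ord0 i).
  exact: smooth_on_subl.
by apply: smooth_onM => //; apply: smooth_on_step.
Qed.

Lemma normr_coord (x : V) i : `|x ord0 i| <= `|x|.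
Proof.
by rewrite [leRHS]/Num.norm /= mx_normrE; apply: (le_bigmax _ (fun ij : 'I_1 * 'I_n => `|x ij.1 ij.2|) (ord0, i)).
Qed.

Lemma normr_rV_le (x : V) (r : R) : 0 <= r -> (forall i, `|x ord0 i| <= r) -> `|x| <= r.
Proof.
move=> r0 xr; rewrite [leLHS]/Num.norm /= mx_normrE.
by apply: bigmax_le => // -[i j] _ /=; rewrite (ord1 i).
Qed.

Lemma normr_rV_lt (x : V) (r : R) : 0 < r -> (forall i, `|x ord0 i| < r) -> `|x| < r.
Proof.
move=> r0 xr; rewrite [ltLHS]/Num.norm /= mx_normrE.
by apply: bigmax_lt => // -[i j] _ /=; rewrite (ord1 i).
Qed.

Lemma bump_ge0 x : 0 <= bump x.
Proof. by apply: prodr_ge0 => i _; exact: bump1_ge0. Qed.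

Lemma bump_le1 x : bump x <= 1.
Proof. by apply: prodr_ile1 => i _; rewrite bump1_ge0 bump1_le1. Qed.

Lemma bump_eq1 x : `|x| <= 1 -> bump x = 1.
Proof.
move=> x1; rewrite /bump big1// => i _; apply: bump1_eq1.
exact: le_trans (normr_coord _ _) x1.
Qed.

Lemma bump_eq0 x : 2 <= `|x| -> bump x = 0.
Proof.
move=> x2; have [i xi] : exists i, 2 <= `|x ord0 i|.
  apply/existsP; apply: contraTT x2 => /existsPn H; rewrite -ltNge.
  by apply: normr_rV_lt => // i; have := H i; rewrite -ltNge.
by rewrite /bump (bigD1 i)//= bump1_eq0// mul0r.
Qed.

End bump_rV.

(** * Complex-valued integrals *)

Notation normc := (@Normc.normc _).
Notation Re := (@complex.Re _).
Notation Im := (@complex.Im _).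

Section complex_facts.
Context {R : realType}.
Implicit Types a b z : R[i].

Lemma complex_ext a b : Re a = Re b -> Im a = Im b -> a = b.
Proof. by case: a b => [? ?] [? ?] /= -> ->. Qed.

Lemma ReD a b : Re (a + b) = Re a + Re b. Proof. by case: a b => [? ?] []. Qed.
Lemma ImD a b : Im (a + b) = Im a + Im b. Proof. by case: a b => [? ?] []. Qed.

Lemma ReM a b : Re (a * b) = Re a * Re b - Im a * Im b.
Proof. by case: a b => [? ?] []. Qed.
Lemma ImM a b : Im (a * b) = Re a * Im b + Im a * Re b.
Proof. by case: a b => [? ?] []. Qed.

Lemma normcE z : normc z = Num.sqrt (Re z ^+ 2 + Im z ^+ 2).
Proof. by case: z. Qed.

Lemma normc_ge0 z : 0 <= normc z.
Proof. by rewrite normcE sqrtr_ge0. Qed.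

Lemma sqr_normc z : normc z ^+ 2 = Re z ^+ 2 + Im z ^+ 2.
Proof. by rewrite normcE sqr_sqrtr// addr_ge0// sqr_ge0. Qed.

Lemma normc_Re z : `|Re z| <= normc z.
Proof. by rewrite normcE -sqrtr_sqr ler_wsqrtr// lerDl sqr_ge0. Qed.

Lemma normc_Im z : `|Im z| <= normc z.
Proof. by rewrite normcE -sqrtr_sqr ler_wsqrtr// lerDr sqr_ge0. Qed.

Lemma normc_le z : normc z <= `|Re z| + `|Im z|.
Proof.
rewrite normcE -[leRHS]ger0_norm ?addr_ge0// -sqrtr_sqr ler_wsqrtr//.
by rewrite sqrrD !real_normK ?num_real// lerD2r lerDl mulrn_wge0// mulr_ge0.
Qed.

Lemma normc_real (r : R) : normc (r%:C)%C = `|r|.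
Proof. by rewrite normcE /= expr0n addr0 sqrtr_sqr. Qed.

Lemma normc_expi (t : R) : normc (expi t) = 1.
Proof. by rewrite normcE /= cos2Dsin2 sqrtr1. Qed.

Lemma expiD (s t : R) : expi (s + t) = expi s * expi t.
Proof. by apply: complex_ext; rewrite ?ReM ?ImM /= ?cosD ?sinD// addrC mulrC. Qed.

Lemma normc_conj z : normc (z^*)%C = normc z.
Proof. by rewrite !normcE; case: z => a b /=; rewrite sqrrN. Qed.

Lemma mulC_conj z : (z^*)%C * z = ((normc z ^+ 2)%:C)%C.
Proof. by apply: complex_ext; rewrite ?ReM ?ImM sqr_normc; case: z => a b /=; ring. Qed.

Lemma conjCM a b : ((a * b)^*)%C = (a^*)%C * (b^*)%C.
Proof. by case: a b => [? ?] [? ?]; apply: complex_ext => /=; ring. Qed.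

Lemma conj_expi (t : R) : ((expi t)^*)%C = expi (- t).
Proof. by apply: complex_ext; rewrite /= ?cosN ?sinN. Qed.

Lemma ReZ (r : R) z : Re ((r%:C)%C * z) = r * Re z.
Proof. by case: z => ? ? /=; rewrite mul0r subr0. Qed.

Lemma ImZ (r : R) z : Im ((r%:C)%C * z) = r * Im z.
Proof. by case: z => ? ? /=; rewrite mul0r addr0. Qed.
End complex_facts.

Section cint.
Context d {T : measurableType d} {R : realType} (m : {measure set T -> \bar R}).
Implicit Types (g h : T -> R[i]).

Definition cmeas g :=
  measurable_fun setT (Re \o g) /\ measurable_fun setT (Im \o g).

(** The componentwise integral of [integralC] over an arbitrary measure; below it is taken over [mu]
    and also over a time variable. *)
Definition cint g : R[i] :=
  ((\int[m]_x Re (g x)) +i* (\int[m]_x Im (g x)))%C.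

Definition cintegrable g :=
  cmeas g /\ (\int[m]_x (normc (g x))%:E < +oo)%E.

Lemma cmeas_cst (c : R[i]) : cmeas (cst c).
Proof. by split; exact: measurable_cst. Qed.

Lemma cmeasD g h : cmeas g -> cmeas h -> cmeas (fun x => g x + h x).
Proof.
move=> [rg ig] [rh ih]; split.
  have -> : Re \o (fun x => g x + h x) = (Re \o g) \+ (Re \o h).
    by apply/funext => x; rewrite /= ReD.
  exact: measurable_funD.
have -> : Im \o (fun x => g x + h x) = (Im \o g) \+ (Im \o h).
  by apply/funext => x; rewrite /= ImD.
exact: measurable_funD.
Qed.

Lemma cmeasM g h : cmeas g -> cmeas h -> cmeas (fun x => g x * h x).
Proof.
move=> [rg ig] [rh ih]; split.
  have -> : Re \o (fun x => g x * h x) =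
      (fun x => (Re \o g) x * (Re \o h) x - (Im \o g) x * (Im \o h) x).
    by apply/funext => x; rewrite /= ReM.
  by apply: measurable_funB; exact: measurable_funM.
have -> : Im \o (fun x => g x * h x) =
    (fun x => (Re \o g) x * (Im \o h) x + (Im \o g) x * (Re \o h) x).
  by apply/funext => x; rewrite /= ImM.
by apply: measurable_funD; exact: measurable_funM.
Qed.

Lemma cmeas_real (f : T -> R) : measurable_fun setT f ->
  cmeas (fun x => ((f x)%:C)%C).
Proof. by move=> mf; split => //; exact: measurable_cst. Qed.

Lemma cmeas_conj g : cmeas g -> cmeas (fun x => ((g x)^*)%C).
Proof.
move=> [rg ig]; split.
  by rewrite (_ : _ \o _ = Re \o g)//; apply/funext => x /=; case: (g x).
rewrite (_ : _ \o _ = -%R \o (Im \o g)); last first.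
  by apply/funext => x /=; case: (g x).
exact: measurableT_comp.
Qed.

Lemma measurable_normc g : cmeas g -> measurable_fun setT (normc \o g).
Proof.
move=> [rg ig]; rewrite (_ : _ \o _ =
    (@Num.sqrt R) \o (fun x => (Re \o g) x ^+ 2 + (Im \o g) x ^+ 2)); last first.
  by apply/funext => x /=; rewrite normcE.
apply: measurableT_comp.
  by apply: continuous_measurable_fun; exact: sqrt_continuous.
by apply: measurable_funD; exact: measurable_funX.
Qed.

Lemma cmeas_expi (f : T -> R) : measurable_fun setT f ->
  cmeas (fun x => expi (f x)).
Proof.
move=> mf; split.
  apply: (measurableT_comp (f := cos)) => //.
  by apply: continuous_measurable_fun; exact: continuous_cos.
apply: (measurableT_comp (f := sin)) => //.
by apply: continuous_measurable_fun; exact: continuous_sin.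
Qed.

Lemma cintegrable_le g (h : T -> R) : cmeas g ->
  (forall x, normc (g x) <= h x) -> m.-integrable setT (EFin \o h) ->
  cintegrable g.
Proof.
move=> mg gh ih; split => //; have /integrableP[mh] := ih.
apply: le_lt_trans; apply: ge0_le_integral => //.
- by move=> x _; rewrite lee_fin normc_ge0.
- by apply/measurable_EFinP; exact: measurable_normc.
- exact: measurableT_comp.
- by move=> x _ /=; rewrite lee_fin (le_trans (gh x))// ler_norm.
Qed.

Lemma cintegrable_norm g : cintegrable g ->
  m.-integrable setT (EFin \o normc \o g).
Proof.
move=> [mg ig]; apply/integrableP; split.
  by apply/measurable_EFinP; exact: measurable_normc.
by under eq_integral do rewrite /= ger0_norm ?normc_ge0//.
Qed.

Lemma cintegrable_Re g : cintegrable g -> m.-integrable setT (EFin \o Re \o g).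
Proof.
move=> ig; have := cintegrable_norm ig; apply: le_integrable => //.
  by apply/measurable_EFinP; case: ig => -[].
by move=> x _ /=; rewrite lee_fin [leRHS]ger0_norm ?normc_ge0// normc_Re.
Qed.

Lemma cintegrable_Im g : cintegrable g -> m.-integrable setT (EFin \o Im \o g).
Proof.
move=> ig; have := cintegrable_norm ig; apply: le_integrable => //.
  by apply/measurable_EFinP; case: ig => -[].
by move=> x _ /=; rewrite lee_fin [leRHS]ger0_norm ?normc_ge0// normc_Im.
Qed.

Lemma eq_cint g h : g =1 h -> cint g = cint h.
Proof. by move=> /funext ->. Qed.

Lemma cintD g h : cintegrable g -> cintegrable h ->
  cint (fun x => g x + h x) = cint g + cint h.
Proof.
move=> ig ih; apply: complex_ext; rewrite ?ReD ?ImD /=.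
  under eq_Rintegral do rewrite ReD.
  by rewrite RintegralD//; exact: cintegrable_Re.
under eq_Rintegral do rewrite ImD.
by rewrite RintegralD//; exact: cintegrable_Im.
Qed.

Lemma cintZ (c : R[i]) g : cintegrable g -> cint (fun x => c * g x) = c * cint g.
Proof.
move=> ig; have ir := cintegrable_Re ig; have ii := cintegrable_Im ig.
have Z (k : R) f : m.-integrable setT (EFin \o f) ->
    m.-integrable setT (EFin \o (fun x => k * f x)).
  by move=> /(integrableZl measurableT k); apply: eq_integrable.
apply: complex_ext; rewrite ?ReM ?ImM /=.
  under eq_Rintegral do rewrite ReM.
  by rewrite RintegralB ?RintegralZl//; exact: Z.
under eq_Rintegral do rewrite ImM.
by rewrite RintegralD ?RintegralZl//; exact: Z.
Qed.

Lemma cint_real (f : T -> R) : cint (fun x => ((f x)%:C)%C) = ((\int[m]_x f x)%:C)%C.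
Proof. by apply: complex_ext => //=; rewrite /Rintegral integral0. Qed.

(* Rotate by the unit complex number that makes the integral nonnegative. *)
Lemma normc_cint_le g : cintegrable g ->
  ((normc (cint g))%:E <= \int[m]_x (normc (g x))%:E)%E.
Proof.
move=> ig; set I := cint g.
have [I0|In0] := eqVneq (normc I) 0.
  by rewrite I0; apply: integral_ge0 => x _; rewrite lee_fin normc_ge0.
pose u : R[i] := (((normc I)^-1)%:C)%C * (I^*)%C.
have nu : normc u = 1.
  rewrite /u Normc.normcM normc_real normc_conj ger0_norm ?invr_ge0 ?normc_ge0//.
  by rewrite mulVf.
have uI : u * I = ((normc I)%:C)%C.
  rewrite /u -mulrA mulC_conj; apply: complex_ext; rewrite ?ReZ ?ImZ /= ?mulr0//.
  by rewrite expr2 mulrA mulVf ?mul1r.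
have iug : cintegrable (fun x => u * g x).
  apply: (@cintegrable_le _ (normc \o g)).
  - by apply: cmeasM; [exact: cmeas_cst|case: ig].
  - by move=> x; rewrite Normc.normcM nu mul1r.
  - exact: cintegrable_norm.
have : Re (cint (fun x => u * g x)) = normc I by rewrite cintZ// -/I uI.
rewrite /= => <-.
have ir := cintegrable_Re iug.
rewrite /Rintegral fineK; last exact: integrable_fin_num.
apply: le_integral => //; first exact: cintegrable_norm.
move=> x _ /=; rewrite lee_fin (le_trans (ler_norm _))// (le_trans (normc_Re _))//.
by rewrite Normc.normcM nu mul1r.
Qed.

Lemma Rintegral_dominated_cvg (f_ : nat -> T -> R) (f h : T -> R) :
  (forall k, measurable_fun setT (f_ k)) -> measurable_fun setT f ->
  (forall x, f_ ^~ x @ \oo --> f x) ->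
  m.-integrable setT (EFin \o h) -> (forall k x, `|f_ k x| <= h x) ->
  (fun k => \int[m]_x f_ k x) @ \oo --> \int[m]_x f x.
Proof.
move=> mf_ mf ff ih fh; apply: fine_cvg; rewrite fineK; last first.
  apply: integrable_fin_num => //; apply: le_integrable ih => //.
    exact/measurable_EFinP.
  move=> x _ /=; rewrite lee_fin (le_trans _ (ler_norm _))//.
  by apply: (cvgr_to_le (cvg_norm (ff x))); exact: nearW.
apply: (@dominated_cvg _ _ _ m setT measurableT
   (fun k x => (f_ k x)%:E) (EFin \o f) (EFin \o h)) => //.
- by move=> k; exact/measurable_EFinP.
- by move=> x _; apply: cvg_EFin; [exact: nearW|exact: ff].
- by move=> k x _ /=; rewrite lee_fin.
Qed.

End cint.

Section cfubini.
Context d1 d2 {T1 : measurableType d1} {T2 : measurableType d2} {R : realType}.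
Variables (m1 : {sigma_finite_measure set T1 -> \bar R}).
Variables (m2 : {sigma_finite_measure set T2 -> \bar R}).

Lemma measurable_Rintegral_param (f : T1 * T2 -> R) : measurable_fun setT f ->
  measurable_fun setT (fun x => \int[m2]_y f (x, y)).
Proof.
move=> mf; rewrite /Rintegral.
apply: (measurableT_comp (@fine_measurable R setT measurableT)).
have mF : measurable_fun setT (EFin \o f) by exact/measurable_EFinP.
rewrite (_ : (fun x => _) = (fun x => fubini_F m2 ((EFin \o f)^\+)%E x -
    fubini_F m2 ((EFin \o f)^\-)%E x)%E); last first.
  apply/funext => x; rewrite integralE /fubini_F; congr (_ - _)%E;
    by apply: eq_integral => y _; rewrite ?funeposE ?funenegE.
apply: emeasurable_funB.
  by apply: measurable_fun_fubini_tonelli_F => //; exact: measurable_funepos.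
by apply: measurable_fun_fubini_tonelli_F => //; exact: measurable_funeneg.
Qed.

Lemma cmeas_cint (g : T1 * T2 -> R[i]) : cmeas g ->
  cmeas (fun x => cint m2 (fun y => g (x, y))).
Proof.
move=> [mr mi]; split.
  exact: (measurable_Rintegral_param mr).
exact: (measurable_Rintegral_param mi).
Qed.

Lemma Rintegral_Fubini (f : T1 * T2 -> R) :
  (m1 \x m2)%E.-integrable setT (EFin \o f) ->
  (forall x, m2.-integrable setT (fun y => (f (x, y))%:E)) ->
  (forall y, m1.-integrable setT (fun x => (f (x, y))%:E)) ->
  \int[m1]_x \int[m2]_y f (x, y) = \int[m2]_y \int[m1]_x f (x, y).
Proof.
move=> fi f1 f2; congr fine.
transitivity (\int[m1]_x \int[m2]_y (f (x, y))%:E)%E.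
  by apply: eq_integral => x _; rewrite fineK//; exact: integrable_fin_num.
transitivity (\int[m2]_y \int[m1]_x (f (x, y))%:E)%E; last first.
  by apply: eq_integral => x _; rewrite fineK//; exact: integrable_fin_num.
exact: (Fubini fi).
Qed.

Lemma integrable_prodM (a : T1 -> R) (b : T2 -> R) :
  m1.-integrable setT (EFin \o a) -> m2.-integrable setT (EFin \o b) ->
  (m1 \x m2)%E.-integrable setT (fun p => (a p.1 * b p.2)%:E).
Proof.
move=> ia ib.
have ma : measurable_fun setT a by apply/measurable_EFinP; exact: (measurable_int m1 ia).
have mb : measurable_fun setT b by apply/measurable_EFinP; exact: (measurable_int m2 ib).
apply/integrable12ltyP.
  apply/measurable_EFinP; apply: measurable_funM; exact: measurableT_comp.
rewrite (_ : (\int[m1]_x _ = \int[m1]_x (`|(a x)%:E| * \int[m2]_y `|(b y)%:E|))%E).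
  have /integrableP[_ boo] := ib; have /integrableP[_ aoo] := ia.
  rewrite ge0_integralZr//; last 2 first.
  - by do 2 apply: measurableT_comp => //.
  - by apply: integral_ge0.
  rewrite lte_mul_pinfty//; first exact: integral_ge0.
  by rewrite ge0_fin_numE//; exact: integral_ge0.
apply: eq_integral => x _; rewrite -ge0_integralZl//; last by do 2 apply: measurableT_comp => //.
by apply: eq_integral => y _; rewrite EFinM abseM.
Qed.

(** A product majorant makes every section integrable, not merely almost every one, so the inner
    real-valued integrals are genuine finite integrals at each point. *)
Lemma cint_Fubini (g : T1 * T2 -> R[i]) (a : T1 -> R) (b : T2 -> R) :
  cmeas g -> (forall x y, normc (g (x, y)) <= a x * b y) ->
  m1.-integrable setT (EFin \o a) -> m2.-integrable setT (EFin \o b) ->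
  cint m1 (fun x => cint m2 (fun y => g (x, y))) =
  cint m2 (fun y => cint m1 (fun x => g (x, y))).
Proof.
move=> mg gab ia ib.
have ig : cintegrable (m1 \x m2)%E g.
  apply: (@cintegrable_le _ _ _ _ _ (fun p => a p.1 * b p.2)) => //.
    by move=> [x y]; exact: gab.
  exact: integrable_prodM.
have mg1 x : cmeas (fun y => g (x, y)).
  by case: mg => mr mi; split; apply: (measurableT_comp mr) || apply: (measurableT_comp mi);
    exact: pair1_measurable.
have mg2 y : cmeas (fun x => g (x, y)).
  by case: mg => mr mi; split; apply: (measurableT_comp mr) || apply: (measurableT_comp mi);
    exact: pair2_measurable.
have ig1 x : cintegrable m2 (fun y => g (x, y)).
  apply: (@cintegrable_le _ _ _ _ _ (fun y => a x * b y)) => //.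
  by have := integrableZl measurableT (a x) ib; apply: eq_integrable.
have ig2 y : cintegrable m1 (fun x => g (x, y)).
  apply: (@cintegrable_le _ _ _ _ _ (fun x => a x * b y)) => //.
  by have := integrableZr measurableT (b y) ia; apply: eq_integrable.
apply: complex_ext.
  apply: (Rintegral_Fubini (f := Re \o g)).
  - exact: cintegrable_Re.
  - by move=> x; exact: (cintegrable_Re (ig1 x)).
  - by move=> y; exact: (cintegrable_Re (ig2 y)).
apply: (Rintegral_Fubini (f := Im \o g)).
- exact: cintegrable_Im.
- by move=> x; exact: (cintegrable_Im (ig1 x)).
- by move=> y; exact: (cintegrable_Im (ig2 y)).
Qed.
End cfubini.

(** * An integrable weight and the functions it dominates *)

Section weight1.
Context {R : realType}.
Notation lam := (@lebesgue_measure R).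

Definition weight1 (x : R) : R := (1 + x ^+ 2)^-1.

Lemma weight1_gt0 x : 0 < weight1 x.
Proof. by rewrite invr_gt0 ltr_pwDl// sqr_ge0. Qed.

Lemma weight1_le1 x : weight1 x <= 1.
Proof. by rewrite invf_le1 ?lerDl ?sqr_ge0// ltr_pwDl// sqr_ge0. Qed.

Lemma measurable_weight1 : measurable_fun [set: measurableTypeR R] weight1.
Proof.
apply: continuous_measurable_fun => x; apply: cvgV.
  by rewrite gt_eqF// ltr_pwDl// sqr_ge0.
by apply: cvgD; [exact: cvg_cst|exact: exprn_continuous].
Qed.

Lemma integral_weight1 : (\int[lam]_x (weight1 x)%:E = pi%:E)%E.
Proof.
have mw : measurable_fun [set: measurableTypeR R] (EFin \o weight1).
  by apply/measurable_EFinP; exact: measurable_weight1.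
have w0 x : (0 <= (weight1 x)%:E)%E by rewrite lee_fin ltW// weight1_gt0.
have H : (\int[lam]_(x in `[0%R, +oo[) (weight1 x)%:E = (pi / 2)%:E)%E.
  by rewrite -(@integral0y_oneDsqr R).
have := ge0_integration_by_substitution0 mw w0; rewrite H => H2.
have -> : [set: R] = `]-oo, 0%R[%classic `|` `[0%R, +oo[%classic.
  apply/seteqP; split => x //= _; rewrite !in_itv /= andbT.
  by case: (ltP x 0); [left|right].
rewrite ge0_integral_setU//=.
- rewrite H (integral_itv_bndo_bndc (r := 0)).
    rewrite (_ : \int[lam]_(x in `]-oo, 0%R]) _ = (pi / 2)%:E)%E.
      by rewrite -EFinD -splitr.
    by rewrite H2; apply: eq_integral => x _ /=; rewrite /weight1 sqrrN.
  exact: measurable_funTS.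
- exact: measurable_funTS.
- by apply/disj_setPS => y [/=]; rewrite !in_itv /= => y0 /andP[y1 _]; move: y1; rewrite leNgt y0.
Qed.
End weight1.

Section integral_cons.
Context {R : realType}.
Notation lam := (@lebesgue_measure R).

Lemma ge0_integral_rVS n (f : 'rV[R]_n.+1 -> \bar R) :
  measurable_fun setT f -> (forall x, 0 <= f x)%E ->
  (\int[borel_lebesgue R n.+1]_x f x =
   \int[lam]_x \int[borel_lebesgue R n]_v f (rV_cons (x, v)))%E.
Proof.
move=> mf f0.
have mc : measurable_fun setT (f \o rV_cons).
  by apply: (measurableT_comp mf); exact: measurable_rV_cons.
rewrite -(fubini_tonelli1 (m1 := lam) (m2 := borel_lebesgue R n) (f \o rV_cons) mc)//; last first.
  by move=> p; exact: f0.
exact: (ge0_integral_pushforward (@measurable_rV_cons R n)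
  (lam \x borel_lebesgue R n)%E measurableT mf).
Qed.

Lemma integral_rVS n (f : 'rV[R]_n.+1 -> \bar R) :
  (borel_lebesgue R n.+1).-integrable setT f ->
  (\int[borel_lebesgue R n.+1]_x f x =
   \int[lam]_x \int[borel_lebesgue R n]_v f (rV_cons (x, v)))%E.
Proof.
move=> fi; have [mf foo] := integrableP _ _ _ fi.
have fci : (lam \x borel_lebesgue R n)%E.-integrable setT (f \o rV_cons).
  apply/integrableP; split.
    by apply: measurableT_comp => //; exact: measurable_rV_cons.
  have maf : measurable_fun setT (abse \o f) by exact: measurableT_comp.
  have := (ge0_integral_pushforward (@measurable_rV_cons R n)
    (lam \x borel_lebesgue R n)%E measurableT maf).
  by move=> /= <-.
rewrite (integral12_prod_meas1 fci).
exact: (integral_pushforward (@measurable_rV_cons R n) mf fci measurableT).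
Qed.

Lemma ge0_integral_rV_prod (n : nat) (h : R -> R) (c : R) :
  measurable_fun [set: measurableTypeR R] h -> (forall x, 0 <= h x) ->
  (\int[lam]_x (h x)%:E = c%:E)%E ->
  (\int[borel_lebesgue R n]_x (\prod_i h (x ord0 i))%:E = (c ^+ n)%:E)%E.
Proof.
move=> mh h0 hc; elim: n => [|n IH].
  transitivity (\int[\d_(0%R : 'rV[R]_0)]_x (cst 1%E x : \bar R))%E.
    by apply: eq_integral => x _; rewrite big_ord0.
  by rewrite integral_dirac//= diracT mul1e.
have mp k : measurable_fun setT (fun x : 'rV[R]_k => \prod_i h (x ord0 i)).
  apply: measurable_prod => i _; apply: (measurableT_comp mh).
  exact: measurable_coord_rV.
have p0 k (x : 'rV[R]_k) : 0 <= \prod_i h (x ord0 i) by exact: prodr_ge0.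
rewrite ge0_integral_rVS//; last 2 first.
- by apply/measurable_EFinP; exact: mp.
- by move=> x; rewrite lee_fin.
transitivity (\int[lam]_x ((h x)%:E * (c ^+ n)%:E))%E.
  apply: eq_integral => x _; rewrite -IH -ge0_integralZl//; last 3 first.
  - by apply/measurable_EFinP; exact: mp.
  - by move=> v _; rewrite lee_fin.
  - by rewrite lee_fin.
  apply: eq_integral => v _; rewrite -EFinM big_ord_recl mxE unlift_none /=.
  by congr (_ * _)%:E; apply: eq_bigr => i _; rewrite mxE liftK.
rewrite ge0_integralZr//; last 3 first.
- by apply/measurable_EFinP.
- by move=> x _; rewrite lee_fin.
- rewrite lee_fin exprn_ge0//.
  by rewrite -lee_fin -hc; apply: integral_ge0 => x _; rewrite lee_fin.
by rewrite hc -EFinM -exprS.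
Qed.
End integral_cons.

Section weight.
Context {R : realType} {n : nat}.
Notation V := 'rV[R]_n.
Notation mu := (borel_lebesgue R n).

(** The product of one-variable Cauchy densities, up to normalization: integrable in every dimension
    by Tonelli alone, with integral [pi^n]. *)
Definition weight (x : V) : R := \prod_i weight1 (x ord0 i).

Lemma weight_gt0 x : 0 < weight x.
Proof. by apply: prodr_gt0 => i _; exact: weight1_gt0. Qed.

Lemma weight_ge0 x : 0 <= weight x.
Proof. exact/ltW/weight_gt0. Qed.

Lemma weight_le1 x : weight x <= 1.
Proof. by apply: prodr_ile1 => i _; rewrite weight1_le1 ltW// weight1_gt0. Qed.

Lemma measurable_weight : measurable_fun setT weight.
Proof.
apply: measurable_prod => i _; apply: (measurableT_comp measurable_weight1).
exact: measurable_coord_rV.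
Qed.

Lemma integral_weight : (\int[mu]_x (weight x)%:E = (pi ^+ n)%:E)%E.
Proof.
apply: ge0_integral_rV_prod.
- exact: measurable_weight1.
- by move=> x; exact/ltW/weight1_gt0.
- exact: integral_weight1.
Qed.

Lemma integrable_weight : mu.-integrable setT (EFin \o weight).
Proof.
apply/integrableP; split; first by apply/measurable_EFinP; exact: measurable_weight.
under eq_integral do rewrite /= ger0_norm ?weight_ge0//.
by rewrite integral_weight ltry.
Qed.

Lemma integrable_weightZ C : mu.-integrable setT (EFin \o (fun x => C * weight x)).
Proof.
by have := integrableZl measurableT C integrable_weight; apply: eq_integrable.
Qed.

(** The working class for all exchanges of integrals: it gives integrability, is stable under
    bounded measurable factors, and supplies product majorants for [cint_Fubini]. *)
Definition dominated (g : V -> R[i]) :=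
  cmeas g /\ exists C, forall x, normc (g x) <= C * weight x.

Lemma dominated_integrable g : dominated g -> cintegrable mu g.
Proof.
move=> [mg [C gC]]; apply: cintegrable_le gC _ => //.
exact: integrable_weightZ.
Qed.

Lemma dominated_le g h : cmeas g -> (exists C, forall x, normc (g x) <= C * normc (h x)) ->
  dominated h -> dominated g.
Proof.
move=> mg [C gh] [mh [D hD]]; split => //; exists (`|C| * D) => x.
rewrite -mulrA (le_trans (gh x))// (le_trans (ler_wpM2r (normc_ge0 _) (ler_norm C)))//.
by rewrite ler_wpM2l.
Qed.

Lemma dominatedM g h : cmeas g -> (exists C, forall x, normc (g x) <= C) ->
  dominated h -> dominated (fun x => g x * h x).
Proof.
move=> mg [C gC] dh; apply: dominated_le (dh).
  by apply: cmeasM => //; case: dh.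
exists C => x; rewrite Normc.normcM ler_wpM2r//; exact: normc_ge0.
Qed.

Lemma dominatedD g h : dominated g -> dominated h ->
  dominated (fun x => g x + h x).
Proof.
move=> [mg [C gC]] [mh [D hD]]; split; first exact: cmeasD.
exists (C + D) => x; rewrite (le_trans (le_normcD _ _))// mulrDl lerD//.
Qed.

Lemma dominated_compact (g : V -> R[i]) (r C : R) : cmeas g -> (forall x, normc (g x) <= C) ->
  (forall x : V, r < `|x| -> g x = 0) -> dominated g.
Proof.
(* For [|x| <= r] each of the [n] factors of [weight x] is at least [(1 + r^2)^-1]. *)
move=> mg gC g0; split => //; exists (C * (1 + r ^+ 2) ^+ n) => x.
have C0 : 0 <= C by exact: le_trans (normc_ge0 _) (gC 0).
have [rx|rx] := ltrP r `|x|.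
  rewrite g0// Normc.normc0 mulr_ge0 ?weight_ge0// mulr_ge0// exprn_ge0//.
  by rewrite addr_ge0// sqr_ge0.
rewrite -mulrA (le_trans (gC x))// ler_peMr//.
rewrite -[n in _ ^+ n]card_ord -prodr_const -big_split /=.
apply: (@le_trans _ _ (\prod_(i < n) (1 : R))); first by rewrite big1.
apply: ler_prod => i _.
rewrite ler01 /= /weight1 -[leRHS]/(_ / _) ler_pdivlMr ?ltr_pwDl ?sqr_ge0//.
rewrite mul1r lerD2l -[leLHS]real_normK ?num_real// lerXn2r ?nnegrE//.
  by rewrite (le_trans _ rx).
by rewrite (le_trans (normr_coord _ _)).
Qed.

Lemma measurable_dotprod :
  measurable_fun setT (fun p : V * V => dotprod p.1 p.2).
Proof.
apply: measurable_sum => i; apply: measurable_funM.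
  by apply: (measurableT_comp (measurable_coord_rV i)); exact: measurable_fst.
by apply: (measurableT_comp (measurable_coord_rV i)); exact: measurable_snd.
Qed.

Lemma measurable_dotprodr (x : V) : measurable_fun setT (dotprod x).
Proof.
apply: (measurableT_comp measurable_dotprod (f := fun p : V * V => dotprod p.1 p.2) (g := pair x)).
exact: pair1_measurable.
Qed.

Lemma dotprodC (x y : V) : dotprod x y = dotprod y x.
Proof. by apply: eq_bigr => i _; rewrite mulrC. Qed.
Lemma dotprodDl (x y z : V) : dotprod (x + y) z = dotprod x z + dotprod y z.
Proof. by rewrite -big_split; apply: eq_bigr => i _; rewrite mxE mulrDl. Qed.
Lemma dotprodZl (c : R) (x z : V) : dotprod (c *: x) z = c * dotprod x z.
Proof. by rewrite /dotprod mulr_sumr; apply: eq_bigr => i _; rewrite mxE mulrA. Qed.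
Lemma dotprodNl (x z : V) : dotprod (- x) z = - dotprod x z.
Proof. by rewrite -scaleN1r dotprodZl mulN1r. Qed.
Lemma dotprodDr (x y z : V) : dotprod z (x + y) = dotprod z x + dotprod z y.
Proof. by rewrite dotprodC dotprodDl !(dotprodC _ z). Qed.
Lemma dotprodZr (c : R) (x z : V) : dotprod z (c *: x) = c * dotprod z x.
Proof. by rewrite dotprodC dotprodZl !(dotprodC _ z). Qed.

(** The Fourier integral with the sign [+]. The transform [fourier] is its reflection ([fourierE]),
    so one operator serves for both the transform and its inverse. *)
Definition osc (g : V -> R[i]) (x : V) : R[i] :=
  cint mu (fun xi => expi (dotprod x xi) * g xi).

Lemma dominated_expi (f : V -> R) g : measurable_fun setT f -> dominated g ->
  dominated (fun x => expi (f x) * g x).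
Proof.
move=> mf dg; apply: dominatedM => //; first exact: cmeas_expi.
by exists 1 => x; rewrite normc_expi.
Qed.

Lemma cmeas_comp d1 d2 (T1 : measurableType d1) (T2 : measurableType d2)
    (f : T1 -> T2) (g : T2 -> R[i]) :
  measurable_fun setT f -> cmeas g -> cmeas (g \o f).
Proof.
by move=> mf [mr mi]; split; [exact: (measurableT_comp mr mf)|exact: (measurableT_comp mi mf)].
Qed.

Lemma cmeas_osc g : cmeas g -> cmeas (osc g).
Proof.
move=> mg; apply: (cmeas_cint mu (g := fun p : V * V => expi (dotprod p.1 p.2) * g p.2)).
apply: cmeasM; first by apply: cmeas_expi; exact: measurable_dotprod.
by apply: cmeas_comp => //; exact: measurable_snd.
Qed.

Lemma osc_bounded g : dominated g -> exists C, forall x, normc (osc g x) <= C.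
Proof.
move=> dg; have [mg [C gC]] := dg; exists (C * pi ^+ n) => x.
rewrite -lee_fin; have dxg := dominated_expi (measurable_dotprodr x) dg.
apply: (le_trans (normc_cint_le (dominated_integrable dxg))).
rewrite EFinM -integral_weight -ge0_integralZl//; last first.
- by rewrite lee_fin -(@pmulr_lge0 _ (weight 0)) ?weight_gt0// (le_trans _ (gC 0))// normc_ge0.
- by move=> y _; rewrite lee_fin weight_ge0.
- by apply/measurable_EFinP; exact: measurable_weight.
apply: ge0_le_integral => //.
- by move=> y _; rewrite lee_fin normc_ge0.
- by apply/measurable_EFinP; apply: measurable_normc; case: dxg.
- by apply/measurable_EFinP/measurable_funM => //; exact: measurable_weight.
- by move=> y _; rewrite -EFinM lee_fin Normc.normcM normc_expi mul1r.
Qed.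

(** The multiplication formula, by Fubini. The dilation [s] is used with the values 1 and -1, to
    cover both signs of the exponential. *)
Lemma osc_mulC (s : R) (a b : V -> R[i]) : dominated a -> dominated b ->
  cint mu (fun x => a x * osc b (s *: x)) = cint mu (fun x => b x * osc a (s *: x)).
Proof.
move=> da db; have [ma [A aA]] := da; have [mb [B bB]] := db.
have dba x : cintegrable mu (fun y => expi (dotprod (s *: x) y) * b y).
  by apply: dominated_integrable; apply: dominated_expi => //; exact: measurable_dotprodr.
have daa x : cintegrable mu (fun y => expi (dotprod (s *: x) y) * a y).
  by apply: dominated_integrable; apply: dominated_expi => //; exact: measurable_dotprodr.
pose g (p : V * V) := a p.1 * (expi (s * dotprod p.1 p.2) * b p.2).
transitivity (cint mu (fun x => cint mu (fun y => g (x, y)))).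
  apply: eq_cint => x; rewrite /osc -cintZ//; apply: eq_cint => y.
  by rewrite /g /= dotprodZl.
transitivity (cint mu (fun y => cint mu (fun x => g (x, y)))); last first.
  apply: eq_cint => x; rewrite /osc -cintZ//; apply: eq_cint => y.
  by rewrite /g /= dotprodZl [dotprod x y]dotprodC mulrCA mulrA [RHS]mulrC -!mulrA; congr (_ * _); rewrite mulrC.
apply: (@cint_Fubini _ _ _ _ _ _ _ _ (fun x => A * weight x) (fun y => B * weight y)).
- apply: cmeasM; first by apply: cmeas_comp => //; exact: measurable_fst.
  apply: cmeasM; last by apply: cmeas_comp => //; exact: measurable_snd.
  apply: cmeas_expi; apply: measurable_funM => //; exact: measurable_dotprod.
- move=> x y; rewrite /g /= !Normc.normcM normc_expi mul1r.
  by rewrite ler_pM ?normc_ge0.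
- exact: integrable_weightZ.
- exact: integrable_weightZ.
Qed.

End weight.

(** * Plancherel inequality and Fourier inversion *)

Section fejer.
Context {R : realType}.
Notation lam := (@lebesgue_measure R).

(* The triangle function; its Fourier transform is the (nonnegative) Fejer kernel. *)
Definition tri (x : R) : R := Num.max 0 (1 - `|x|).

Lemma tri_ge0 x : 0 <= tri x. Proof. by rewrite /tri le_max lexx. Qed.

Lemma tri_le1 x : tri x <= 1.
Proof. by rewrite /tri ge_max ler01 gerBl normr_ge0. Qed.

Lemma tri_eq0 x : 1 <= `|x| -> tri x = 0.
Proof. by move=> x1; rewrite /tri max_l// subr_le0. Qed.

Lemma tri_lt1 x : `|x| <= 1 -> tri x = 1 - `|x|.
Proof. by move=> x1; rewrite /tri max_r// subr_ge0. Qed.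

Lemma measurable_tri : measurable_fun [set: measurableTypeR R] tri.
Proof.
apply: measurable_maxr => //; apply: measurable_funB => //.
Qed.

Lemma le_tri_indic x : tri x <= \1_(`[-1, 1]%classic : set R) x.
Proof.
have [x1|x1] := lerP `|x| 1.
  by rewrite indicE mem_set ?tri_le1//= in_itv /= -ler_norml.
by rewrite (tri_eq0 (ltW x1)) indicE ler0n.
Qed.

Lemma integral_indic_cc (a b : R) : a <= b ->
  (\int[lam]_x (\1_(`[a, b]%classic : set R) x)%:E = (b - a)%:E)%E.
Proof.
move=> ab; rewrite (integral_indic lam measurableT (measurable_itv `[a, b]))// setIT.
have := @lebesgue_measure_itv R `[a, b]; rewrite /= lte_fin => ->.
by move: ab; rewrite le_eqVlt => /predU1P[->|->]; rewrite ?ltxx ?subrr.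
Qed.

Lemma integrable_tri (g : measurableTypeR R -> R) : measurable_fun setT g ->
  (forall x, `|g x| <= 1) ->
  lam.-integrable setT (fun x => (g x * tri x)%:E).
Proof.
move=> mg g1.
have ii : lam.-integrable setT (EFin \o \1_(`[-1, 1]%classic : set R)).
  exact: integrable_indic_itv.
apply: (le_integrable measurableT _ _ ii).
- by apply/measurable_EFinP; apply: measurable_funM => //; exact: measurable_tri.
- move=> x _ /=; rewrite lee_fin normrM (ger0_norm (tri_ge0 _)).
  rewrite [leRHS]ger0_norm ?indic_ge0// -[leRHS]mul1r ler_pM ?tri_ge0//.
  exact: le_tri_indic.
Qed.

Lemma is_derive_affine (a b x : R) : is_derive x (1 : R) (fun y => a + b * y) b.
Proof.
have h1 : is_derive x (1 : R) (fun y : R => b * y) (b *: 1).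
  by apply: is_deriveZ; exact: is_derive_id.
have h2 : is_derive x (1 : R) (fun y : R => a + b * y) (0 + b *: 1).
  by apply: is_deriveD.
by apply: (is_derive_eq h2); rewrite add0r /GRing.scale /= mulr1.
Qed.

Lemma measurable_cos_affine (delta u : R) :
  measurable_fun [set: measurableTypeR R] (fun x => cos (delta + x * u)).
Proof.
apply: (measurableT_comp (f := cos)).
  by apply: continuous_measurable_fun; exact: continuous_cos.
by apply: measurable_funD => //; exact: measurable_funM.
Qed.

Definition fejer1 (u : R) : R := \int[lam]_x (cos (x * u) * tri x).

(** The slope [s] is 1 on [[0, 1]] and -1 on [[-1, 0]], so a single antiderivative, found by one
    integration by parts, serves both halves of the triangle. *)
Lemma integral_half_tri (s delta u a b : R) : u != 0 -> a < b ->
  (\int[lam]_(x in `[a, b]) ((cos (delta + x * u) * (1 - s * x))%:E) =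
   ((1 - s * b) * sin (delta + b * u) / u - s * cos (delta + b * u) / u ^+ 2)%:E -
   ((1 - s * a) * sin (delta + a * u) / u - s * cos (delta + a * u) / u ^+ 2)%:E)%E.
Proof.
move=> u0 ab.
pose F (x : R) := (1 - s * x) * sin (delta + x * u) / u - s * cos (delta + x * u) / u ^+ 2.
have dphase x : is_derive x (1 : R) (fun x : R => delta + x * u) u.
  have := is_derive_affine delta u x; congr (is_derive _ _ _ _).
  by apply/funext => y; rewrite mulrC.
have dsin x := @is_derive1_comp R sin _ x _ _ (is_derive_sin _) (dphase x).
have dcos x := @is_derive1_comp R cos _ x _ _ (is_derive_cos _) (dphase x).
have dlin x : is_derive x (1 : R) (fun x : R => 1 - s * x) (- s).
  have := is_derive_affine 1 (- s) x; congr (is_derive _ _ _ _).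
  by apply/funext => y; rewrite mulNr.
have dF x : is_derive x (1 : R) F (cos (delta + x * u) * (1 - s * x)).
  have hM : is_derive x (1 : R) (fun y : R => (1 - s * y) * sin (delta + y * u))
    ((1 - s * x) *: (cos (delta + x * u) * u) + sin (delta + x * u) *: (- s)).
    exact: (is_deriveM (dlin x) (dsin x)).
  have h1 : is_derive x (1 : R) (fun y : R => u^-1 * ((1 - s * y) * sin (delta + y * u)))
    (u^-1 *: ((1 - s * x) *: (cos (delta + x * u) * u) + sin (delta + x * u) *: (- s))).
    by apply: is_deriveZ; exact: hM.
  have h2 : is_derive x (1 : R) (fun y : R => - (s / u ^+ 2) * cos (delta + y * u))
    (- (s / u ^+ 2) *: (- sin (delta + x * u) * u)).
    by apply: is_deriveZ; exact: dcos.
  have h3 : is_derive x (1 : R) (fun y : R => u^-1 * ((1 - s * y) * sin (delta + y * u)) +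
      - (s / u ^+ 2) * cos (delta + y * u)) _ := is_deriveD h1 h2.
  have -> : F = (fun y : R => u^-1 * ((1 - s * y) * sin (delta + y * u)) +
      - (s / u ^+ 2) * cos (delta + y * u)).
    by apply/funext => y; rewrite /F; field.
  by apply: (is_derive_eq h3); rewrite /GRing.scale /=; field.
have cl : continuous (fun x : R => 1 - s * x).
  by move=> x; apply/differentiable_continuous/derivable1_diffP; case: (dlin x).
have cF : continuous F.
  by move=> x; apply/differentiable_continuous/derivable1_diffP; case: (dF x).
apply: (@continuous_FTC2 _ _ F) => //.
- apply: continuous_subspaceT => x; apply: cvgM.
    by apply/differentiable_continuous/derivable1_diffP; case: (dcos x).
  exact: cl.
- split; first by move=> x _; case: (dF x).
    by apply: cvg_at_right_filter; exact: cF.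
  by apply: cvg_at_left_filter; exact: cF.
- by move=> x _; rewrite derive1E; case: (dF x).
Qed.

Lemma integral_cos_tri (delta u : R) : u != 0 ->
  \int[lam]_x (cos (delta + x * u) * tri x) = cos delta * (2 * (1 - cos u) / u ^+ 2).
Proof.
move=> u0; pose f (x : measurableTypeR R) := cos (delta + x * u) * tri x.
have fi : lam.-integrable setT (EFin \o f).
  apply: integrable_tri; first exact: measurable_cos_affine.
  by move=> x; rewrite ler_norml cos_geN1 cos_le1.
have -> : \int[lam]_x f x = \int[lam]_(x in `[-1, 1]) f x.
  rewrite [RHS]Rintegral_mkcond; apply: eq_Rintegral => x _.
  rewrite patchE; case: ifPn => // /negP; rewrite inE /= in_itv /= => /negP.
  by rewrite -ler_norml -ltNge => x1; rewrite /f tri_eq0 ?mulr0// ltW.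
have fiS (A : set (measurableTypeR R)) : measurable A -> lam.-integrable A (EFin \o f).
  by move=> mA; apply: integrableS fi.
have := @Rintegral_itvB R f (BLeft (-1)) (BRight 1) 0.
rewrite !bnd_simp => /(_ (fiS _ _) _ _); rewrite Rintegral_itv_obnd_cbnd//; last exact: fiS.
move=> /(_ ltac:(by []) ltac:(by rewrite lerN10) ltac:(by [])) H.
rewrite -[LHS](subrK (\int[lam]_(x in `[-1, 0]) f x)) H.
have -> : \int[lam]_(x in `[0, 1]) f x =
   \int[lam]_(x in `[0, 1]) (cos (delta + x * u) * (1 - 1 * x)).
  apply: eq_Rintegral => x; rewrite inE /= in_itv /= => /andP[x0 x1].
  by rewrite /f tri_lt1 ger0_norm// mul1r.
have -> : \int[lam]_(x in `[-1, 0]) f x =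
   \int[lam]_(x in `[-1, 0]) (cos (delta + x * u) * (1 - (-1) * x)).
  apply: eq_Rintegral => x; rewrite inE /= in_itv /= => /andP[x0 x1].
  by rewrite /f tri_lt1 ler0_norm// ?mulN1r//; lra.
rewrite /Rintegral !integral_half_tri//=.
rewrite !mul0r !addr0 !mulN1r !mul1r !cosD cosN sinN.
by field.
Qed.

Lemma fejer1E u : u != 0 -> fejer1 u = 2 * (1 - cos u) / u ^+ 2.
Proof.
move=> u0; have := integral_cos_tri 0 u0; rewrite cos0 mul1r => <-.
by apply: eq_Rintegral => x _; rewrite add0r.
Qed.

(** The phase factors out because [tri] is even. It is kept for the induction on the dimension in
    [integral_cos_triV], where it carries the contribution of the coordinates already split off. *)
Lemma integral_cos_tri_phase (delta u : R) :
  \int[lam]_x (cos (delta + x * u) * tri x) = cos delta * fejer1 u.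
Proof.
have [->|u0] := eqVneq u 0; last by rewrite integral_cos_tri// fejer1E.
rewrite /fejer1 -RintegralZl//.
  by apply: eq_Rintegral => x _; rewrite !mulr0 addr0 cos0 mul1r.
apply: integrable_tri; first by under eq_fun do rewrite mulr0; exact: measurable_cst.
by move=> x; rewrite mulr0 cos0 normr1.
Qed.

Lemma fejer1_ge0 u : 0 <= fejer1 u.
Proof.
have [->|u0] := eqVneq u 0.
  by apply: Rintegral_ge0 => x _; rewrite mulr0 cos0 mul1r tri_ge0.
by rewrite fejer1E// divr_ge0 ?sqr_ge0// mulr_ge0// subr_ge0 cos_le1.
Qed.

Lemma fejer1_le2 u : fejer1 u <= 2.
Proof.
rewrite (le_trans (ler_norm _))//.
have mc : measurable_fun [set: measurableTypeR R] (fun x : R => cos (x * u)).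
  by have := measurable_cos_affine 0 u; congr measurable_fun; apply/funext => x; rewrite add0r.
have ci : lam.-integrable setT (fun x => (cos (x * u) * tri x)%:E).
  by apply: integrable_tri => // x; rewrite ler_norml cos_geN1 cos_le1.
apply: (le_trans (le_normr_Rintegral _ _)) => //.
have -> : 2 = \int[lam]_x \1_(`[-1, 1]%classic : set R) x :> R.
  by rewrite /Rintegral integral_indic_cc//=; lra.
apply: le_Rintegral => //.
- by have := integrable_norm ci; apply: eq_integrable.
- exact: integrable_indic_itv.
- move=> x _; rewrite normrM (ger0_norm (tri_ge0 x)) (le_trans _ (le_tri_indic x))//.
  by rewrite ler_piMl ?tri_ge0// ler_norml cos_geN1 cos_le1.
Qed.

(** For [u^2 <= 1] the bound 2 suffices. For [u^2 > 1] the closed form has numerator at most 4 and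
    [1 + u^2 <= 2 u^2], whence the 8. *)
Lemma fejer1_le u : fejer1 u <= 8 * weight1 u.
Proof.
rewrite /weight1 ler_pdivlMr ?ltr_pwDl ?sqr_ge0//.
have [u1|u1] := lerP (u ^+ 2) 1.
  have := fejer1_le2 u; have := fejer1_ge0 u; have := sqr_ge0 u; nra.
have u0 : u != 0 by apply: contraTN u1 => /eqP ->; rewrite expr0n ltr10.
have u20 : 0 < u ^+ 2 by rewrite exprn_even_gt0.
rewrite fejer1E// mulrAC ler_pdivrMr//.
have := cos_geN1 u; have := cos_le1 u; nra.
Qed.

Lemma measurable_fejer1 : measurable_fun [set: measurableTypeR R] fejer1.
Proof.
apply: (measurable_Rintegral_param lam (f := fun p : measurableTypeR R * measurableTypeR R => cos (p.2 * p.1) * tri p.2)).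
apply: measurable_funM.
  apply: (measurableT_comp (f := cos)).
    by apply: continuous_measurable_fun; exact: continuous_cos.
  by apply: measurable_funM.
by apply: (measurableT_comp measurable_tri).
Qed.

(** Finiteness comes from comparison with [weight1]. Positivity comes from [[pi / 2, pi]], where the
    cosine is nonpositive and hence [fejer1 u >= 2 / u^2 >= 2 / pi^2]. *)
Lemma integral_fejer1 : exists2 c : R, 0 < c &
  (\int[lam]_u (fejer1 u)%:E = c%:E)%E.
Proof.
have m1 : measurable_fun setT (EFin \o fejer1) by apply/measurable_EFinP; exact: measurable_fejer1.
have le8 : (\int[lam]_u (fejer1 u)%:E <= (8 * pi)%:E)%E.
  rewrite EFinM -integral_weight1 -ge0_integralZl//.
  - apply: ge0_le_integral => //.
    + by move=> x _; rewrite lee_fin fejer1_ge0.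
    + by apply/measurable_EFinP; apply: measurable_funM => //; exact: measurable_weight1.
    + by move=> x _; rewrite -EFinM lee_fin fejer1_le.
  - by apply/measurable_EFinP; exact: measurable_weight1.
  - by move=> x _; rewrite lee_fin ltW// weight1_gt0.
have ge : ((2 / pi ^+ 2 * (pi / 2))%:E <= \int[lam]_u (fejer1 u)%:E)%E.
  have pihalf : pi / 2 < pi :> R by rewrite ltr_pdivrMr// ltr_pMr ?pi_gt0// ltr1n.
  have -> : (2 / pi ^+ 2 * (pi / 2))%:E =
     (\int[lam]_x ((2 / pi ^+ 2)%:E * (\1_(`[pi / 2, pi]%classic : set R) x)%:E))%E.
    rewrite ge0_integralZl//; last 2 first.
    - by apply/measurable_EFinP; exact: measurable_indic.
    - by rewrite lee_fin divr_ge0// sqr_ge0.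
    rewrite integral_indic_cc ?(ltW pihalf)//.
    by rewrite -EFinM; congr (_%:E); congr (_ * _); lra.
  apply: ge0_le_integral => //.
  - by move=> x _; rewrite -EFinM lee_fin mulr_ge0// divr_ge0// sqr_ge0.
  - apply/measurable_EFinP; apply: measurable_funM => //; exact: measurable_indic.
  - move=> u _; rewrite -EFinM lee_fin indicE.
    have [/andP[u1 u2]|nu] := boolP (pi / 2 <= u <= pi); last first.
      by rewrite memNset/= ?in_itv//= ?mulr0 ?fejer1_ge0//; exact/negP.
    rewrite mem_set/= ?in_itv/= ?u1// mulr1.
    have u0 : 0 < u by rewrite (lt_le_trans _ u1)// divr_gt0 ?pi_gt0.
    rewrite fejer1E ?gt_eqF// -mulrA ler_wpM2l//.
    have cu : cos u <= 0.
      have := cosDpi (u - pi); rewrite subrK => ->.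
      rewrite oppr_le0 cos_ge0_pihalf//; apply/andP; split; lra.
    apply: (@le_trans _ _ (u ^+ 2)^-1).
      by rewrite lef_pV2 ?posrE ?exprn_gt0 ?pi_gt0// lerXn2r ?nnegrE ?pi_ge0 ?(ltW u0).
    by rewrite ler_peMl ?invr_ge0 ?sqr_ge0//; lra.
case E : (\int[lam]_u (fejer1 u)%:E)%E le8 ge => [c| |]//.
rewrite lee_fin lee_fin => _ H; exists c => //; apply: lt_le_trans H.
by rewrite mulr_gt0// divr_gt0 ?pi_gt0// exprn_gt0 ?pi_gt0.
Qed.

End fejer.

Section cauchy_schwarz.
Context d {T : measurableType d} {R : realType}.
Variable m : {sigma_finite_measure set T -> \bar R}.
Local Open Scope ereal_scope.

(* Expand the square as a double integral and use [2 b c <= b^2 + c^2]. *)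
Lemma sqr_integral_le (w b : T -> R) :
  measurable_fun setT w -> measurable_fun setT b ->
  (forall x, 0 <= w x)%R -> (forall x, 0 <= b x)%R ->
  (\int[m]_x (w x * b x)%:E) * (\int[m]_x (w x * b x)%:E) <=
  (\int[m]_x (w x)%:E) * (\int[m]_x (w x * b x ^+ 2)%:E).
Proof.
move=> mw mb w0 b0.
have mwb : measurable_fun setT (fun x => (w x * b x)%:E).
  by apply/measurable_EFinP; exact: measurable_funM.
have mwb2 : measurable_fun setT (fun x => (w x * b x ^+ 2)%:E).
  by apply/measurable_EFinP; apply: measurable_funM => //; exact: measurable_funX.
have mwE : measurable_fun setT (fun x => (w x)%:E) by exact/measurable_EFinP.
have wb0 x : 0 <= (w x * b x)%:E by rewrite lee_fin mulr_ge0.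
have wb20 x : 0 <= (w x * b x ^+ 2)%:E by rewrite lee_fin mulr_ge0// exprn_ge0.
set B := \int[m]_x (w x * b x ^+ 2)%:E; set W := \int[m]_x (w x)%:E.
have W0 : 0 <= W by apply: integral_ge0 => x _; rewrite lee_fin.
have B0 : 0 <= B by apply: integral_ge0.
rewrite -ge0_integralZl//; last by apply: integral_ge0.
apply: (@le_trans _ _ (\int[m]_x (2^-1%:E * ((w x * b x ^+ 2)%:E * W + (w x)%:E * B)))).
  apply: ge0_le_integral => //.
  - by move=> x _; apply: mule_ge0 => //; exact: integral_ge0.
  - by apply: emeasurable_funM => //; exact: measurable_cst.
  - apply: emeasurable_funM => //; apply: emeasurable_funD;
      by apply: emeasurable_funM => //; exact: measurable_cst.
  move=> x _; rewrite muleC -ge0_integralZl//.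
  have -> : (w x * b x ^+ 2)%:E * W + (w x)%:E * B =
     \int[m]_y ((w x * b x ^+ 2)%:E * (w y)%:E + (w x)%:E * (w y * b y ^+ 2)%:E).
    rewrite ge0_integralD//; last 4 first.
    - by move=> y _; rewrite mule_ge0// lee_fin.
    - by apply: emeasurable_funM => //; exact: measurable_cst.
    - by move=> y _; rewrite mule_ge0// lee_fin.
    - by apply: emeasurable_funM => //; exact: measurable_cst.
    rewrite !ge0_integralZl// ?lee_fin//.
    by move=> y _; rewrite lee_fin.
  rewrite -ge0_integralZl//; last 2 first.
  - by apply: emeasurable_funD; apply: emeasurable_funM => //; exact: measurable_cst.
  - by move=> y _; rewrite adde_ge0// mule_ge0// lee_fin.
  apply: ge0_le_integral => //.
  - by move=> y _; rewrite mule_ge0.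
  - by apply: emeasurable_funM => //; exact: measurable_cst.
  - apply: emeasurable_funM => //; apply: emeasurable_funD;
      by apply: emeasurable_funM => //; exact: measurable_cst.
  move=> y _; rewrite -!EFinM lee_fin /=.
  have := mulr_ge0 (mulr_ge0 (w0 x) (w0 y)) (sqr_ge0 (b x - b y)); lra.
rewrite ge0_integralZl//; last 2 first.
- by apply: emeasurable_funD; apply: emeasurable_funM => //; exact: measurable_cst.
- by move=> x _; rewrite adde_ge0// mule_ge0// lee_fin.
rewrite ge0_integralD//; last 4 first.
- by move=> y _; rewrite mule_ge0// lee_fin.
- by apply: emeasurable_funM => //; exact: measurable_cst.
- by move=> y _; rewrite mule_ge0// lee_fin.
- by apply: emeasurable_funM => //; exact: measurable_cst.
rewrite !ge0_integralZr//; last by move=> x _; rewrite lee_fin.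
rewrite -/B -/W (muleC B W).
have -> : W * B + W * B = 2%:E * (W * B).
  by rewrite -[in LHS](mul1e (W * B)) -ge0_muleDl.
by rewrite muleA -EFinM mulVf// mul1e.
Qed.

End cauchy_schwarz.

(** * The Fejer kernel in several variables *)

Section fejer_kernel.
Context {R : realType} {n : nat}.
Notation V := 'rV[R]_n.
Notation mu := (borel_lebesgue R n).

Definition triV (x : V) : R := \prod_i tri (x ord0 i).
Definition fejer (u : V) : R := \prod_i fejer1 (u ord0 i).

Lemma triV_ge0 x : 0 <= triV x.
Proof. by apply: prodr_ge0 => i _; exact: tri_ge0. Qed.

Lemma triV_le1 x : triV x <= 1.
Proof. by apply: prodr_ile1 => i _; rewrite tri_ge0 tri_le1. Qed.

Lemma triV_eq0 (x : V) : 1 < `|x| -> triV x = 0.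
Proof.
move=> x2; have [i xi] : exists i, 1 <= `|x ord0 i|.
  apply/existsP; apply: contraTT x2 => /existsPn H; rewrite -leNgt.
  by apply: normr_rV_le => // i; have := H i; rewrite -ltNge => /ltW.
by rewrite /triV (bigD1 i)//= tri_eq0// mul0r.
Qed.

Lemma measurable_triV : measurable_fun setT triV.
Proof.
apply: measurable_prod => i _; apply: (measurableT_comp measurable_tri).
exact: measurable_coord_rV.
Qed.

Lemma fejer_ge0 x : 0 <= fejer x.
Proof. by apply: prodr_ge0 => i _; exact: fejer1_ge0. Qed.

Lemma measurable_fejer : measurable_fun setT fejer.
Proof.
apply: measurable_prod => i _; apply: (measurableT_comp measurable_fejer1).
exact: measurable_coord_rV.
Qed.

Lemma integral_fejer : exists2 c : R, 0 < c & (\int[mu]_u (fejer u)%:E = c%:E)%E.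
Proof.
have [c c0 hc] := @integral_fejer1 R; exists (c ^+ n); first exact: exprn_gt0.
apply: ge0_integral_rV_prod => //; first exact: measurable_fejer1.
by move=> x; exact: fejer1_ge0.
Qed.

Lemma integrable_fejer : mu.-integrable setT (EFin \o fejer).
Proof.
apply/integrableP; split; first by apply/measurable_EFinP; exact: measurable_fejer.
under eq_integral do rewrite /= ger0_norm ?fejer_ge0//.
by have [c _ ->] := integral_fejer; rewrite ltry.
Qed.

Lemma dominated_real (f : V -> R) C : measurable_fun setT f ->
  (forall x, `|f x| <= C) -> forall r, (forall x : V, r < `|x| -> f x = 0) ->
  dominated (fun x => ((f x)%:C)%C).
Proof.
move=> mf fC r f0; apply: (@dominated_compact _ _ _ r C).
- exact: cmeas_real.
- by move=> x; rewrite normc_real.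
- by move=> x /f0 ->.
Qed.

Lemma dominated_triV (c : R) : 0 < c -> dominated (fun x => ((triV (c *: x))%:C)%C).
Proof.
move=> c0; apply: (@dominated_real _ 1 _ _ (c^-1)).
- apply: (measurableT_comp measurable_triV).
  have := measurable_affine_rV c (0 : V).
  by congr measurable_fun; apply/funext => x; rewrite /affine_rV addr0.
- by move=> x; rewrite ger0_norm ?triV_ge0 ?triV_le1.
- move=> x xc; apply: triV_eq0; rewrite normrZ gtr0_norm//.
  by rewrite mulrC -ltr_pdivrMr// div1r.
Qed.

Lemma cint_affine (c : R) (y : V) (g : V -> R[i]) : c != 0 -> cintegrable mu g ->
  cint mu (fun x => g (c *: x + y)) = (((`|c| ^- n)%:C)%C * cint mu g).
Proof.
move=> c0 ig.
have k0 : 0 <= `|c| ^- n by rewrite invr_ge0 exprn_ge0.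
have H (f : V -> R) : mu.-integrable setT (EFin \o f) ->
    \int[mu]_x f (c *: x + y) = `|c| ^- n * \int[mu]_x f x.
  move=> fi; have [mf _] := integrableP _ _ _ fi.
  rewrite /Rintegral -[`|c| ^- n]/(fine (`|c| ^- n)%:E) -fineM//; last first.
    by apply: integrable_fin_num.
  congr fine; rewrite integralE.
  have -> : (\int[mu]_x (fun x => (f (c *: x + y))%:E)^\+ x =
      (`|c| ^- n)%:E * \int[mu]_x (EFin \o f)^\+ x)%E.
    rewrite -(ge0_integral_affine y (f := (EFin \o f)^\+%E) c0)//; last first.
      exact: measurable_funepos.
    by apply: eq_integral => x _; rewrite !funeposE.
  have -> : (\int[mu]_x (fun x => (f (c *: x + y))%:E)^\- x =
      (`|c| ^- n)%:E * \int[mu]_x (EFin \o f)^\- x)%E.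
    rewrite -(ge0_integral_affine y (f := (EFin \o f)^\-%E) c0)//; last first.
      exact: measurable_funeneg.
    by apply: eq_integral => x _; rewrite !funenegE.
  rewrite -muleBr//; first by rewrite [in RHS]integralE.
  by exact: integrable_add_def.
apply: complex_ext; rewrite ?ReZ ?ImZ.
  exact: (H (Re \o g) (cintegrable_Re ig)).
exact: (H (Im \o g) (cintegrable_Im ig)).
Qed.

End fejer_kernel.

Section fejer_transform.
Context {R : realType}.
Notation lam := (@lebesgue_measure R).

Lemma integrable_triV n (f : 'rV[R]_n -> R) : measurable_fun setT f ->
  (forall x, `|f x| <= 1) ->
  (borel_lebesgue R n).-integrable setT (fun x => (f x * triV x)%:E).
Proof.
move=> mf f1.
have : dominated (fun x : 'rV[R]_n => ((f x * triV x)%:C)%C).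
  apply: (@dominated_real _ _ _ 1 _ _ 1).
  - by apply: measurable_funM => //; exact: measurable_triV.
  - move=> x; rewrite normrM (ger0_norm (triV_ge0 _)) mulr_ile1// ?triV_le1//.
    exact: triV_ge0.
  - by move=> x /triV_eq0 ->; rewrite mulr0.
by move=> /dominated_integrable/cintegrable_Re.
Qed.

Lemma measurable_cos_dotprod n (delta : R) (u : 'rV[R]_n) :
  measurable_fun setT (fun x => cos (delta + dotprod x u)).
Proof.
apply: (measurableT_comp (f := cos)).
  by apply: continuous_measurable_fun; exact: continuous_cos.
apply: measurable_funD => //.
by under eq_fun do rewrite dotprodC; exact: measurable_dotprodr.
Qed.

Lemma integral_cos_triV n (delta : R) (u : 'rV[R]_n) :
  \int[borel_lebesgue R n]_x (cos (delta + dotprod x u) * triV x) =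
  cos delta * fejer u.
Proof.
have c1 (t : R) : `|cos t| <= 1 by rewrite ler_norml cos_geN1 cos_le1.
elim: n delta u => [|n IH] delta u.
  rewrite /fejer big_ord0 mulr1 /Rintegral.
  transitivity (fine (\int[\d_(0%R : 'rV[R]_0)]_x (cst (cos delta)%:E x : \bar R))%E).
    by congr fine; apply: eq_integral => x _; rewrite /triV /dotprod !big_ord0 addr0 mulr1.
  by rewrite integral_dirac// diracT mul1e.
pose u' : 'rV[R]_n := \row_j u ord0 (lift ord0 j).
rewrite /Rintegral integral_rVS; last first.
  by apply: integrable_triV => //; exact: measurable_cos_dotprod.
transitivity (\int[lam]_x ((cos (delta + x * u ord0 ord0) * tri x) * fejer u')).
  congr fine; apply: eq_integral => x _.
  have -> : cos (delta + x * u ord0 ord0) * tri x * fejer u' =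
     tri x * \int[borel_lebesgue R n]_v (cos (delta + x * u ord0 ord0 + dotprod v u') * triV v).
    by rewrite IH; ring.
  rewrite -RintegralZl//; last first.
    by apply: integrable_triV => //; exact: measurable_cos_dotprod.
  rewrite /Rintegral fineK.
    apply: eq_integral => v _; congr (_%:E).
    rewrite /dotprod /triV !big_ord_recl !mxE !unlift_none /= addrA mulrCA; congr (_ * (_ * _)).
      congr (cos (_ + _)); apply: eq_bigr => i _; rewrite !mxE liftK.
      by rewrite ?mxE.
    by apply: eq_bigr => i _; rewrite !mxE liftK.
  apply: integrable_fin_num => //.
  have := @integrable_triV n (fun v => cos (delta + x * u ord0 ord0 + dotprod v u')) (measurable_cos_dotprod _ _) (fun _ => c1 _).
  by move=> /(integrableZl measurableT (tri x)); apply: eq_integrable.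
rewrite RintegralZr//; last first.
  by apply: integrable_tri => //; exact: measurable_cos_affine.
rewrite integral_cos_tri_phase -mulrA; congr (_ * _).
rewrite /fejer big_ord_recl; congr (_ * _).
by apply: eq_bigr => i _; rewrite mxE.
Qed.

Lemma osc_triV n (u : 'rV[R]_n) : osc (fun x => ((triV x)%:C)%C) u = ((fejer u)%:C)%C.
Proof.
apply: (@complex_ext R) => /=.
  rewrite -[RHS]mul1r -cos0 -integral_cos_triV; apply: eq_Rintegral => x _.
  by rewrite mulr0 subr0 add0r dotprodC.
(* The sine part is the cosine integral with phase [- pi / 2], so it carries the factor
   [cos (- pi / 2) = 0]. *)
transitivity (cos (- (pi / 2)) * fejer u); last by rewrite cosN cos_pihalf mul0r.
rewrite -integral_cos_triV; apply: eq_Rintegral => x _.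
by rewrite mulr0 add0r addrC cosBpihalf dotprodC.
Qed.

Lemma osc_dilate n (c : R) (g : 'rV[R]_n -> R[i]) (u : 'rV[R]_n) : 0 < c -> dominated g ->
  osc (fun x => g (c *: x)) u = ((c ^- n)%:C)%C * osc g (c^-1 *: u).
Proof.
move=> c0 dg.
have := @cint_affine R n c 0 (fun x => expi (dotprod (c^-1 *: u) x) * g x).
rewrite gt_eqF// gtr0_norm// => /(_ isT) <-; last first.
  by apply: dominated_integrable; apply: dominated_expi => //; exact: measurable_dotprodr.
apply: eq_cint => x; rewrite addr0; congr (expi _ * _).
by rewrite dotprodZl dotprodZr mulrA mulVf ?mul1r// gt_eqF.
Qed.

End fejer_transform.

(** * Kernels with bounded marginals *)

Section schur.
Context d {T : measurableType d} {R : realType}.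
Variable m : {sigma_finite_measure set T -> \bar R}.
Variables (k : T * T -> R) (q : \bar R) (b : T -> R).
Hypothesis mk : measurable_fun setT k.
Hypothesis k0 : forall p, 0 <= k p.
Hypothesis mb : measurable_fun setT b.
Hypothesis b0 : forall x, 0 <= b x.
Hypothesis q0 : (0 <= q)%E.
Hypothesis k1 : forall x, (\int[m]_y (k (x, y))%:E <= q)%E.
Hypothesis k2 : forall y, (\int[m]_x (k (x, y))%:E <= q)%E.
Local Open Scope ereal_scope.

Let mkx x : measurable_fun setT (fun y => k (x, y)).
Proof. by apply: (measurableT_comp mk); exact: pair1_measurable. Qed.
Let mky y : measurable_fun setT (fun x => k (x, y)).
Proof. by apply: (measurableT_comp mk); exact: pair2_measurable. Qed.

Lemma measurable_kernel_weight :
  measurable_fun setT (fun p : T * T => (b p.2 ^+ 2 * k p)%:E).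
Proof.
apply/measurable_EFinP; apply: measurable_funM => //.
by apply: measurable_funX; exact: (measurableT_comp mb).
Qed.

Lemma integral_kernel_weight2 :
  \int[m]_x \int[m]_y (b y ^+ 2 * k (x, y))%:E <= q * \int[m]_y (b y ^+ 2)%:E.
Proof.
have mb2 : measurable_fun setT (fun y => (b y ^+ 2)%:E).
  by apply/measurable_EFinP; exact: measurable_funX.
have b20 y : 0 <= (b y ^+ 2)%:E by rewrite lee_fin sqr_ge0.
rewrite (fubini_tonelli (m1 := m) (m2 := m) (fun p : T * T => (b p.2 ^+ 2 * k p)%:E)); last 2 first.
- exact: measurable_kernel_weight.
- by move=> p; rewrite lee_fin mulr_ge0// sqr_ge0.
rewrite muleC -ge0_integralZr//.
apply: ge0_le_integral => //.
- by move=> z _; apply: integral_ge0 => x _; rewrite lee_fin mulr_ge0// sqr_ge0.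
- apply: (measurable_fun_fubini_tonelli_G (m1 := m) (fun p : T * T => (b p.2 ^+ 2 * k p)%:E)); first exact: measurable_kernel_weight.
  by move=> p; rewrite lee_fin mulr_ge0// sqr_ge0.
- by apply: emeasurable_funM => //; exact: measurable_cst.
move=> z _ /=; under eq_integral do rewrite EFinM.
rewrite ge0_integralZl//.
- by rewrite lee_wpmul2l.
- exact/measurable_EFinP.
- by move=> x _; rewrite lee_fin.
Qed.

Lemma integral_kernel_weight1 :
  \int[m]_x \int[m]_y (b x ^+ 2 * k (x, y))%:E <= q * \int[m]_y (b y ^+ 2)%:E.
Proof.
have mb2 : measurable_fun setT (fun y => (b y ^+ 2)%:E).
  by apply/measurable_EFinP; exact: measurable_funX.
have b20 y : 0 <= (b y ^+ 2)%:E by rewrite lee_fin sqr_ge0.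
rewrite muleC -ge0_integralZr//.
apply: ge0_le_integral => //.
- by move=> z _; apply: integral_ge0 => x _; rewrite lee_fin mulr_ge0// sqr_ge0.
- apply: (measurable_fun_fubini_tonelli_F (m2 := m) (fun p : T * T => (b p.1 ^+ 2 * k p)%:E)).
    apply/measurable_EFinP; apply: measurable_funM => //.
    by apply: measurable_funX; exact: (measurableT_comp mb).
  by move=> p; rewrite lee_fin mulr_ge0// sqr_ge0.
- by apply: emeasurable_funM => //; exact: measurable_cst.
move=> z _ /=; under eq_integral do rewrite EFinM.
rewrite ge0_integralZl//.
- by rewrite lee_wpmul2l.
- exact/measurable_EFinP.
- by move=> x _; rewrite lee_fin.
Qed.

(** Schur's test: [2 b(x) b(y) <= b(x)^2 + b(y)^2], and in each square the kernel is integrated in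
    the variable that does not occur, which costs [q]. *)
Lemma schur_bilinear :
  \int[m]_x \int[m]_y (b x * b y * k (x, y))%:E <= q * \int[m]_y (b y ^+ 2)%:E.
Proof.
have mF1 : measurable_fun setT (fun p : T * T => (b p.1 ^+ 2 * k p)%:E).
  apply/measurable_EFinP; apply: measurable_funM => //.
  by apply: measurable_funX; exact: (measurableT_comp mb).
have mF2 := measurable_kernel_weight.
have p1 (p : T * T) : 0 <= (b p.1 ^+ 2 * k p)%:E by rewrite lee_fin mulr_ge0// sqr_ge0.
have p2 (p : T * T) : 0 <= (b p.2 ^+ 2 * k p)%:E by rewrite lee_fin mulr_ge0// sqr_ge0.
have mG1 := measurable_fun_fubini_tonelli_F (m2 := m) _ mF1 p1.
have mG2 := measurable_fun_fubini_tonelli_F (m2 := m) _ mF2 p2.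
have sec (F : T * T -> \bar R) x : measurable_fun setT F -> measurable_fun setT (fun y => F (x, y)).
  by move=> mF; apply: (measurableT_comp mF); exact: pair1_measurable.
apply: (@le_trans _ _ (2^-1%:E * (\int[m]_x \int[m]_y (b x ^+ 2 * k (x, y))%:E +
   \int[m]_x \int[m]_y (b y ^+ 2 * k (x, y))%:E))); last first.
  rewrite -[leRHS]mul1e (_ : 1 = 2^-1%:E * 2%:E); last by rewrite -EFinM mulVf.
  rewrite -muleA lee_wpmul2l ?lee_fin//.
  apply: (le_trans (leeD integral_kernel_weight1 integral_kernel_weight2)).
  set Q := q * _; have Q0 : 0 <= Q.
    by rewrite mule_ge0// integral_ge0// => x _; rewrite lee_fin sqr_ge0.
  by rewrite -[in leLHS](mul1e Q) -ge0_muleDl.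
rewrite -ge0_integralD//; last 2 first.
- by move=> x _; apply: integral_ge0 => y _; exact: (p1 (x, y)).
- by move=> x _; apply: integral_ge0 => y _; exact: (p2 (x, y)).
rewrite -ge0_integralZl//; last 2 first.
- exact: emeasurable_funD.
- by move=> x _; apply: adde_ge0; apply: integral_ge0 => y _; [exact: (p1 (x, y))|exact: (p2 (x, y))].
apply: ge0_le_integral => //.
- by move=> x _; apply: integral_ge0 => y _; rewrite lee_fin !mulr_ge0.
- apply: (measurable_fun_fubini_tonelli_F (m2 := m) (fun p : T * T => (b p.1 * b p.2 * k p)%:E)).
    apply/measurable_EFinP; apply: measurable_funM => //.
    by apply: measurable_funM; exact: (measurableT_comp mb).
  by move=> p; rewrite lee_fin !mulr_ge0.
- by apply: emeasurable_funM; [exact: measurable_cst|exact: emeasurable_funD].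
move=> x _; rewrite -ge0_integralD//; last 4 first.
- by move=> y _; exact: (p1 (x, y)).
- exact: (sec _ x mF1).
- by move=> y _; exact: (p2 (x, y)).
- exact: (sec _ x mF2).
rewrite -ge0_integralZl//; last 2 first.
- by apply: emeasurable_funD; [exact: (sec _ x mF1)|exact: (sec _ x mF2)].
- by move=> y _; rewrite adde_ge0//; [exact: (p1 (x, y))|exact: (p2 (x, y))].
apply: ge0_le_integral => //.
- by move=> y _; rewrite lee_fin !mulr_ge0.
- apply/measurable_EFinP; apply: measurable_funM => //.
  by apply: measurable_funM.
- apply: emeasurable_funM; first exact: measurable_cst.
  by apply: emeasurable_funD; [exact: (sec _ x mF1)|exact: (sec _ x mF2)].
move=> y _; rewrite -EFinD -EFinM lee_fin.
have := mulr_ge0 (k0 (x, y)) (sqr_ge0 (b x - b y)); lra.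
Qed.

(** Cauchy-Schwarz for the measure with density [k (x, .)], of mass at most [q], gives the first
    factor; Tonelli and the other marginal give the second. *)
Lemma young :
  \int[m]_x ((\int[m]_y (k (x, y) * b y)%:E) * (\int[m]_y (k (x, y) * b y)%:E)) <=
  q * (q * \int[m]_y (b y ^+ 2)%:E).
Proof.
have mF2 := measurable_kernel_weight.
have p2 (p : T * T) : 0 <= (b p.2 ^+ 2 * k p)%:E by rewrite lee_fin mulr_ge0// sqr_ge0.
have mG2 := measurable_fun_fubini_tonelli_F (m2 := m) _ mF2 p2.
have mkb : measurable_fun setT (fun x => \int[m]_y (k (x, y) * b y)%:E).
  apply: (measurable_fun_fubini_tonelli_F (m2 := m) (fun p : T * T => (k p * b p.2)%:E)).
    apply/measurable_EFinP; apply: measurable_funM => //.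
    exact: (measurableT_comp mb).
  by move=> p; rewrite lee_fin !mulr_ge0.
have kb0 x : 0 <= \int[m]_y (k (x, y) * b y)%:E.
  by apply: integral_ge0 => y _; rewrite lee_fin mulr_ge0.
apply: le_trans (lee_wpmul2l q0 integral_kernel_weight2).
rewrite -ge0_integralZl//; last first.
  by move=> x _; apply: integral_ge0 => y _; exact: (p2 (x, y)).
apply: ge0_le_integral => //.
- by move=> x _; apply: mule_ge0.
- exact: emeasurable_funM.
- by apply: emeasurable_funM; [exact: measurable_cst|].
move=> x _; apply: (le_trans (sqr_integral_le m (mkx x) mb (fun y => k0 (x, y)) b0)).
rewrite /fubini_F /=; under [X in _ * X <= _]eq_integral do rewrite mulrC.
apply: lee_wpmul2r => //.
by apply: integral_ge0 => y _; exact: (p2 (x, y)).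
Qed.

End schur.

(** * Plancherel and inversion through the Fejer kernel *)

Section plancherel.
Context {R : realType} {n : nat}.
Notation V := 'rV[R]_n.
Notation mu := (borel_lebesgue R n).

(* The constant of Plancherel and of inversion; its value (morally [(2 pi)^n])
   is never needed. *)
Definition fmass : R := \int[mu]_u fejer u.

Lemma fmassE : (\int[mu]_u (fejer u)%:E = fmass%:E)%E.
Proof. by rewrite /fmass /Rintegral fineK//; exact: (integrable_fin_num _ integrable_fejer). Qed.

Lemma fmass_gt0 : 0 < fmass.
Proof. by have [c c0] := @integral_fejer R n; rewrite fmassE => -[->]. Qed.

Lemma cint_conj (g : V -> R[i]) : cintegrable mu g ->
  cint mu (fun x => ((g x)^*)%C) = ((cint mu g)^*)%C.
Proof.
move=> ig; apply: complex_ext => /=.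
  by apply: eq_Rintegral => x _; case: (g x).
rewrite -mulN1r -RintegralZl//; last exact: cintegrable_Im.
by apply: eq_Rintegral => x _; rewrite mulN1r; case: (g x).
Qed.

Lemma dominated_conj (g : V -> R[i]) : dominated g -> dominated (fun x => ((g x)^*)%C).
Proof.
move=> [mg [C gC]]; split; first exact: cmeas_conj.
by exists C => x; rewrite normc_conj.
Qed.

Lemma osc_conj (g : V -> R[i]) x : dominated g ->
  ((osc g x)^*)%C = osc (fun x => ((g x)^*)%C) (- x).
Proof.
move=> dg; rewrite -cint_conj; last first.
  by apply: dominated_integrable; apply: dominated_expi => //; exact: measurable_dotprodr.
by apply: eq_cint => y; rewrite conjCM conj_expi dotprodNl.
Qed.

Lemma osc_modulate (g : V -> R[i]) y x :
  osc (fun x => expi (dotprod y x) * g x) x = osc g (x + y).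
Proof. by apply: eq_cint => z; rewrite mulrA -expiD -dotprodDl. Qed.

(** The transform of [x |-> triV (e *: x)] ([osc_triV_dilate]): a nonnegative approximate identity
    of mass [fmass], concentrating at 0 as [e] tends to 0. *)
Definition fker (e : R) (u : V) : R := e ^- n * fejer (e^-1 *: u).

Lemma measurable_fker e : measurable_fun setT (fker e).
Proof.
apply: measurable_funM => //; apply: (measurableT_comp measurable_fejer).
have := measurable_affine_rV e^-1 (0 : V).
by congr measurable_fun; apply/funext => x; rewrite /affine_rV addr0.
Qed.

Lemma measurable_fker_subr e (x : V) : measurable_fun setT (fun z : V => fker e (x - z)).
Proof.
have := measurableT_comp (measurable_fker e) (measurable_affine_rV (-1) x).
by congr measurable_fun; apply/funext => z; rewrite /= /affine_rV scaleN1r addrC.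
Qed.

Lemma fker_ge0 e u : 0 < e -> 0 <= fker e u.
Proof. by move=> e0; rewrite mulr_ge0 ?fejer_ge0// invr_ge0 exprn_ge0// ltW. Qed.

Lemma osc_triV_dilate e (u : V) : 0 < e ->
  osc (fun x => ((triV (e *: x))%:C)%C) u = ((fker e u)%:C)%C.
Proof.
move=> e0; have d1 := @dominated_triV R n 1 ltr01.
have d : dominated (fun x : V => ((triV x)%:C)%C).
  by move: d1; congr dominated; apply/funext => x; rewrite scale1r.
rewrite (@osc_dilate R n e (fun x => ((triV x)%:C)%C))// osc_triV.
by apply: complex_ext; rewrite ?ReZ ?ImZ //= mulr0.
Qed.

Lemma integral_fkerE (e s : R) (y : V) : 0 < e -> `|s| = 1 ->
  (\int[mu]_x (fker e (s *: x + y))%:E = fmass%:E)%E.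
Proof.
move=> e0 s1; have s0 : s != 0 by rewrite -normr_eq0 s1 oner_eq0.
have mE : measurable_fun setT (fun x : V => (fejer x)%:E).
  by apply/measurable_EFinP; exact: measurable_fejer.
have c0 : e^-1 * s != 0 by rewrite mulf_neq0// invr_eq0 gt_eqF.
have E x : fker e (s *: x + y) = e ^- n * fejer ((e^-1 * s) *: x + e^-1 *: y).
  by rewrite /fker scalerDr scalerA.
have pe : 0 <= e ^- n by rewrite invr_ge0 exprn_ge0// ltW.
under eq_integral do rewrite E EFinM.
rewrite ge0_integralZl//; last 2 first.
- have := measurableT_comp mE (measurable_affine_rV (e^-1 * s) (e^-1 *: y)).
  by [].
- by move=> x _; rewrite lee_fin fejer_ge0.
rewrite (ge0_integral_affine (e^-1 *: y) (f := fun x => (fejer x)%:E) c0 mE); last first.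
  by move=> x; rewrite lee_fin fejer_ge0.
rewrite fmassE normrM s1 mulr1 normfV gtr0_norm// exprVn invrK muleA -EFinM.
by rewrite mulVf ?mul1r// expf_neq0// gt_eqF.
Qed.

Lemma cmeas_osc_conj (B : V -> R[i]) : cmeas B -> cmeas (fun x => ((osc B x)^*)%C).
Proof. by move=> mB; apply: cmeas_conj; exact: cmeas_osc. Qed.

(** The triangle makes the integral of [|osc B|^2] absolutely convergent. Two uses of the
    multiplication formula turn it into the double integral of [B(x) conj(B(z)) fker(x - z)], to
    which Schur's test applies because the kernel is nonnegative with both marginals equal to
    [fmass]. *)
Lemma plancherel_regularized (B : V -> R[i]) e : 0 < e -> dominated B ->
  (\int[mu]_x (triV (e *: x) * normc (osc B x) ^+ 2)%:E <=
   fmass%:E * \int[mu]_x (normc (B x) ^+ 2)%:E)%E.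
Proof.
move=> e0 dB; have [mB _] := dB.
have dT := @dominated_triV R n e e0.
have mO := cmeas_osc_conj mB.
have [C oC] := osc_bounded dB.
have oCc : exists C, forall x, normc (((osc B x)^*)%C) <= C.
  by exists C => x; rewrite normc_conj.
pose A x := ((osc B x)^*)%C * ((triV (e *: x))%:C)%C.
have dA : dominated A by exact: dominatedM.
have AE x : A x * osc B x = ((triV (e *: x) * normc (osc B x) ^+ 2)%:C)%C.
  rewrite /A mulrAC mulC_conj; apply: complex_ext; rewrite ?ReM ?ImM /=; ring.
have iAB : cintegrable mu (fun x => A x * osc B x).
  apply: dominated_integrable.
  have := dominatedM (cmeas_osc mB) (ex_intro _ C oC) dA.
  by congr dominated; apply/funext => x; rewrite mulrC.
have p0 x : 0 <= triV (e *: x) * normc (osc B x) ^+ 2.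
  by rewrite mulr_ge0 ?triV_ge0// sqr_ge0.
have -> : (\int[mu]_x (triV (e *: x) * normc (osc B x) ^+ 2)%:E =
   (normc (cint mu (fun x => A x * osc B x)))%:E)%E.
  under [in RHS]eq_cint do rewrite AE.
  rewrite cint_real normc_real ger0_norm; last by apply: Rintegral_ge0 => x _.
  rewrite /Rintegral fineK//; apply: integrable_fin_num => //.
  move: (cintegrable_Re iAB); congr (_.-integrable _ _).
  by apply/funext => x; exact: (congr1 (fun z => (Re z)%:E) (AE x)).
have -> : cint mu (fun x => A x * osc B x) = cint mu (fun x => B x * osc A x).
  have E1 (g h : V -> R[i]) : cint mu (fun x => g x * osc h (1 *: x)) = cint mu (fun x => g x * osc h x).
    by apply: eq_cint => x; rewrite scale1r.
  by rewrite -E1 osc_mulC// E1.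
have dBc := dominated_conj dB.
(* The conjugate of [osc B x] is the transform of the conjugate of [B] at [- x]; this is where the
   multiplication formula is used with [s = -1]. *)
have oA y : osc A y = cint mu (fun z => ((B z)^*)%C * ((fker e (y - z))%:C)%C).
  pose T (y x : V) := expi (dotprod y x) * ((triV (e *: x))%:C)%C.
  have dTy : dominated (T y).
    by apply: dominated_expi => //; exact: measurable_dotprodr.
  transitivity (cint mu (fun x => T y x * osc (fun x => ((B x)^*)%C) (-1 *: x))).
    apply: eq_cint => x; rewrite /A /T osc_conj// scaleN1r mulrCA mulrC -!mulrA.
    by rewrite mulrC -mulrA.
  rewrite osc_mulC//; apply: eq_cint => z; congr (_ * _).
  by rewrite /T scaleN1r osc_modulate osc_triV_dilate// addrC.
have mk : measurable_fun setT (fun p : V * V => fker e (p.1 - p.2)).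
  apply: (measurableT_comp (measurable_fker e)); apply: measurable_fun_rV => i.
  under eq_fun do rewrite !mxE.
  by apply: measurable_funB; apply: (measurableT_comp (measurable_coord_rV i)).
have i1 x : (\int[mu]_y (fker e (x - y))%:E = fmass%:E)%E.
  rewrite -(integral_fkerE x e0 (normrN1 R)).
  by apply: eq_integral => y _; rewrite scaleN1r addrC.
have i2 y : (\int[mu]_x (fker e (x - y))%:E = fmass%:E)%E.
  rewrite -(integral_fkerE (- y) e0 (normr1 R)).
  by apply: eq_integral => x _; rewrite scale1r.
have mnB : measurable_fun setT (normc \o B) by exact: measurable_normc.
have nB0 x : 0 <= (normc \o B) x by exact: normc_ge0.
apply: le_trans (@schur_bilinear _ _ _ mu _ fmass%:E _ mk _ mnB nB0 _ _ _); last 4 first.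
- by move=> p; exact: fker_ge0.
- by rewrite lee_fin ltW// fmass_gt0.
- by move=> x; rewrite i1.
- by move=> y; rewrite i2.
have dBA : dominated (fun x => B x * osc A x).
  have [D oD] := osc_bounded dA.
  have mA : cmeas A by case: dA.
  have := dominatedM (cmeas_osc mA) (ex_intro _ D oD) dB.
  by congr dominated; apply/funext => x; rewrite mulrC.
apply: (le_trans (normc_cint_le (dominated_integrable dBA))).
apply: ge0_le_integral => //.
- by move=> x _; rewrite lee_fin normc_ge0.
- by apply/measurable_EFinP; apply: measurable_normc; case: dBA.
- apply: (measurable_fun_fubini_tonelli_F (m2 := mu)
     (fun p : V * V => (normc (B p.1) * normc (B p.2) * fker e (p.1 - p.2))%:E)).
    apply/measurable_EFinP; apply: measurable_funM => //.
    by apply: measurable_funM; apply: (measurableT_comp mnB).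
  by move=> p; rewrite lee_fin; apply: mulr_ge0; [apply: mulr_ge0; exact: normc_ge0|exact: fker_ge0].
move=> x _; rewrite Normc.normcM EFinM.
have ik : cintegrable mu (fun z => ((B z)^*)%C * ((fker e (x - z))%:C)%C).
  have fb : exists C, forall z, normc (((fker e (x - z))%:C)%C) <= C.
    have [D oD] := osc_bounded dT; exists D => z.
    by rewrite -osc_triV_dilate.
  have mf : cmeas (fun z : V => ((fker e (x - z))%:C)%C).
    by apply: cmeas_real; exact: measurable_fker_subr.
  apply: dominated_integrable; have := dominatedM mf fb dBc.
  by congr dominated; apply/funext => z; rewrite mulrC.
have := normc_cint_le ik; rewrite -oA => H.
apply: (@le_trans _ _ ((normc (B x))%:E * \int[mu]_z (normc (B z) * fker e (x - z))%:E)%E).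
  apply: lee_wpmul2l; first by rewrite lee_fin normc_ge0.
  apply: (le_trans H); rewrite le_eqVlt; apply/orP; left; apply/eqP; apply: eq_integral => z _.
  by rewrite Normc.normcM normc_conj normc_real ger0_norm// fker_ge0.
rewrite -ge0_integralZl//.
- rewrite le_eqVlt; apply/orP; left; apply/eqP; apply: eq_integral => z _.
  by rewrite -EFinM mulrA.
- apply/measurable_EFinP; apply: measurable_funM; first exact: mnB.
  exact: measurable_fker_subr.
- by move=> z _; rewrite lee_fin; apply: mulr_ge0; [exact: normc_ge0|exact: fker_ge0].
- by rewrite lee_fin normc_ge0.
Qed.

Lemma fatou_le d (T : measurableType d) (m : {measure set T -> \bar R})
    (f_ : nat -> T -> R) (f : T -> R) (C : \bar R) :
  (forall k, measurable_fun setT (f_ k)) -> (forall k x, 0 <= f_ k x) ->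
  (forall x, f_ ^~ x @ \oo --> f x) ->
  (forall k, (\int[m]_x (f_ k x)%:E <= C)%E) -> (\int[m]_x (f x)%:E <= C)%E.
Proof.
move=> mf f0 cf fC.
have := @fatou _ _ _ m _ measurableT (fun k x => (f_ k x)%:E).
have -> : (\int[m]_x limn_einf (fun k => (f_ k x)%:E) = \int[m]_x (f x)%:E)%E.
  apply: eq_integral => x _.
  have cx : (fun k => (f_ k x)%:E) @ \oo --> (f x)%:E.
    by apply: cvg_EFin; [exact: nearW|exact: cf].
  by rewrite (cvg_limn_einf_sup cx).
move=> H; apply: (le_trans (H _ _)).
- by move=> k; apply/measurable_EFinP; exact: mf.
- by move=> k x _; rewrite lee_fin.
rewrite limn_einf_lim; apply: lime_le; first exact: is_cvg_einfs.
apply: nearW => k; apply: le_trans (fC k).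
by apply: ereal_inf_lbound; exists k => /=.
Qed.

Lemma cvg_triV (x : V) : (fun k => triV (k.+1%:R^-1 *: x)) @ \oo --> (1 : R).
Proof.
have t (y : R) : (fun k => tri (k.+1%:R^-1 * y)) @ \oo --> (1 : R).
  have c : (fun k : nat => k.+1%:R^-1 * `|y|) @ \oo --> (0 : R).
    by rewrite -(mul0r `|y|); apply: cvgM; [exact: cvg_harmonic|exact: cvg_cst].
  apply: (@squeeze_cvgr _ _ _ _ (fun k : nat => 1 - k.+1%:R^-1 * `|y|) (cst 1)).
  - apply: nearW => k; rewrite tri_le1 andbT /tri le_max; apply/orP; right.
    by rewrite normrM ger0_norm.
  - by rewrite -[X in _ --> X]subr0; apply: cvgB; [exact: cvg_cst|exact: c].
  - exact: cvg_cst.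
rewrite [X in _ --> X](_ : 1 = \prod_(i < n) (1 : R)); last by rewrite big1.
have -> : (fun k => triV (k.+1%:R^-1 *: x)) = (fun k => \prod_(i < n) tri (k.+1%:R^-1 * x ord0 i)).
  by apply/funext => k; apply: eq_bigr => i _; rewrite mxE.
apply: (@cvg_big R _ *%R 1 xpredT (@mul_continuous R) nat \oo _ _ (fun=> 1)) => i _.
exact: t.
Qed.

(** The regularization is removed by Fatou, with [e = 1 / (k + 1)]; this loses equality, but only
    the upper bound is wanted. *)
Theorem plancherel_le (B : V -> R[i]) : dominated B ->
  (\int[mu]_x (normc (osc B x) ^+ 2)%:E <=
   fmass%:E * \int[mu]_x (normc (B x) ^+ 2)%:E)%E.
Proof.
move=> dB; have [mB _] := dB.
apply: (@fatou_le _ _ mu (fun k x => triV (k.+1%:R^-1 *: x) * normc (osc B x) ^+ 2)).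
- move=> k; apply: measurable_funM.
    have := measurableT_comp measurable_triV (measurable_affine_rV k.+1%:R^-1 (0 : V)).
    by congr measurable_fun; apply/funext => x; rewrite /= /affine_rV addr0.
  by apply: measurable_funX; apply: measurable_normc; exact: cmeas_osc.
- by move=> k x; rewrite mulr_ge0 ?triV_ge0// sqr_ge0.
- move=> x; rewrite -[X in _ --> X]mul1r.
  by apply: cvgM; [exact: cvg_triV|exact: cvg_cst].
- by move=> k; apply: plancherel_regularized.
Qed.

Lemma cint_dominated_cvg d (T : measurableType d) (m : {measure set T -> \bar R})
    (f_ : nat -> T -> R[i]) (f : T -> R[i]) (h : T -> R) :
  (forall k, cmeas (f_ k)) -> cmeas f ->
  (forall x, (fun k => Re (f_ k x)) @ \oo --> Re (f x)) ->
  (forall x, (fun k => Im (f_ k x)) @ \oo --> Im (f x)) ->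
  m.-integrable setT (EFin \o h) -> (forall k x, normc (f_ k x) <= h x) ->
  ((fun k => Re (cint m (f_ k))) @ \oo --> Re (cint m f)) /\
  ((fun k => Im (cint m (f_ k))) @ \oo --> Im (cint m f)).
Proof.
move=> mf_ [mfr mfi] cr ci ih fh; split => /=.
- apply: (Rintegral_dominated_cvg _ mfr cr ih) => [k|k x]; first by case: (mf_ k).
  exact: le_trans (normc_Re _) _.
- apply: (Rintegral_dominated_cvg _ mfi ci ih) => [k|k x]; first by case: (mf_ k).
  exact: le_trans (normc_Im _) _.
Qed.

Lemma cintegrable_affine (c : R) (y : V) (g : V -> R[i]) : c != 0 -> cintegrable mu g ->
  cintegrable mu (fun x => g (c *: x + y)).
Proof.
move=> c0 [mg fg]; split; first exact: (cmeas_comp (measurable_affine_rV c y) mg).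
rewrite (ge0_integral_affine y (f := fun x => (normc (g x))%:E))//.
- by rewrite lte_mul_pinfty// ?lee_fin ?invr_ge0 ?exprn_ge0.
- by apply/measurable_EFinP; exact: measurable_normc.
- by move=> x; rewrite lee_fin normc_ge0.
Qed.

Lemma integrable_fejerZ (c : R) : mu.-integrable setT (EFin \o (fun x : V => c * fejer x)).
Proof. exact: (integrableZl measurableT c (@integrable_fejer R n)). Qed.

(** The outer integral is regularized by a triangle. The multiplication formula rewrites it as an
    average of [B] around [z] against the Fejer kernel, and dominated convergence identifies the
    limit of the same sequence [L k] in both forms. Continuity of [B] gives the identity at every
    point [z]. *)
Theorem osc_inversion (B : V -> R[i]) z : dominated B -> dominated (osc B) ->
  continuous (Re \o B) -> continuous (Im \o B) ->
  osc (osc B) (- z) = (fmass%:C)%C * B z.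
Proof.
move=> dB dO cRe cIm.
have e0 k : (0 : R) < k.+1%:R^-1 by [].
have [mB [D BD]] := dB; have [mO [C OC]] := dO.
have nBD x : normc (B x) <= `|D|.
  apply: (le_trans (BD x)); apply: (@le_trans _ _ (`|D| * weight x)).
    by rewrite ler_wpM2r ?weight_ge0// ler_norm.
  by rewrite ler_piMr// weight_le1.
have nG k u : normc (((fejer u)%:C)%C * B (k.+1%:R^-1 *: u + z)) <= `|D| * fejer u.
  rewrite Normc.normcM normc_real ger0_norm ?fejer_ge0// mulrC.
  by rewrite ler_wpM2r ?fejer_ge0.
have iG k : cintegrable mu (fun u => ((fejer u)%:C)%C * B (k.+1%:R^-1 *: u + z)).
  apply: (cintegrable_le _ (nG k) (integrable_fejerZ _)).
  apply: cmeasM; first exact: (cmeas_real measurable_fejer).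
  exact: (cmeas_comp (measurable_affine_rV k.+1%:R^-1 z) mB).
pose L k := cint mu (fun x => expi (dotprod (- z) x) *
   (((triV (k.+1%:R^-1 *: x))%:C)%C * osc B x)).
have LE k : L k = cint mu (fun u => ((fejer u)%:C)%C * B (k.+1%:R^-1 *: u + z)).
  have dT := @dominated_triV R n _ (e0 k).
  pose T (x : V) := expi (dotprod (- z) x) * ((triV (k.+1%:R^-1 *: x))%:C)%C.
  have dTz : dominated T.
    by apply: dominated_expi => //; exact: measurable_dotprodr.
  transitivity (cint mu (fun x => T x * osc B (1 *: x))).
    by apply: eq_cint => x; rewrite /T scale1r mulrA.
  rewrite osc_mulC//.
  have E x : B x * osc T (1 *: x) = B x * ((fker k.+1%:R^-1 (x - z))%:C)%C.
    by rewrite scale1r osc_modulate addrC osc_triV_dilate// addrC.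
  under eq_cint do rewrite E.
  have k0 : k.+1%:R != 0 :> R by rewrite pnatr_eq0.
  (* The substitution [u = (k + 1) (x - z)] moves the concentration from the kernel to the argument
     of [B], so that the majorant is a fixed multiple of [fejer]. *)
  have := cint_affine (- (k.+1%:R *: z)) k0 (iG k).
  rewrite ger0_norm// => /(congr1 (fun w => (((k.+1%:R ^+ n)%:C)%C) * w)).
  rewrite mulrA -rmorphM/= mulfV ?mul1r; last by rewrite expf_neq0.
  move=> <-; rewrite -cintZ; last exact: (cintegrable_affine (- (k.+1%:R *: z)) k0 (iG k)).
  apply: eq_cint => u; rewrite scalerDr scalerN !scalerA mulVf// !scale1r subrK.
  rewrite /fker invrK exprVn invrK scalerBr rmorphM/=; ring.
pose G (x : V) := ((fejer x)%:C)%C * B z.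
have GE : cint mu G = (fmass%:C)%C * B z.
  rewrite /G; under eq_cint do rewrite mulrC.
  rewrite cintZ ?cint_real; first by rewrite mulrC.
  apply: (cintegrable_le _ _ integrable_fejer); first exact: (cmeas_real measurable_fejer).
  by move=> x; rewrite normc_real ger0_norm// fejer_ge0.
have mG : cmeas G.
  by apply: cmeasM; [exact: (cmeas_real measurable_fejer)|exact: cmeas_cst].
have cz (u : V) : (fun k => k.+1%:R^-1 *: u + z) @ \oo --> z.
  rewrite -[X in _ --> X]add0r -(scale0r u); apply: cvgD; last exact: cvg_cst.
  by apply: cvgZ; [exact: cvg_harmonic|exact: cvg_cst].
have [L1 L2] : ((fun k => Re (L k)) @ \oo --> Re (cint mu G)) /\
    ((fun k => Im (L k)) @ \oo --> Im (cint mu G)).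
  have -> : L = (fun k => cint mu (fun u => ((fejer u)%:C)%C * B (k.+1%:R^-1 *: u + z))).
    by apply/funext.
  apply: (@cint_dominated_cvg _ _ mu _ _ (fun u => `|D| * fejer u)) => //.
  - by move=> k; case: (iG k).
  - move=> u; rewrite /G; under eq_cvg do rewrite ReZ.
    rewrite ReZ; apply: cvgM; first exact: cvg_cst.
    exact: (cvg_comp _ _ (cz u) (cRe z)).
  - move=> u; rewrite /G; under eq_cvg do rewrite ImZ.
    rewrite ImZ; apply: cvgM; first exact: cvg_cst.
    exact: (cvg_comp _ _ (cz u) (cIm z)).
  - exact: integrable_fejerZ.
(* In its original form the sequence converges to the double transform, because the triangles tend
   to 1; the majorant is the decay of [osc B]. *)
have [M1 M2] : ((fun k => Re (L k)) @ \oo --> Re (osc (osc B) (- z))) /\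
    ((fun k => Im (L k)) @ \oo --> Im (osc (osc B) (- z))).
  apply: (@cint_dominated_cvg _ _ mu _ _ (fun x => C * weight x)) => //.
  - move=> k; apply: cmeasM.
      by apply: cmeas_expi; exact: measurable_dotprodr.
    apply: cmeasM => //; have [] // := @dominated_triV R n _ (e0 k).
  - by apply: cmeasM => //; apply: cmeas_expi; exact: measurable_dotprodr.
  - move=> x; set w := expi _ * osc B x.
    have -> : (fun k => Re (expi (dotprod (- z) x) * (((triV (k.+1%:R^-1 *: x))%:C)%C * osc B x))) =
        (fun k => triV (k.+1%:R^-1 *: x) * Re w).
      by apply/funext => k; rewrite mulrCA ReZ.
    rewrite -[X in _ --> X]mul1r; apply: cvgM; [exact: cvg_triV|exact: cvg_cst].
  - move=> x; set w := expi _ * osc B x.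
    have -> : (fun k => Im (expi (dotprod (- z) x) * (((triV (k.+1%:R^-1 *: x))%:C)%C * osc B x))) =
        (fun k => triV (k.+1%:R^-1 *: x) * Im w).
      by apply/funext => k; rewrite mulrCA ImZ.
    rewrite -[X in _ --> X]mul1r; apply: cvgM; [exact: cvg_triV|exact: cvg_cst].
  - exact: integrable_weightZ.
  - move=> k x; rewrite !Normc.normcM normc_expi mul1r normc_real ger0_norm ?triV_ge0//.
    by apply: le_trans (OC x); rewrite ler_piMl ?normc_ge0// triV_le1.
rewrite -GE; apply: complex_ext.
- by apply: cvg_unique M1 L1; exact: Rhausdorff.
- by apply: cvg_unique M2 L2; exact: Rhausdorff.
Qed.

End plancherel.

(** * Oscillatory integrals and rapid decay *)

Section ibp.
Context {R : realType} {n : nat}.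
Notation V := 'rV[R]_n.
Notation mu := (borel_lebesgue R n).
Notation "''e_' i" := (delta_mx ord0 i : V) (at level 8, i at level 2).

Lemma weight1_shift (x s : R) : `|s| <= 1 -> weight1 (x + s) <= 3 * weight1 x.
Proof.
rewrite -ler_sqr ?nnegrE// real_normK ?num_real// expr1n => s1.
have x0 : 0 < 1 + x ^+ 2 by rewrite ltr_pwDl// sqr_ge0.
have xs0 : 0 < 1 + (x + s) ^+ 2 by rewrite ltr_pwDl// sqr_ge0.
rewrite /weight1 ler_pdivlMr// mulrC ler_pdivrMr//.
have := sqr_ge0 (x + 2 * s); nra.
Qed.

(** Comparability of [weight] at distance at most 1 along an axis: it dominates difference quotients
    uniformly in their step. *)
Lemma weight_shift (x : V) i (s : R) : `|s| <= 1 -> weight (x + s *: 'e_i) <= 3 * weight x.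
Proof.
move=> s1; rewrite /weight (bigD1 i)//= [in leRHS](bigD1 i)//= mulrA.
rewrite [X in _ * X <= _](_ : _ = \prod_(j | j != i) weight1 (x ord0 j)); last first.
  apply: eq_bigr => j ji; rewrite !mxE eqxx (negbTE ji) mulr0 addr0//.
apply: ler_wpM2r; first by apply: prodr_ge0 => j _; exact/ltW/weight1_gt0.
by rewrite !mxE !eqxx mulr1; exact: weight1_shift.
Qed.

Lemma is_derive_line (J : V -> R) (x v : V) (t : R) : differentiable J (x + t *: v) ->
  is_derive t (1 : R) (fun t => J (x + t *: v)) ('D_v J (x + t *: v)).
Proof.
move=> dJ; have E : (fun h : R => h^-1 *: ((fun t => J (x + t *: v)) (h *: (1 : R) + t) - J (x + t *: v)))
  = (fun h : R => h^-1 *: (J (h *: v + (x + t *: v)) - J (x + t *: v))).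
  apply/funext => h; congr (_ *: (J _ - _)).
  by rewrite [h *: 1]mulr1 scalerDl addrCA.
apply: DeriveDef; last by rewrite /derive [in LHS]/= E.
have dv : derivable J (x + t *: v) v by exact: diff_derivable.
by rewrite /derivable /= in dv *; rewrite E.
Qed.

Lemma Rintegral_shift (J : V -> R) (y : V) : mu.-integrable setT (EFin \o J) ->
  \int[mu]_x J (x + y) = \int[mu]_x J x.
Proof.
move=> iJ; have [mJ _] := integrableP _ _ _ iJ.
have cJ : cintegrable mu (fun x => ((J x)%:C)%C).
  apply: (@cintegrable_le _ _ _ mu _ (fun x => `|J x|)); first by apply: cmeas_real; exact/measurable_EFinP.
    by move=> x; rewrite normc_real.
  exact: (integrable_abse iJ).
have := cint_affine y (oner_neq0 R) cJ; rewrite normr1 expr1n invr1 mul1r !cint_real.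
move=> /(congr1 Re) /= <-; by apply: eq_Rintegral => x _; rewrite scale1r.
Qed.

(** Difference quotients have integral zero by translation invariance and converge to the
    derivative. The mean value theorem and [weight_shift] provide the common majorant. *)
Lemma integral_partial0 (J : V -> R) i C : (forall x, differentiable J x) ->
  measurable_fun setT (partial i J) ->
  (forall x, `|J x| <= C * weight x) -> (forall x, `|partial i J x| <= C * weight x) ->
  \int[mu]_x partial i J x = 0.
Proof.
move=> dJ mdJ JC dJC.
have mJ : measurable_fun setT J.
  by apply: measurable_rV_continuous => x; exact: differentiable_continuous.
have iJ : mu.-integrable setT (EFin \o J).
  apply: (le_integrable measurableT _ _ (integrable_weightZ C)); first exact/measurable_EFinP.
  move=> x _ /=; rewrite lee_fin (le_trans (JC x))// ler_norm//.
pose D (k : nat) x := k.+1%:R * (J (x + k.+1%:R^-1 *: 'e_i) - J x).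
have D0 k : \int[mu]_x D k x = 0.
  have iJs : mu.-integrable setT (EFin \o (fun x => J (x + k.+1%:R^-1 *: 'e_i))).
    apply: (le_integrable measurableT _ _ (integrable_weightZ (C * 3))).
      apply/measurable_EFinP.
      have := measurableT_comp mJ (measurable_affine_rV 1 (k.+1%:R^-1 *: 'e_i)).
      by congr measurable_fun; apply/funext => x; rewrite /= /affine_rV scale1r.
    have C0 : 0 <= C.
      by have := le_trans (normr_ge0 _) (JC 0); rewrite pmulr_lge0// weight_gt0.
    move=> x _ /=; rewrite lee_fin (le_trans (JC _))// (le_trans _ (ler_norm _))// -mulrA.
    by rewrite ler_wpM2l// weight_shift// ger0_norm// invf_le1// ler1n.
  rewrite RintegralZl//; last exact: (integrableB measurableT iJs iJ).
  by rewrite RintegralB// Rintegral_shift// subrr mulr0.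
have : (fun k => \int[mu]_x D k x) @ \oo --> \int[mu]_x partial i J x.
  have C0 : 0 <= C.
    by have := le_trans (normr_ge0 _) (JC 0); rewrite pmulr_lge0// weight_gt0.
  apply: (@Rintegral_dominated_cvg _ _ _ mu D _ (fun x => (C * 3) * weight x)) => //.
  - move=> k; apply: measurable_funM => //; apply: measurable_funB => //.
    have := measurableT_comp mJ (measurable_affine_rV 1 (k.+1%:R^-1 *: 'e_i)).
    by congr measurable_fun; apply/funext => x; rewrite /= /affine_rV scale1r.
  - move=> x; have : derivable J x 'e_i by exact: diff_derivable.
    rewrite /derivable => /cvgr_dnbhsP /(_ (fun k => k.+1%:R^-1)) H.
    have {H} := H (conj _ (@cvg_harmonic R)).
    rewrite -/(partial i J x) => H.
    have E : D ^~ x = (fun k => k.+1%:R^-1^-1 *: ((J \o shift x) (k.+1%:R^-1 *: 'e_i) - J x)).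
      by apply/funext => k; rewrite /D invrK /=; congr (_ * (J _ - _)); rewrite addrC.
    rewrite E; apply: H => k; by rewrite invr_eq0 pnatr_eq0.
  - exact: integrable_weightZ.
  - move=> k x.
    have h0 : (0 : R) < k.+1%:R^-1 by [].
    have [c /itvP cI E] : exists2 c, c \in `[0, k.+1%:R^-1] &
        J (x + k.+1%:R^-1 *: 'e_i) - J (x + 0 *: 'e_i) = partial i J (x + c *: 'e_i) * (k.+1%:R^-1 - 0).
      apply: (@MVT_segment _ (fun t => J (x + t *: 'e_i)) (fun t => partial i J (x + t *: 'e_i))).
      - exact: ltW.
      - by move=> t _; exact: is_derive_line.
      - apply: continuous_subspaceT => t; apply: differentiable_continuous.
        by apply/derivable1_diffP; apply: ex_derive; exact: is_derive_line.
    rewrite scale0r addr0 subr0 in E.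
    rewrite /D E mulrCA mulfV ?pnatr_eq0// mulr1 (le_trans (dJC _))// -mulrA ler_wpM2l//.
    apply: weight_shift; rewrite ger0_norm ?cI// (@le_trans _ _ k.+1%:R^-1) ?cI//.
    by rewrite invf_le1// ler1n.
have -> : (fun k => \int[mu]_x D k x) = cst 0 by apply/funext => k; exact: D0.
by move=> /cvg_unique; apply => //; exact: cvg_cst.
Qed.

End ibp.

(** * Cosine integrals: differentiation and decay *)

Section cosint.
Context {R : realType} {n : nat}.
Notation V := 'rV[R]_n.
Notation mu := (borel_lebesgue R n).
Implicit Types (a b : V -> R).

(** Monomials are given by words of indices, like iterated derivatives in [partials]: each
    derivative of a cosine integral multiplies its amplitude by one coordinate. *)
Definition rapid a := measurable_fun setT a /\
  forall s : seq 'I_n, exists C, forall x : V, `|(\prod_(i <- s) x ord0 i) * a x| <= C * weight x.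

(* The phase [delta] treats [cos] and [sin] at once and makes the family closed
   under partial derivatives. *)
Definition cosint a (delta : R) (x : V) : R :=
  \int[mu]_xi (cos (dotprod x xi + delta) * a xi).

Lemma measurable_coord i : measurable_fun setT (fun x : V => x ord0 i).
Proof. exact: (measurable_coord_rV i). Qed.

Lemma rapid_coord a i : rapid a -> rapid (fun x => x ord0 i * a x).
Proof.
move=> [ma ra]; split; first by apply: measurable_funM => //; exact: measurable_coord.
move=> s; have [C aC] := ra (rcons s i); exists C => x.
by rewrite mulrA; have := aC x; rewrite big_rcons /=.
Qed.

Lemma integrable_le_weight (f : V -> R) C : measurable_fun setT f ->
  (forall x, `|f x| <= C * weight x) -> mu.-integrable setT (EFin \o f).
Proof.
move=> mf fC; apply: (le_integrable measurableT _ _ (integrable_weightZ C)).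
  exact/measurable_EFinP.
by move=> x _ /=; rewrite lee_fin (le_trans (fC x))// ler_norm.
Qed.

Lemma rapid_bound a : rapid a -> exists C, forall x, `|a x| <= C * weight x.
Proof.
by move=> [_ /(_ [::])[C aC]]; exists C => x; have := aC x; rewrite big_nil mul1r.
Qed.

Lemma measurable_cos_phase (x : V) (p : V -> R) (d : R) : measurable_fun setT p ->
  measurable_fun setT (fun xi => cos (dotprod x xi + p xi + d)).
Proof.
move=> mp; apply: (measurableT_comp (continuous_measurable_fun (@continuous_cos R))).
apply: measurable_funD => //; apply: measurable_funD => //.
exact: measurable_dotprodr.
Qed.

Lemma measurable_cos_dotprodr (x : V) (d : R) :
  measurable_fun setT (fun xi => cos (dotprod x xi + d)).
Proof.
have := @measurable_cos_phase x (cst 0) d (measurable_cst _).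
by congr measurable_fun; apply/funext => xi; rewrite addr0.
Qed.

Lemma normr_cos_le1 (t : R) : `|cos t| <= 1.
Proof. by rewrite ler_norml cos_geN1 cos_le1. Qed.

Lemma rapid_integrable a (g : V -> R) : measurable_fun setT g -> (forall x, `|g x| <= 1) ->
  rapid a -> mu.-integrable setT (EFin \o (fun x => g x * a x)).
Proof.
move=> mg g1 ra; have [C aC] := rapid_bound ra; have [ma _] := ra.
apply: (@integrable_le_weight _ C); first exact: measurable_funM.
by move=> x; rewrite normrM (le_trans _ (aC x))// ler_piMl.
Qed.

Lemma lipschitz_derive (f f' : R -> R) K (t u : R) :
  (forall v, is_derive v (1 : R) f (f' v)) ->
  (forall v, `|v - t| <= `|u| -> `|f' v| <= K) -> `|f (t + u) - f t| <= K * `|u|.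
Proof.
move=> df fK.
have cf : continuous f.
  move=> v; apply: differentiable_continuous; apply/derivable1_diffP.
  exact: ex_derive.
have [u0|u0] := leP 0 u.
- have [c /itvP cI ->] : exists2 c, c \in `[t, t + u] & f (t + u) - f t = f' c * (t + u - t).
    by apply: MVT_segment => //; [rewrite lerDl|exact: continuous_subspaceT].
  rewrite addrAC subrr add0r normrM ler_wpM2r// fK// !ger0_norm// ?subr_ge0 ?cI//.
  by rewrite lerBlDl cI.
- have [c /itvP cI E] : exists2 c, c \in `[t + u, t] & f t - f (t + u) = f' c * (t - (t + u)).
    by apply: MVT_segment => //; [rewrite gerDl ltW|exact: continuous_subspaceT].
  rewrite distrC E opprD addrA subrr add0r normrM normrN ler_wpM2r// fK//.
  rewrite distrC (ltr0_norm u0) ger0_norm ?subr_ge0 ?cI//.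
  by rewrite lerBlDl -lerBlDr opprK cI.
Qed.

(** The mean value bound is applied twice, first to [sin] and then to the remainder; the constant 1,
    instead of the sharp 1/2, is enough. *)
Lemma cos_taylor (t u : R) : `|cos (t + u) - cos t + u * sin t| <= u ^+ 2.
Proof.
have sl (v : R) : `|v - t| <= `|u| -> `|- sin v + sin t| <= `|u|.
  move=> vu; apply: le_trans vu; rewrite addrC -normrN opprB -[v in sin v](subrK t) addrC.
  have := @lipschitz_derive sin cos 1 t (v - t) (@is_derive_sin R) (fun w _ => normr_cos_le1 w).
  by rewrite mul1r [t + _]addrC [- sin t + _]addrC.
have dg v : is_derive v (1 : R) (fun v => cos v + v * sin t) (- sin v + sin t).
  have h : is_derive v (1 : R) (fun v => v * sin t) (sin t).
    have := @is_derive_affine R 0 (sin t) v.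
    by congr is_derive; apply/funext => y; rewrite add0r mulrC.
  exact: is_deriveD.
have := lipschitz_derive dg sl.
rewrite -expr2 real_normK ?num_real//; congr (`|_| <= _); ring.
Qed.

Lemma normr_Rintegral_weight (f : V -> R) C : measurable_fun setT f ->
  (forall x, `|f x| <= C * weight x) -> `|\int[mu]_x f x| <= C * pi ^+ n.
Proof.
move=> mf fC; have iF := integrable_le_weight mf fC.
apply: (le_trans (le_normr_Rintegral measurableT iF)).
have -> : C * pi ^+ n = \int[mu]_x (C * weight x).
  rewrite RintegralZl//; last exact: integrable_weight.
  by rewrite /Rintegral integral_weight.
apply: le_Rintegral => //; last exact: integrable_weightZ.
exact: (integrable_abse iF).
Qed.

Lemma integrable_sumR d (T : measurableType d) (m : {measure set T -> \bar R}) (I : Type) (r : seq I) (F : I -> T -> R) :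
  (forall i, m.-integrable setT (EFin \o F i)) ->
  m.-integrable setT (EFin \o (fun x => \sum_(i <- r) F i x)) /\
  \int[m]_x (\sum_(i <- r) F i x) = \sum_(i <- r) \int[m]_x F i x.
Proof.
move=> iF; elim: r => [|i r [IH1 IH2]].
  split; last by rewrite big_nil; under eq_Rintegral do rewrite big_nil; rewrite /Rintegral integral0.
  rewrite (_ : _ \o _ = cst 0%E); first exact: integrable0.
  by apply/funext => x /=; rewrite big_nil.
have E : (fun x => \sum_(j <- i :: r) F j x) = (fun x => F i x + \sum_(j <- r) F j x).
  by apply/funext => x; rewrite big_cons.
rewrite E big_cons; split; last by rewrite RintegralD// IH2.
exact: (integrableD measurableT (iF i) IH1).
Qed.

(** The Taylor remainder of the cosine, integrated against the second moments of [a], is quadratic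
    in the increment. This gives the full differential under the integral sign at once, and the
    partial derivatives are read off from it. *)
Lemma is_diff_cosint a (d : R) (x : V) : rapid a ->
  differentiable (cosint a d) x /\
  forall i, partial i (cosint a d) x = cosint (fun xi => xi ord0 i * a xi) (d + pi / 2) x.
Proof.
move=> ra; set c := \row_i cosint (fun xi => xi ord0 i * a xi) (d + pi / 2) x.
have lL : GRing.linear_for *:%R (dotprod c : V -> (R : normedModType R)).
  by move=> k u v; rewrite dotprodDr dotprodZr.
pose L : {linear V -> R} := HB.pack (dotprod c : V -> (R : normedModType R)) (GRing.isLinear.Build _ _ _ _ _ lL).
have LE h : L h = dotprod c h by [].
have cL : continuous L.
  move=> y; apply: differentiable_continuous; apply: (smooth_on_diff (U := setT)) => //.
  by apply: smooth_on_dotprod; exact: openT.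
have [C aC] : exists C : 'I_n -> 'I_n -> R, forall i j (xi : V),
    `|xi ord0 i * (xi ord0 j * a xi)| <= C i j * weight xi.
  have /choice[C0 H0] : forall ij : 'I_n * 'I_n, exists C, forall xi : V,
      `|xi ord0 ij.1 * (xi ord0 ij.2 * a xi)| <= C * weight xi.
    by move=> [i j]; exact: rapid_bound (rapid_coord i (rapid_coord j ra)).
  by exists (fun i j => C0 (i, j)) => i j xi; exact: (H0 (i, j)).
have [ma _] := ra.
have idc : is_diff x (cosint a d) L.
  (* The constant bounds [(h . xi)^2 |a xi|]: expanding the square, each [|xi_i xi_j a|] is at most
     [C i j * weight], and [weight] has integral [pi^n]. *)
  apply: (@is_diff_quadratic _ _ _ _ ((\sum_i \sum_j C i j) * pi ^+ n)) => //.
  near=> h; rewrite LE.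
  pose th (xi : V) := dotprod x xi + d.
  pose F i (xi : V) := h ord0 i * (cos (th xi + pi / 2) * (xi ord0 i * a xi)).
  have mc (y : V) e : measurable_fun setT (fun xi => cos (dotprod y xi + e)).
    exact: measurable_cos_dotprodr.
  have iG (y : V) e b : rapid b -> mu.-integrable setT (EFin \o (fun xi => cos (dotprod y xi + e) * b xi)).
    by move=> rb; apply: rapid_integrable => // xi; exact: normr_cos_le1.
  have iF i : mu.-integrable setT (EFin \o F i).
    have : rapid (fun xi : V => xi ord0 i * a xi) by exact: rapid_coord.
    move=> /(iG x (d + pi / 2)) /(integrableZl measurableT (h ord0 i)).
    by congr (mu.-integrable _ _); apply/funext => xi; rewrite /F /th/= addrA.
  have [iS ES] := integrable_sumR (index_enum 'I_n) iF.
  have -> : dotprod c h = \int[mu]_xi (\sum_i F i xi).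
    rewrite ES; apply: eq_bigr => i _; rewrite !mxE mulrC -RintegralZl//.
      by apply: eq_Rintegral => xi _; rewrite /F /th addrA.
    by apply: (iG x (d + pi / 2)); exact: rapid_coord.
  rewrite -!RintegralB//; last 3 first.
  - exact: (integrableB measurableT (iG (h + x) d a ra) (iG x d a ra)).
  - exact: iG.
  - exact: iG.
  rewrite mulrAC; apply: normr_Rintegral_weight.
    apply: measurable_funB; last by have /integrableP[/measurable_EFinP] := iS.
    by apply: measurable_funB; apply: measurable_funM.
  move=> xi.
  have -> : \sum_i F i xi = - (dotprod h xi * sin (th xi)) * a xi.
    rewrite /dotprod mulr_suml -sumrN mulr_suml.
    by apply: eq_bigr => i _; rewrite /F cosDpihalf; ring.
  rewrite -!mulrBl opprK dotprodDl addrAC (addrC (dotprod h xi)).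
  rewrite (_ : dotprod x xi + dotprod h xi + d = th xi + dotprod h xi); last by rewrite /th; ring.
  rewrite normrM; apply: (@le_trans _ _ (dotprod h xi ^+ 2 * `|a xi|)).
    by rewrite ler_wpM2r// addrAC; exact: cos_taylor.
  rewrite -[X in X * _]ger0_norm ?sqr_ge0// -normrM expr2 /dotprod big_distrlr/= mulr_suml.
  apply: (le_trans (ler_norm_sum _ _ _)); rewrite !mulr_suml; apply: ler_sum => i _.
  rewrite mulr_suml; apply: (le_trans (ler_norm_sum _ _ _)); rewrite !mulr_suml; apply: ler_sum => j _.
  have -> : h ord0 i * xi ord0 i * (h ord0 j * xi ord0 j) * a xi =
     h ord0 i * h ord0 j * (xi ord0 i * (xi ord0 j * a xi)) by ring.
  rewrite normrM mulrC mulrAC; apply: ler_pM => //; rewrite normrM expr2.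
  by apply: ler_pM => //; exact: normr_coord.
split => [|i]; first exact: ex_diff.
rewrite /partial deriveE; last exact: ex_diff.
rewrite diff_val LE /dotprod (bigD1 i)//= big1 ?addr0 => [|j ji].
  by rewrite !mxE !eqxx mulr1.
by rewrite !mxE (negbTE ji) mulr0.
Unshelve. all: by end_near. Qed.

Lemma partial_cosint a (d : R) i : rapid a ->
  partial i (cosint a d) = cosint (fun xi => xi ord0 i * a xi) (d + pi / 2).
Proof. by move=> ra; apply/funext => x; have [_ ->] := is_diff_cosint d x ra. Qed.

Definition moment (s : seq 'I_n) a : V -> R := foldr (fun i b => fun xi => xi ord0 i * b xi) a s.

Lemma rapid_moment s a : rapid a -> rapid (moment s a).
Proof. by move=> ra; elim: s => //= i s IH; exact: rapid_coord. Qed.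

Lemma partials_cosint s a (d : R) : rapid a ->
  partials s (cosint a d) = cosint (moment s a) (d + (size s)%:R * (pi / 2)).
Proof.
move=> ra; elim: s => [|i s IH] /=; first by rewrite mul0r addr0.
rewrite IH partial_cosint; last exact: rapid_moment.
by congr cosint; rewrite -natr1; ring.
Qed.

Lemma smooth_on_cosint a (d : R) : rapid a -> smooth_on setT (cosint a d).
Proof.
move=> ra s x _; rewrite partials_cosint//.
by have [] := is_diff_cosint (d + (size s)%:R * (pi / 2)) x (rapid_moment s ra).
Qed.

(** Smooth functions of compact support, the support being measured in the max norm. *)
Definition test b := smooth_on setT b /\ exists r, forall x : V, r < `|x| -> b x = 0.

Lemma smooth_on_measurable b : smooth_on setT b -> measurable_fun setT b.
Proof. by move=> /smooth_on_continuous; exact: measurable_rV_continuous. Qed.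

Lemma test_bound b : test b -> exists C, forall x, `|b x| <= C * weight x.
Proof.
move=> [sb [r br]].
have [M bM] : exists M, forall x, `|b x| <= M.
  have cA : compact [set x : V | `|x| <= r].
    apply: bounded_closed_compact.
      exists r; split; first exact: num_real.
      by move=> x rx y /= yr; exact/ltW/(le_lt_trans yr).
    have := @closed_comp _ _ (fun x : V => `|x|) [set y : R | y <= r].
    apply; first by move=> x _; exact: norm_continuous.
    exact: closed_le.
  have := continuous_compact (continuous_subspaceT (smooth_on_continuous sb)) cA.
  move=> /compact_bounded[M [_ MA]]; exists (Num.max 0 (M + 1)) => x.
  have [xr|xr] := leP `|x| r; last by rewrite br// normr0 le_max lexx.
  rewrite le_max; apply/orP; right; apply: (MA (M + 1)); first by rewrite ltrDl.
  by exists x.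
have [_ [C H]] : dominated (fun x => ((b x)%:C)%C).
  by apply: (dominated_real (smooth_on_measurable sb) bM br).
by exists C => x; rewrite -normc_real.
Qed.

Lemma test_partial b i : test b -> test (partial i b).
Proof.
move=> [sb [r br]]; split; first exact: smooth_on_partial.
exists r => x rx.
have oU : open [set x : V | r < `|x|].
  have := @open_comp _ _ (fun x : V => `|x|) [set y : R | r < y].
  by apply; [move=> y _; exact: norm_continuous|exact: open_gt].
have := @partials_eq_on _ _ _ oU [:: i] b (cst 0) br x rx.
by rewrite /= partial_cst.
Qed.

Lemma testM b g : test b -> smooth_on setT g -> test (b * g).
Proof.
move=> [sb [r br]] sg; split; first by apply: smooth_onM => //; exact: openT.
by exists r => x rx; rewrite fctE br// mul0r.
Qed.

Lemma test_coord b i : test b -> test (fun x => x ord0 i * b x).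
Proof.
move=> tb; have sc : smooth_on setT (fun x : V => x ord0 i) by exact: smooth_on_coord.
have := testM tb sc.
by congr test; apply/funext => x; rewrite fctE mulrC.
Qed.

Lemma test_moment b s : test b -> test (moment s b).
Proof. by move=> tb; elim: s => //= i s IH; exact: test_coord. Qed.

Lemma momentE s b x : moment s b x = (\prod_(i <- s) x ord0 i) * b x.
Proof.
elim: s => [|i s IH] /=; first by rewrite big_nil mul1r.
by rewrite IH big_cons mulrA.
Qed.

Lemma test_rapid b : test b -> rapid b.
Proof.
move=> tb; split; first by apply: smooth_on_measurable; case: tb.
move=> s; have [C H] := test_bound (test_moment s tb); exists C => x.
by rewrite -momentE.
Qed.

(** What repeated integration by parts in the [i]-th variable asks of an amplitude. Test functions
    and the components of Schwartz functions both satisfy it ([test_decays], [schwartz_cdecays]). *)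
Definition decays i b := smooth_on setT b /\
  forall m, exists C, forall x, `|partials (nseq m i) b x| <= C * weight x.

Lemma test_decays i b : test b -> decays i b.
Proof.
move=> tb; split; first by case: tb.
move=> m; apply: test_bound; elim: m => //= m; exact: test_partial.
Qed.

Lemma decays_partial i b : decays i b -> decays i (partial i b).
Proof.
move=> [sb db]; split; first exact: smooth_on_partial.
move=> m; have [C bC] := db m.+1; exists C => x.
by rewrite -partials_rcons -cats1 -[[:: i]]/(nseq 1 i) -nseqD addn1.
Qed.

Lemma decays_bound i b : decays i b -> exists C, forall x, `|b x| <= C * weight x.
Proof. by move=> [_ /(_ 0)]. Qed.

Definition oscint (p b : V -> R) (tau delta : R) (x : V) : R :=
  \int[mu]_xi (cos (dotprod x xi + tau * p xi + delta) * b xi).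

(** The derivative in [xi_i] of [b] times the sine of the phase has integral zero. The factor [x_i]
    comes from the linear part of the phase; the other two terms come from [tau * p] and from
    [b]. *)
Lemma oscint_parts i p b (tau delta : R) (x : V) : test p -> decays i b ->
  x ord0 i * oscint p b tau delta x =
  - tau * oscint p (b * partial i p) tau delta x
  - oscint p (partial i b) tau (delta - pi / 2) x.
Proof.
move=> tp db; have [sp _] := tp; have [sb _] := db.
(* The shift by [- pi / 2] makes [cos \o q] the sine of the original phase, whose derivative is
   again the cosine in [oscint]. *)
pose q := dotprod x + (cst tau * p + cst (delta - pi / 2)).
have sq : smooth_on setT q.
  apply: smooth_onD; [exact: openT|exact: smooth_on_dotprod openT x|].
  apply: smooth_onD; [exact: openT| |by apply: smooth_on_cst; exact: openT].
  by apply: smooth_onM => //; [exact: openT|apply: smooth_on_cst; exact: openT].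
have dq y : partial i q y = x ord0 i + tau * partial i p y.
  have dp : differentiable p y by exact: (smooth_on_diff sp).
  rewrite /q partialD; last 2 first.
  - by apply: (smooth_on_diff (U := setT)) => //; exact: smooth_on_dotprod openT x.
  - by apply: differentiableD => //; exact: differentiableM.
  rewrite partial_dotprod partialD//; last exact: differentiableM.
  by rewrite partialM// !partial_cst /= mulr0 !addr0.
have qE y : q y = dotprod x y + tau * p y + (delta - pi / 2) by rewrite /q !fctE addrA.
pose J : V -> R := (cos \o q) * b.
have sJ : smooth_on setT J.
  by apply: smooth_onM => //; [exact: openT|exact: (smooth_on_cos openT)].
have cE y : cos (q y) = sin (dotprod x y + tau * p y + delta).
  by rewrite qE addrA cosBpihalf.
have dJ y : partial i J y = x ord0 i * (cos (dotprod x y + tau * p y + delta) * b y) +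
   tau * (cos (dotprod x y + tau * p y + delta) * (b * partial i p) y) +
   cos (dotprod x y + tau * p y + (delta - pi / 2)) * partial i b y.
  have dqy : differentiable q y by exact: (smooth_on_diff sq).
  have dby : differentiable b y by exact: (smooth_on_diff sb).
  have dc : is_derive (q y) (1 : R) cos (- sin (q y)) by exact: is_derive_cos.
  have dcq : differentiable (cos \o q) y by exact: (differentiable_comp1 dc).
  rewrite /J (partialM i dcq dby).
  rewrite (partial_comp1 i dc)// dq /= qE addrA sinBpihalf opprK !fctE; ring.
have mp : measurable_fun setT p by exact: smooth_on_measurable.
have mph d : measurable_fun setT (fun y => cos (dotprod x y + tau * p y + d)).
  by apply: (@measurable_cos_phase x (fun y => tau * p y)); exact: measurable_funM.
have sbp : smooth_on setT (b * partial i p).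
  by apply: smooth_onM => //; [exact: openT|exact: smooth_on_partial].
have [C0 b0] := decays_bound db.
have [C1 b1] := decays_bound (decays_partial db).
have [C2 b2] : exists C, forall y, `|(b * partial i p) y| <= C * weight y.
  apply: test_bound; have := testM (test_partial i tp) sb.
  by rewrite mulrC.
have iI (g : V -> R) C d : smooth_on setT g -> (forall y, `|g y| <= C * weight y) ->
    mu.-integrable setT (EFin \o (fun y => cos (dotprod x y + tau * p y + d) * g y)).
  move=> sg gC; apply: (@integrable_le_weight _ C).
    by apply: measurable_funM => //; exact: smooth_on_measurable.
  by move=> y; rewrite normrM (le_trans _ (gC y))// ler_piMl// normr_cos_le1.
have cb (g : V -> R) C d : (forall y, `|g y| <= C * weight y) -> forall y,
    `|cos (dotprod x y + tau * p y + d) * g y| <= C * weight y.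
  by move=> gC y; rewrite normrM (le_trans _ (gC y))// ler_piMl// normr_cos_le1.
have i0 := iI b C0 delta sb b0.
have i1 := iI _ C1 (delta - pi / 2) (smooth_on_partial i sb) b1.
have i2 := iI _ C2 delta sbp b2.
have z0 : \int[mu]_y partial i J y = 0.
  apply: (@integral_partial0 _ _ _ _ (`|C0| + (`|x ord0 i| * C0 + `|tau| * C2 + C1))).
  - by move=> y; exact: (smooth_on_diff sJ).
  - by apply: smooth_on_measurable; exact: smooth_on_partial.
  - move=> y; rewrite /J fctE normrM (@le_trans _ _ `|b y|)//.
      by rewrite ler_piMl// normr_cos_le1.
    rewrite (le_trans (b0 y))// ler_wpM2r ?weight_ge0//.
    have wp := weight_gt0 y.
    have H0 : 0 <= C0 by have := le_trans (normr_ge0 _) (b0 y); rewrite pmulr_lge0.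
    have H1 : 0 <= C1 by have := le_trans (normr_ge0 _) (b1 y); rewrite pmulr_lge0.
    have H2 : 0 <= C2 by have := le_trans (normr_ge0 _) (b2 y); rewrite pmulr_lge0.
    by rewrite (le_trans (ler_norm _))// lerDl !addr_ge0// mulr_ge0.
  - move=> y; rewrite dJ [leRHS]mulrDl -[leLHS]add0r; apply: lerD.
      by rewrite mulr_ge0// weight_ge0.
    rewrite [leRHS]mulrDl; apply: (le_trans (ler_normD _ _)); apply: lerD; last exact: cb.
    rewrite [leRHS]mulrDl; apply: (le_trans (ler_normD _ _)).
    by apply: lerD; rewrite normrM -mulrA ler_wpM2l//; exact: cb.
move: z0; under eq_Rintegral do rewrite dJ.
have j0 := integrableZl measurableT (x ord0 i) i0.
have j2 := integrableZl measurableT tau i2.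
rewrite RintegralD//; last exact: (integrableD measurableT j0 j2).
rewrite RintegralD//.
rewrite !RintegralZl// -!/(oscint _ _ _ _ _); lra.
Qed.

(* Each integration by parts trades a factor [x_i] for at most one factor
   [tau]. *)
Lemma oscint_decay i p : test p -> forall (N : nat) b, decays i b ->
  exists C, forall (sigma tau delta : R) (x : V), 1 <= sigma -> `|tau| <= sigma ->
    `|x ord0 i| ^+ N * `|oscint p b tau delta x| <= C * sigma ^+ N.
Proof.
move=> tp; elim=> [|N IH] b db.
  have [C bC] := decays_bound db; exists (C * pi ^+ n) => sigma tau delta x _ _.
  rewrite !expr0 mul1r mulr1; apply: normr_Rintegral_weight.
    apply: measurable_funM; last by apply: smooth_on_measurable; case: db.
    apply: (@measurable_cos_phase x (fun y => tau * p y)); apply: measurable_funM => //.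
    by apply: smooth_on_measurable; case: tp.
  by move=> y; rewrite normrM (le_trans _ (bC y))// ler_piMl// normr_cos_le1.
(* The factor [partial i p] has compact support, so this amplitude is a test function and remains in
   the class of the induction. *)
have dbp : decays i (b * partial i p).
  apply: test_decays; rewrite mulrC; apply: testM; first exact: test_partial.
  by case: db.
have [C1 H1] := IH _ dbp; have [C2 H2] := IH _ (decays_partial db).
exists (C1 + C2) => sigma tau delta x s1 ts; have s0 : 0 <= sigma by exact: le_trans s1.
rewrite exprSr -mulrA -normrM (oscint_parts _ _ _ tp db).
have X0 : 0 <= `|x ord0 i| ^+ N by rewrite exprn_ge0.
apply: (le_trans (ler_wpM2l X0 (ler_normB _ _))); rewrite mulrDr [leRHS]mulrDl lerD//.
  rewrite normrM normrN mulrCA exprS [leRHS]mulrCA ler_pM//;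
    by [rewrite mulr_ge0|exact: H1].
(* The term in which [b] is differentiated has gained no [tau]; the missing power of [sigma] is
   supplied by [sigma >= 1]. *)
apply: (le_trans (H2 sigma tau (delta - pi / 2) x s1 ts)).
have P : 0 <= C2 * sigma ^+ N.
  by apply: le_trans (H2 sigma tau (delta - pi / 2) x s1 ts); rewrite mulr_ge0.
by rewrite exprSr mulrA ler_peMr.
Qed.

End cosint.

(** * Schwartz functions and their Fourier transforms *)

Section rapid_decay.
Context {R : realType} {n : nat}.
Notation V := 'rV[R]_n.
Notation mu := (borel_lebesgue R n).

(** With [M] the maximum of 1 and all [|x_i|], the monomial is at most [M ^ mdegree alpha], which is
    one of the terms on the right. Mixed monomials are thus reduced to the pure powers given by
    integration by parts in a single variable. *)
Lemma monomial_le alpha (x : V) :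
  `|monomial alpha x| <= 1 + \sum_i `|x ord0 i| ^+ mdegree alpha.
Proof.
pose M := \big[Order.max/(1 : R)]_i `|x ord0 i|.
have M1 : 1 <= M by exact: bigmax_ge_id.
have xM i : `|x ord0 i| <= M by exact: le_bigmax.
have MM : M ^+ mdegree alpha <= 1 + \sum_i `|x ord0 i| ^+ mdegree alpha.
  rewrite /M; elim/big_ind: _ => [|a b Ha Hb|i _].
  - by rewrite expr1n lerDl sumr_ge0// => i _; rewrite exprn_ge0.
  - by case: (leP a b).
  - rewrite (bigD1 i)//= addrCA lerDl addr_ge0//; apply: sumr_ge0 => j _.
    exact: exprn_ge0.
apply: le_trans MM; rewrite /monomial normr_prod /mdegree -prodrXr; apply: ler_prod => i _.
by rewrite normr_ge0 normrX lerXn2r ?nnegrE// (le_trans _ M1).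
Qed.

Lemma monomial_shift alpha i (x : V) :
  monomial (fun j => alpha j + (j == i))%N x = monomial alpha x * x ord0 i.
Proof.
rewrite /monomial (bigD1 i)//= [in RHS](bigD1 i)//= eqxx addn1 exprSr -!mulrA; congr (_ * _).
rewrite mulrC; congr (_ * _); apply: eq_bigr => j /negbTE ->.
by rewrite addn0.
Qed.

(** [1 / weight x] is at most [2^n] times the product of the [x_i^2] over the coordinates with
    [|x_i| > 1]. There are finitely many such sets of coordinates, indexed by [e], so the bounds for
    the corresponding monomials can be summed. *)
Lemma monomial_weight (g : V -> R) :
  (forall alpha, exists C, forall x, `|monomial alpha x| * `|g x| <= C) ->
  exists C, forall x, `|g x| <= C * weight x.
Proof.
move=> gC.
have /choice[C CP] : forall e : {ffun 'I_n -> bool}, exists C, forall x,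
   `|monomial (fun j => 2 * e j)%N x| * `|g x| <= C by move=> e; exact: gC.
exists (2 ^+ n * \sum_e C e) => x.
pose e := [ffun j => 1 < `|x ord0 j|].
have C0 e' : 0 <= C e' by apply: le_trans (CP e' 0); rewrite mulr_ge0.
rewrite -ler_pdivrMr ?weight_gt0//; apply: (@le_trans _ _ (2 ^+ n * C e)); last first.
  by rewrite ler_wpM2l ?exprn_ge0// (bigD1 e)//= lerDl sumr_ge0.
apply: (@le_trans _ _ (2 ^+ n * (`|monomial (fun j => 2 * e j)%N x| * `|g x|))); last first.
  by rewrite ler_wpM2l ?exprn_ge0.
rewrite mulrC mulrA ler_wpM2r//.
have -> : (2 : R) ^+ n = \prod_(i < n) 2 by rewrite prodr_const card_ord.
rewrite /weight -prodfV /monomial normr_prod -big_split /=.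
apply: ler_prod => i _; rewrite /weight1 invrK ffunE.
have x2 : 0 <= x ord0 i ^+ 2 by exact: sqr_ge0.
rewrite addr_ge0//=; case: ltP => x1.
  rewrite muln1 ger0_norm// mulr2n mulrDl mul1r lerD2r.
  by rewrite -[x ord0 i ^+ 2]real_normK ?num_real// expr_ge1// ltW.
rewrite muln0 expr0 normr1 mulr1 mulr2n lerD2l.
by rewrite -[x ord0 i ^+ 2]real_normK ?num_real// expr_le1.
Qed.

Lemma monomial_rapid (g : V -> R) : measurable_fun setT g ->
  (forall alpha, exists C, forall x, `|monomial alpha x| * `|g x| <= C) -> rapid g.
Proof.
move=> mg gC; split => // s; elim: s g {mg} gC => [|i s IH] g gC.
  have [C H] := monomial_weight gC; exists C => x.
  by rewrite big_nil mul1r.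
have [|C H] := IH (fun x => x ord0 i * g x).
  move=> alpha; have [C H] := gC (fun j => alpha j + (j == i))%N; exists C => x.
  by have := H x; rewrite monomial_shift !normrM mulrA.
by exists C => x; rewrite big_cons (mulrC (x ord0 i)) -mulrA.
Qed.

Lemma mderiv_nseq i m (g : V -> R) :
  mderiv (fun j => if j == i then m else 0%N) g = partials (nseq m i) g.
Proof.
rewrite /mderiv; congr partials.
have H (s : seq 'I_n) : uniq s -> flatten [seq nseq (if j == i then m else 0%N) j | j <- s] =
    if i \in s then nseq m i else [::].
  elim: s => //= j s IH /andP[js us]; rewrite inE IH// [i == j]eq_sym.
  have [ji|_] //= := eqVneq j i; rewrite -ji.
  by rewrite (negbTE js) cats0.
by rewrite H ?enum_uniq// mem_enum.
Qed.

Lemma mderiv0 (g : V -> R) : mderiv (fun=> 0%N) g = g.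
Proof.
rewrite /mderiv; have -> : flatten [seq nseq 0 i | i <- enum 'I_n] = [::] => //.
by elim: (enum 'I_n).
Qed.

Lemma Re_mderivC beta (f : V -> R[i]) x : Re (mderivC beta f x) = mderiv beta (Re \o f) x.
Proof. by []. Qed.

Lemma Im_mderivC beta (f : V -> R[i]) x : Im (mderivC beta f x) = mderiv beta (Im \o f) x.
Proof. by []. Qed.

Definition crapid (g : V -> R[i]) := rapid (Re \o g) /\ rapid (Im \o g).
Definition cdecays (g : V -> R[i]) := forall i, decays i (Re \o g) /\ decays i (Im \o g).
Definition ctest (g : V -> R[i]) := test (Re \o g) /\ test (Im \o g).

Lemma schwartz_crapid (f : V -> R[i]) : schwartz f -> crapid f.
Proof.
move=> [sr si fC]; split; apply: monomial_rapid; try exact: smooth_on_measurable.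
- move=> alpha; have [C H] := fC alpha (fun=> 0%N); exists C => x.
  apply: le_trans (H x); apply: ler_wpM2l => //.
  by have := normc_Re (mderivC (fun=> 0%N) f x); rewrite Re_mderivC mderiv0.
- move=> alpha; have [C H] := fC alpha (fun=> 0%N); exists C => x.
  apply: le_trans (H x); apply: ler_wpM2l => //.
  by have := normc_Im (mderivC (fun=> 0%N) f x); rewrite Im_mderivC mderiv0.
Qed.

Lemma schwartz_cdecays (f : V -> R[i]) : schwartz f -> cdecays f.
Proof.
move=> [sr si fC] i; split; split => // m; apply: monomial_weight => alpha.
- have [C H] := fC alpha (fun j => if j == i then m else 0%N); exists C => x.
  apply: le_trans (H x); apply: ler_wpM2l => //.
  by have := normc_Re (mderivC (fun j => if j == i then m else 0%N) f x); rewrite Re_mderivC mderiv_nseq.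
- have [C H] := fC alpha (fun j => if j == i then m else 0%N); exists C => x.
  apply: le_trans (H x); apply: ler_wpM2l => //.
  by have := normc_Im (mderivC (fun j => if j == i then m else 0%N) f x); rewrite Im_mderivC mderiv_nseq.
Qed.

Lemma ctest_crapid g : ctest g -> crapid g.
Proof. by move=> [tr ti]; split; exact: test_rapid. Qed.

Lemma ctest_cdecays g : ctest g -> cdecays g.
Proof. by move=> [tr ti] i; split; exact: test_decays. Qed.

Lemma crapid_cmeas g : crapid g -> cmeas g.
Proof. by move=> [[? _] [? _]]. Qed.

Lemma crapid_dominated g : crapid g -> dominated g.
Proof.
move=> rg; split; first exact: crapid_cmeas.
have [/rapid_bound[C HC] /rapid_bound[D HD]] := rg.
exists (C + D) => x; rewrite mulrDl (le_trans (normc_le _))// lerD//.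
  exact: HC.
exact: HD.
Qed.

Lemma osc_cosint g x : crapid g ->
  Re (osc g x) = cosint (Re \o g) 0 x + cosint (Im \o g) (pi / 2) x /\
  Im (osc g x) = cosint (Im \o g) 0 x + cosint (Re \o g) (- (pi / 2)) x.
Proof.
move=> [rr ri].
have iG d b : rapid b -> mu.-integrable setT (EFin \o (fun xi => cos (dotprod x xi + d) * b xi)).
  move=> rb; apply: rapid_integrable => //; first exact: measurable_cos_dotprodr.
  by move=> xi; exact: normr_cos_le1.
split; rewrite /= /cosint -RintegralD//; try exact: iG; apply: eq_Rintegral => xi _.
  by rewrite ReM /expi /= addr0 cosDpihalf mulNr.
by rewrite ImM /expi /= addr0 cosBpihalf.
Qed.

Lemma cosint_opp (b : V -> R) d x : cosint b d (- x) = cosint b (- d) x.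
Proof. by apply: eq_Rintegral => xi _; rewrite dotprodNl -cosN opprD opprK. Qed.

Lemma smooth_osc g : crapid g ->
  smooth_on setT (Re \o osc g) /\ smooth_on setT (Im \o osc g).
Proof.
move=> rg; have [rr ri] := rg; split.
  apply: (@smooth_on_eq _ _ _ openT (cosint (Re \o g) 0 + cosint (Im \o g) (pi / 2))).
    by move=> x _; exact: esym (osc_cosint x rg).1.
  by apply: smooth_onD; [exact: openT|exact: smooth_on_cosint|exact: smooth_on_cosint].
apply: (@smooth_on_eq _ _ _ openT (cosint (Im \o g) 0 + cosint (Re \o g) (- (pi / 2)))).
  by move=> x _; exact: esym (osc_cosint x rg).2.
by apply: smooth_onD; [exact: openT|exact: smooth_on_cosint|exact: smooth_on_cosint].
Qed.

Lemma smooth_osc_opp g : crapid g ->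
  smooth_on setT (fun x => Re (osc g (- x))) /\ smooth_on setT (fun x => Im (osc g (- x))).
Proof.
move=> rg; have [rr ri] := rg; split.
  apply: (@smooth_on_eq _ _ _ openT (cosint (Re \o g) (- 0) + cosint (Im \o g) (- (pi / 2)))).
    by move=> x _; rewrite (osc_cosint (- x) rg).1 !cosint_opp.
  by apply: smooth_onD; [exact: openT|exact: smooth_on_cosint|exact: smooth_on_cosint].
apply: (@smooth_on_eq _ _ _ openT (cosint (Im \o g) (- 0) + cosint (Re \o g) (- - (pi / 2)))).
  by move=> x _; rewrite (osc_cosint (- x) rg).2 !cosint_opp.
by apply: smooth_onD; [exact: openT|exact: smooth_on_cosint|exact: smooth_on_cosint].
Qed.

(** The case of a vanishing phase function in [oscint_decay], with [sigma = tau = 1]. *)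
Lemma cosint_decay i (b : V -> R) N : decays i b ->
  exists C, forall (d : R) (x : V), `|x ord0 i| ^+ N * `|cosint b d x| <= C.
Proof.
move=> db; have t0 : test (cst 0 : V -> R).
  by split; [apply: smooth_on_cst; exact: openT|exists 0].
have [C H] := oscint_decay t0 N db; exists C => d x.
have := H 1 1 d x (lexx _); rewrite normr1 => /(_ (lexx _)); rewrite expr1n mulr1; congr (_ * `|_| <= _).
by apply: eq_Rintegral => xi _; rewrite mulr0 addr0.
Qed.

Lemma monomial_decay (F : V -> R) alpha :
  (forall N, exists C, forall i (x : V), `|x ord0 i| ^+ N * `|F x| <= C) ->
  (exists C, forall x, `|F x| <= C) ->
  exists C, forall x, `|monomial alpha x| * `|F x| <= C.
Proof.
move=> /(_ (mdegree alpha))[C HC] [D HD].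
exists (D + C *+ n) => x.
apply: (le_trans (ler_wpM2r (normr_ge0 _) (monomial_le alpha x))).
rewrite mulrDl mul1r lerD// mulr_suml.
rewrite -[in leRHS](card_ord n) -sumr_const; apply: ler_sum => i _.
exact: HC.
Qed.

Lemma partialsD s (f g : V -> R) : smooth_on setT f -> smooth_on setT g ->
  partials s (f + g) = partials s f + partials s g.
Proof.
move=> sf sg; elim: s => //= i s ->; apply/funext => x.
rewrite partialD//; first exact: (smooth_on_diff (smooth_on_partials s sf)).
exact: (smooth_on_diff (smooth_on_partials s sg)).
Qed.

Lemma monomial_cosint (b : V -> R) (d : R) alpha : rapid b -> (forall i, decays i b) ->
  exists C, forall x, `|monomial alpha x| * `|cosint b d x| <= C.
Proof.
move=> rb db; apply: monomial_decay => [N|].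
  have /choice[C H] : forall i, exists C, forall (d : R) (x : V), `|x ord0 i| ^+ N * `|cosint b d x| <= C.
    by move=> i; exact: cosint_decay.
  exists (\sum_i `|C i|) => i x; apply: (le_trans (H i d x)).
  by rewrite (bigD1 i)//= (le_trans (ler_norm _))// lerDl sumr_ge0.
have [C bC] := rapid_bound rb; exists (C * pi ^+ n) => x.
apply: normr_Rintegral_weight.
  by apply: measurable_funM; [exact: measurable_cos_dotprodr|case: rb].
by move=> y; rewrite normrM (le_trans _ (bC y))// ler_piMl// normr_cos_le1.
Qed.

Lemma cosint2_monomial (b c : V -> R) (d e : R) alpha :
  rapid b -> (forall i, decays i b) -> rapid c -> (forall i, decays i c) ->
  exists C, forall x, `|monomial alpha x| * `|cosint b d x + cosint c e x| <= C.
Proof.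
move=> rb db rc dc.
have [C HC] := monomial_cosint d alpha rb db; have [D HD] := monomial_cosint e alpha rc dc.
exists (C + D) => x; apply: le_trans (lerD (HC x) (HD x)).
by rewrite -mulrDr ler_wpM2l// ler_normD.
Qed.

Lemma dominated_osc g : crapid g -> cdecays g -> dominated (osc g).
Proof.
move=> rg dg; split; first exact: cmeas_osc (crapid_cmeas rg).
have [rr ri] := rg.
have dr i : decays i (Re \o g) by case: (dg i).
have di i : decays i (Im \o g) by case: (dg i).
have [C HC] : exists C, forall x, `|Re (osc g x)| <= C * weight x.
  apply: monomial_weight => alpha.
  have [C HC] := cosint2_monomial 0 (pi / 2) alpha rr dr ri di; exists C => x.
  by rewrite (osc_cosint x rg).1.
have [D HD] : exists C, forall x, `|Im (osc g x)| <= C * weight x.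
  apply: monomial_weight => alpha.
  have [D HD] := cosint2_monomial 0 (- (pi / 2)) alpha ri di rr dr; exists D => x.
  by rewrite (osc_cosint x rg).2.
by exists (C + D) => x; rewrite mulrDl (le_trans (normc_le _))// lerD.
Qed.

(** A derivative of a cosine integral is the cosine integral of a moment. Moments of test functions
    are test functions, so all derivatives decay as the integral itself does. This makes [osc g] an
    admissible datum in the local hypothesis. *)
Lemma schwartz_osc g : ctest g -> schwartz (osc g).
Proof.
move=> tg; have rg := ctest_crapid tg; have [sr si] := smooth_osc rg.
have [tr ti] := tg; split => // alpha beta.
set s := flatten [seq nseq (beta i) i | i <- enum 'I_n].
have H (b c : V -> R) (d e : R) : test b -> test c -> exists C, forall x,
    `|monomial alpha x| * `|mderiv beta (cosint b d + cosint c e) x| <= C.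
  move=> tb tc; rewrite /mderiv -/s partialsD; [|exact: smooth_on_cosint (test_rapid _)..].
  rewrite !partials_cosint; [|exact: test_rapid..].
  apply: cosint2_monomial.
  - exact/test_rapid/test_moment.
  - by move=> i; exact/test_decays/test_moment.
  - exact/test_rapid/test_moment.
  - by move=> i; exact/test_decays/test_moment.
have [C HC] := H _ _ 0 (pi / 2) tr ti; have [D HD] := H _ _ 0 (- (pi / 2)) ti tr.
exists (C + D) => x; apply: le_trans (lerD (HC x) (HD x)).
rewrite -mulrDr ler_wpM2l//; apply: (le_trans (normc_le _)).
rewrite Re_mderivC Im_mderivC.
have -> : Re \o osc g = cosint (Re \o g) 0 + cosint (Im \o g) (pi / 2).
  by apply/funext => y; exact: (osc_cosint y rg).1.
have -> // : Im \o osc g = cosint (Im \o g) 0 + cosint (Re \o g) (- (pi / 2)).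
by apply/funext => y; exact: (osc_cosint y rg).2.
Qed.

Lemma measurable_dotprodl (x : V) : measurable_fun setT (fun y => dotprod y x).
Proof. by have := measurable_dotprodr x; congr measurable_fun; apply/funext => y; rewrite dotprodC. Qed.

Lemma integralC_cint (g : V -> R[i]) : cmeas g -> integralC g = cint mu g.
Proof.
move=> [mr mi]; apply: complex_ext => /=.
  exact: (Rintegral_lebesgue_rV mr).
exact: (Rintegral_lebesgue_rV mi).
Qed.

Lemma fourierE (f : V -> R[i]) : cmeas f -> fourier f = (fun xi => osc f (- xi)).
Proof.
move=> mf; apply/funext => xi; rewrite /fourier integralC_cint.
  by apply: eq_cint => x; rewrite dotprodNl dotprodC.
apply: cmeasM => //; apply: cmeas_expi.
by apply: measurableT_comp => //; exact: measurable_dotprodl.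
Qed.

(** The propagator with its time frozen and its Fourier transform replaced by an arbitrary
    amplitude, so that bounds uniform in the time can be used at [t x]. *)
Definition wave (phi : V -> R) (tau : R) (g : V -> R[i]) (x : V) : R[i] :=
  cint mu (fun xi => expi (dotprod x xi + tau * phi xi) * g xi).

Lemma propagatorE (phi t : V -> R) (f : V -> R[i]) x : measurable_fun setT phi ->
  cmeas (fourier f) -> propagator phi t f x = wave phi (t x) (fourier f) x.
Proof.
move=> mphi mf; rewrite /propagator integralC_cint//; apply: cmeasM => //.
apply: cmeas_expi; apply: measurable_funD; first exact: measurable_dotprodr.
exact: measurable_funM.
Qed.

Lemma cmeas_opp (g : V -> R[i]) : cmeas g -> cmeas (fun x : V => g (- x)).
Proof.
move=> mg; have := cmeas_comp (measurable_affine_rV (-1) (0 : V)) mg.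
by congr cmeas; apply/funext => x; rewrite /= /affine_rV addr0 scaleN1r.
Qed.

Lemma weightN (x : V) : weight (- x) = weight x.
Proof. by apply: eq_bigr => i _; rewrite mxE /weight1 sqrrN. Qed.

Lemma dominated_opp (g : V -> R[i]) : dominated g -> dominated (fun x => g (- x)).
Proof.
move=> [mg [C gC]]; split; first exact: cmeas_opp.
by exists C => x; rewrite -weightN.
Qed.

Lemma dominated_fourier (f : V -> R[i]) : schwartz f -> dominated (fourier f).
Proof.
move=> sf; have rf := schwartz_crapid sf; rewrite fourierE; last exact: crapid_cmeas.
by apply: dominated_opp; apply: dominated_osc => //; exact: schwartz_cdecays.
Qed.

Lemma smooth_fourier (f : V -> R[i]) : schwartz f ->
  smooth_on setT (Re \o fourier f) /\ smooth_on setT (Im \o fourier f).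
Proof.
move=> sf; have rf := schwartz_crapid sf; rewrite fourierE; last exact: crapid_cmeas.
exact: smooth_osc_opp.
Qed.

(** Off the origin [phi] is continuous; its value at 0 is unrestricted and affects preimages only by
    the measurable set [[set 0]]. *)
Lemma measurable_punctured (phi : V -> R) :
  smooth_on [set xi : V | xi != 0] phi -> measurable_fun setT phi.
Proof.
move=> sp.
have sE : [set xi : V | xi != 0] = [set xi : V | 0 < `|xi|].
  by apply/seteqP; split => x /=; rewrite normr_gt0.
have oU : open [set xi : V | xi != 0].
  rewrite sE; have := @open_comp _ _ (fun x : V => `|x|) [set y : R | 0 < y].
  by apply; [move=> y _; exact: norm_continuous|exact: open_gt].
have m0 : measurable [set (0 : V)].
  rewrite -[X in measurable X]setCK; apply: measurableC; apply: measurable_rV_open.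
  by rewrite (_ : ~` _ = [set xi : V | xi != 0])//; apply/seteqP; split => x /= /eqP.
apply: (measurability _ (RGenOpens.measurableE R)) => _ [_ [a [b ->]] <-].
rewrite setTI; set A := `]a, b[%classic; have oA : open A by exact: interval_open.
rewrite (_ : phi @^-1` A = (phi @^-1` A `&` [set xi | xi != 0]) `|` (phi @^-1` A `&` [set 0])); last first.
  rewrite -setIUr (_ : _ `|` _ = setT) ?setIT//.
  by apply/seteqP; split => x //= _; have [->|x0] := eqVneq x 0; [right|left].
apply: measurableU.
  apply: measurable_rV_open; rewrite openE => x [/= Ax x0]; apply: filterI; last exact: open_nbhs_nbhs.
  have cx : {for x, continuous phi} by apply: differentiable_continuous; exact: (smooth_on_diff sp).
  by apply: cx; exact: open_nbhs_nbhs.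
have [A0|A0] := pselect (A (phi 0)).
  rewrite (_ : _ `&` _ = [set 0])//; apply/seteqP; split => x /=; first by case.
  by move=> ->.
rewrite (_ : _ `&` _ = set0)//; apply/seteqP; split => x //= [+ x0].
by rewrite x0 => /A0.
Qed.

End rapid_decay.

(** * Reduction to the Borel measure and low frequencies *)

Section L2.
Context {R : realType} {n : nat}.
Notation V := 'rV[R]_n.
Notation mu := (borel_lebesgue R n).
Notation nu := (lebesgue_rV R n).
Local Open Scope ereal_scope.

Lemma L2normE (E : set V) (g : V -> R[i]) :
  L2norm E g = (\int[nu]_x (\1_E x * normc (g x) ^+ 2)%:E) `^ 2^-1.
Proof.
rewrite /L2norm unlock/=; congr (_ `^ _); apply: eq_integral => x _ /=.
rewrite (@powR_mulrn _ _ 2)// ger0_norm.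
  by rewrite /patch indicE; case: ifPn => _; rewrite ?mul1r// mul0r expr0n.
by rewrite /patch; case: ifPn => _ //; exact: normc_ge0.
Qed.

Lemma ge0_integralZ_real d (T : measurableType d) (m : {measure set T -> \bar R})
    (c : R) (f : T -> R) : (0 <= c)%R -> measurable_fun setT f -> (forall x, 0 <= f x)%R ->
  \int[m]_x (c * f x)%:E = c%:E * \int[m]_x (f x)%:E.
Proof.
move=> c0 mf f0; under eq_integral do rewrite EFinM.
rewrite ge0_integralZl//.
- exact/measurable_EFinP.
- by move=> x _; rewrite lee_fin.
Qed.

Lemma sqn_ge0 (E : set V) (g : V -> R[i]) x : (0 <= \1_E x * normc (g x) ^+ 2)%R.
Proof. by rewrite mulr_ge0// sqr_ge0. Qed.

(** Removes square roots: from here on all estimates compare integrals of squares, where infinite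
    values need no separate treatment. *)
Lemma L2norm_le (C : R) (E E' : set V) (g g' : V -> R[i]) : (0 <= C)%R ->
  (L2norm E g <= C%:E * L2norm E' g') =
  (\int[nu]_x (\1_E x * normc (g x) ^+ 2)%:E <=
   (C ^+ 2)%:E * \int[nu]_x (\1_E' x * normc (g' x) ^+ 2)%:E).
Proof.
move=> C0; rewrite !L2normE.
set A := (X in X `^ _ <= _); set B := (X in _ * X `^ _).
have A0 : 0 <= A by apply: integral_ge0 => x _; rewrite lee_fin sqn_ge0.
have B0 : 0 <= B by apply: integral_ge0 => x _; rewrite lee_fin sqn_ge0.
have CE : C%:E = (C ^+ 2)%:E `^ 2^-1.
  by rewrite poweR_EFin powR12_sqrt ?sqr_ge0// sqrtr_sqr ger0_norm.
have C20 : 0 <= (C ^+ 2)%:E by rewrite lee_fin sqr_ge0.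
rewrite CE -poweRM//; apply/idP/idP => [|AB].
  move=> /(@gt0_ler_poweR _ 2 (ler0n _ 2)).
  rewrite -!poweRrM mulVf// !poweRe1// ?mule_ge0//.
  by apply; rewrite ?in_itv/= ?poweR_ge0 ?leey.
by apply: gt0_ler_poweR => //; rewrite ?in_itv/= ?leey ?andbT// mule_ge0.
Qed.

(** Measurability of a parameter integral on the product of the completed space in [x] with the
    Borel space in [xi]; [t] is measurable only for the former. *)
Lemma cmeas_wave (phi : V -> R) (t : V -> R) (g : V -> R[i]) :
  measurable_fun setT phi -> cmeas g -> lebesgue_measurable t ->
  cmeas (fun x : lebesgue_rVType R n => wave phi (t x) g x).
Proof.
move=> mphi mg mt.
apply: (@cmeas_cint _ _ (lebesgue_rVType R n) V R mu
  (fun p => expi (dotprod (p.1 : V) p.2 + t p.1 * phi p.2) * g p.2)%R).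
apply: cmeasM; last exact: (cmeas_comp measurable_snd mg).
apply: cmeas_expi; apply: measurable_funD.
  have h : measurable_fun setT (fun p : lebesgue_rVType R n * V => (p.1 : V, p.2)).
    apply: measurable_fun_pair; last exact: measurable_snd.
    exact: (measurableT_comp measurable_id_lebesgue_rV measurable_fst).
  exact: (measurableT_comp (@measurable_dotprod R n) h).
apply: measurable_funM; first exact: (measurableT_comp mt measurable_fst).
exact: (measurableT_comp mphi measurable_snd).
Qed.

Lemma measurable_unit_ball : measurable (@unit_ball R n).
Proof.
apply: measurable_rV_open.
have cs : continuous (fun x : V => \sum_i x ord0 i ^+ 2)%R.
  apply: smooth_on_continuous; apply: smooth_on_sum; first exact: openT.
  by move=> i; under eq_fun do rewrite expr2; apply: smooth_onM; [exact: openT|exact: smooth_on_coord..].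
have -> : @unit_ball R n = (fun x : V => \sum_i x ord0 i ^+ 2)%R @^-1` [set y | y < 1]%R.
  have E (y : R) : (Num.sqrt y < 1 = (y < 1))%R by rewrite -{1}(@sqrtr1 R) ltr_sqrt.
  by apply/seteqP; split => x; rewrite /unit_ball /mkset /enorm E.
by move/continuousP : cs; apply; exact: open_lt.
Qed.

Lemma waveZ (phi : V -> R) tau (c : R[i]) (g : V -> R[i]) x : measurable_fun setT phi ->
  dominated g -> wave phi tau (fun xi => c * g xi)%R x = (c * wave phi tau g x)%R.
Proof.
move=> mphi dg; rewrite /wave -cintZ; last first.
  apply: dominated_integrable; apply: dominated_expi => //.
  by apply: measurable_funD; [exact: measurable_dotprodr|exact: measurable_funM].
by apply: eq_cint => xi; rewrite mulrCA.
Qed.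

Lemma measurable_bracket : measurable_fun setT (@bracket R n).
Proof.
have cs : continuous (fun x : V => \sum_i x ord0 i ^+ 2)%R.
  apply: smooth_on_continuous; apply: smooth_on_sum; first exact: openT.
  by move=> i; under eq_fun do rewrite expr2; apply: smooth_onM; [exact: openT|exact: smooth_on_coord..].
have -> : @bracket R n = (fun x : V => Num.sqrt (1 + \sum_i x ord0 i ^+ 2))%R.
  by apply/funext => x; rewrite /bracket /enorm sqr_sqrtr// sumr_ge0// => i _; rewrite sqr_ge0.
apply: (measurableT_comp (continuous_measurable_fun (@sqrt_continuous R))).
apply: measurable_funD => //; exact: measurable_rV_continuous.
Qed.

Lemma measurable_bracket_powR (s : R) : measurable_fun setT (fun x : V => bracket x `^ s)%R.
Proof. exact: (measurableT_comp (measurable_powR s) measurable_bracket). Qed.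

(** The local hypothesis in terms of amplitudes: by inversion [osc G] is a Schwartz function with
    Fourier transform [fmass * G], and [fmass^2] cancels from the two sides. *)
Lemma hypothesis_ctest (phi : V -> R) (s C : R) : measurable_fun setT phi ->
  (forall t : V -> R, lebesgue_measurable t -> (forall x, 0 <= t x <= 1)%R ->
   forall f, schwartz f ->
     L2norm unit_ball (propagator phi t f) <= C%:E * sobolev_norm s f) ->
  forall t : V -> R, lebesgue_measurable t -> (forall x, 0 <= t x <= 1)%R ->
  forall G, ctest G ->
  \int[nu]_x (\1_unit_ball x * normc (wave phi (t x) G x) ^+ 2)%:E <=
  (C ^+ 2)%:E * \int[mu]_xi ((bracket xi `^ s * normc (G xi)) ^+ 2)%:E.
Proof.
move=> mphi H t mt t01 G tG.
have rG := ctest_crapid tG; have dG := crapid_dominated rG.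
have [cGr cGi] : continuous (Re \o G) /\ continuous (Im \o G).
  by case: tG => -[sr _] [si _]; split; exact: smooth_on_continuous.
have dO := dominated_osc rG (ctest_cdecays tG).
have FE : fourier (osc G) = (fun xi => ((@fmass R n)%:C)%C * G xi)%R.
  rewrite fourierE; last by case: dO.
  by apply/funext => xi; exact: osc_inversion.
have := H t mt t01 _ (schwartz_osc tG).
set f := osc G in FE *.
have PE x : propagator phi t f x = (((@fmass R n)%:C)%C * wave phi (t x) G x)%R.
  rewrite propagatorE//; last by rewrite FE; apply: cmeasM; [exact: cmeas_cst|case: dG].
  by rewrite FE waveZ.
have S0 : 0 <= sobolev_norm s f by rewrite /sobolev_norm L2normE poweR_ge0.
(* The constant of the hypothesis has no prescribed sign; passing to [|C|] allows squaring. *)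
move=> HC; have : L2norm unit_ball (propagator phi t f) <= `|C|%:E * sobolev_norm s f.
  by apply: (le_trans HC); rewrite lee_wpmul2r// lee_fin ler_norm.
rewrite /sobolev_norm L2norm_le// real_normK ?num_real//.
have f0 : (0 < @fmass R n ^+ 2)%R by rewrite exprn_gt0// fmass_gt0.
have mB : measurable_fun setT (fun xi : V => ((bracket xi `^ s * normc (G xi)) ^+ 2)%:E).
  apply/measurable_EFinP; apply: measurable_funX; apply: measurable_funM.
    exact: measurable_bracket_powR.
  by apply: measurable_normc; case: dG.
have -> : \int[nu]_x (\1_[set: V] x * normc ((bracket x `^ s)%:C%C * fourier f x) ^+ 2)%:E =
    (@fmass R n ^+ 2)%:E * \int[mu]_xi ((bracket xi `^ s * normc (G xi)) ^+ 2)%:E.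
  rewrite -ge0_integralZl//; last 2 first.
  - by move=> x _; rewrite lee_fin sqr_ge0.
  - by rewrite lee_fin ltW.
  rewrite -ge0_integral_lebesgue_rV//; last 2 first.
  - by apply: emeasurable_funM => //; exact: measurable_cst.
  - by move=> x; rewrite -EFinM lee_fin mulr_ge0// ?sqr_ge0// ltW.
  apply: eq_integral => x _; rewrite indicT mul1r FE !Normc.normcM !normc_real -EFinM.
  rewrite (ger0_norm (powR_ge0 _ _)) [`|fmass|%R]ger0_norm ?(ltW (@fmass_gt0 R n))//.
  by congr (_%:E); ring.
have -> : \int[nu]_x (\1_unit_ball x * normc (propagator phi t f x) ^+ 2)%:E =
    (@fmass R n ^+ 2)%:E * \int[nu]_x (\1_unit_ball x * normc (wave phi (t x) G x) ^+ 2)%:E.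
  rewrite -ge0_integralZ_real; [|by rewrite ltW| |by move=> x; exact: sqn_ge0]; last first.
    apply: measurable_funM.
      by apply: lebesgue_measurable_borel; exact: measurable_indic measurable_unit_ball.
    apply: measurable_funX; apply: measurable_normc; apply: cmeas_wave => //.
    by case: dG.
  apply: eq_integral => x _; rewrite PE Normc.normcM normc_real.
  by rewrite [`|fmass|%R]ger0_norm ?(ltW (@fmass_gt0 R n))//; congr (_%:E); ring.
by rewrite muleCA lee_pmul2l.
Qed.

Lemma integral_phase_derivative (tau c b : R) : (0 <= tau)%R ->
  \int[@lebesgue_measure R]_(s in `[0%R, tau]) (b * cos (c + s * b + pi / 2))%:E =
  (cos (c + tau * b) - cos c)%:E.
Proof.
rewrite le_eqVlt => /predU1P[<-|t0].
  by rewrite set_itv1 integral_set1 mul0r addr0 subrr.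
have dphase s : is_derive s (1 : R)%R (fun s : R => c + s * b)%R b.
  have := is_derive_affine c b s; congr (is_derive _ _ _ _).
  by apply/funext => y; rewrite mulrC.
pose F (s : R) := cos (c + s * b)%R.
have dF s : is_derive s (1 : R)%R F (- sin (c + s * b) * b)%R.
  exact: (is_derive1_comp (is_derive_cos _) (dphase s)).
have dG s : is_derive s (1 : R)%R (fun s => sin (c + s * b))%R (cos (c + s * b) * b)%R.
  exact: (is_derive1_comp (is_derive_sin _) (dphase s)).
have E s : (b * cos (c + s * b + pi / 2) = - sin (c + s * b) * b)%R.
  by rewrite cosDpihalf; ring.
under eq_integral do rewrite E.
have cF : continuous F.
  by move=> x; apply/differentiable_continuous/derivable1_diffP; case: (dF x).
rewrite (@continuous_FTC2 _ _ F)//.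
- by rewrite /F mul0r addr0.
- apply: continuous_subspaceT => x; apply: cvgM; last exact: cvg_cst.
  by apply: cvgN; apply/differentiable_continuous/derivable1_diffP; case: (dG x).
- split; first by move=> x _; case: (dF x).
    by apply: cvg_at_right_filter; exact: cF.
  by apply: cvg_at_left_filter; exact: cF.
- by move=> x _; rewrite derive1E; case: (dF x).
Qed.

End L2.

(** * Low frequencies by integration in time *)

Section low_frequency.
Context {R : realType} {n : nat}.
Notation V := 'rV[R]_n.
Notation mu := (borel_lebesgue R n).
Notation nu := (lebesgue_rV R n).
Notation lam := (@lebesgue_measure R).

(** The fundamental theorem of calculus in time, with the factor [i] written as the phase [pi / 2]:
    the real and imaginary parts are then the same cosine identity with different phases. *)
Lemma expi_increment (tau c b : R) : (0 <= tau)%R ->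
  expi (c + tau * b) - expi c =
  cint lam (fun s => ((\1_(`[0, tau]%classic : set R) s)%:C)%C *
     (((b)%:C)%C * expi (c + s * b + pi / 2))).
Proof.
move=> t0.
have H (e : R) : \int[lam]_s (\1_(`[0, tau]%classic : set R) s * (b * cos (e + s * b + pi / 2))) =
    cos (e + tau * b) - cos e.
  rewrite -[RHS]/(fine (cos (e + tau * b) - cos e)%:E) -integral_phase_derivative//.
  rewrite /Rintegral [in RHS]integral_mkcond; congr fine; apply: eq_integral => s _.
  by rewrite patchE indicE; case: ifP => _; rewrite ?mul1r// mul0r.
apply: complex_ext; rewrite /= ?addr0.
  by rewrite -H; apply: eq_Rintegral => s _; rewrite !mul0r !subr0.
rewrite -!cosBpihalf (_ : c + tau * b - pi / 2 = (c - pi / 2) + tau * b)%R; last by ring.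
rewrite -H; apply: eq_Rintegral => s _; rewrite !mul0r !addr0 -cosBpihalf.
by congr (_ * (_ * cos _))%R; ring.
Qed.

Lemma wave_osc (phi : V -> R) tau (g : V -> R[i]) x :
  wave phi tau g x = osc (fun xi => expi (tau * phi xi) * g xi)%R x.
Proof. by apply: eq_cint => xi; rewrite expiD mulrA. Qed.

Lemma wave_plancherel (phi : V -> R) tau (g : V -> R[i]) : measurable_fun setT phi ->
  dominated g ->
  (\int[mu]_x (normc (wave phi tau g x) ^+ 2)%:E <=
  (@fmass R n)%:E * \int[mu]_x (normc (g x) ^+ 2)%:E)%E.
Proof.
move=> mphi dg.
have d : dominated (fun xi => expi (tau * phi xi) * g xi).
  by apply: dominated_expi => //; exact: measurable_funM.
have := plancherel_le d; under eq_integral do rewrite -wave_osc.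
by under [in X in (_ <= X)%E -> _]eq_integral do rewrite Normc.normcM normc_expi mul1r.
Qed.

(* [wave tau g = wave 0 g + i int_0^tau wave s (phi g) ds]. *)
Lemma wave_low_pointwise (phi : V -> R) tau (g : V -> R[i]) x :
  measurable_fun setT phi -> dominated g ->
  dominated (fun xi => ((phi xi)%:C)%C * g xi)%R -> (0 <= tau <= 1)%R ->
  ((normc (wave phi tau g x) ^+ 2)%:E <=
  (2 * normc (osc g x) ^+ 2)%:E + 2%:E * \int[lam]_s
    ((\1_(`[0%R, 1%R]%classic : set R) s *
     normc (wave phi s (fun xi => ((phi xi)%:C)%C * g xi) x) ^+ 2)%R%:E))%E.
Proof.
move=> mphi dg dpg /andP[t0 t1].
set pg := (fun xi => ((phi xi)%:C)%C * g xi).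
pose I01 : measurableTypeR R -> R := \1_(`[0, 1]%classic : set R).
pose It : measurableTypeR R -> R := \1_(`[0, tau]%classic : set R).
have mIt : measurable_fun setT It by exact: measurable_indic.
have mI1 : measurable_fun setT I01 by exact: measurable_indic.
have It0 s : (0 <= It s)%R by rewrite /It indicE.
have I10 s : (0 <= I01 s)%R by rewrite /I01 indicE.
(* After absolute values the time interval [[0, tau]] is enlarged to [[0, 1]], which removes [tau],
   later [t x], from the bound. *)
have ItI s : (It s <= I01 s).
  rewrite /It /I01 !indicE; case: (boolP (s \in _)) => // /set_mem /=.
  rewrite in_itv /= => /andP[s0 st]; rewrite mem_set//= in_itv/= s0.
  exact: le_trans st t1.
have iI1 : lam.-integrable setT (EFin \o I01).
  apply/integrableP; split; first exact/measurable_EFinP.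
  under eq_integral do rewrite /= ger0_norm//.
  by rewrite /I01 integral_indic_cc// ltry.
have mph : measurable_fun setT (fun p : V * measurableTypeR R => dotprod x p.1 + p.2 * phi p.1).
  apply: measurable_funD; first exact: (measurableT_comp (measurable_dotprodr x) measurable_fst).
  apply: measurable_funM; first exact: measurable_snd.
  exact: (measurableT_comp mphi measurable_fst).
have mpg : cmeas pg by case: dpg.
have pgE xi : pg xi = ((phi xi)%:C)%C * g xi by [].
change (dominated pg) in dpg; clearbody pg.
pose h (p : V * measurableTypeR R) : R[i] :=
  (((It p.2)%:C)%C * (expi (dotprod x p.1 + p.2 * phi p.1 + pi / 2) * pg p.1)).
have mh : cmeas h.
  apply: cmeasM; first by apply: cmeas_real; exact: (measurableT_comp mIt measurable_snd).
  apply: cmeasM; last exact: (cmeas_comp measurable_fst mpg).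
  by apply: cmeas_expi; exact: measurable_funD.
have [C pgC] : exists C, forall xi, (normc (pg xi) <= C * weight xi)%R by case: dpg.
have D : wave phi tau g x = (osc g x +
    cint lam (fun s => ((It s)%:C)%C * (expi (pi / 2) * wave phi s pg x))).
  have -> : cint lam (fun s => ((It s)%:C)%C * (expi (pi / 2) * wave phi s pg x))%R =
      cint lam (fun s => cint mu (fun xi => h (xi, s))).
    apply: eq_cint => s; rewrite /wave -cintZ; last first.
      apply: dominated_integrable; apply: dominated_expi => //.
      by apply: measurable_funD; [exact: measurable_dotprodr|exact: measurable_funM].
    rewrite -cintZ; last first.
      apply: dominated_integrable; have := dominated_expi (measurable_cst (pi / 2)%R)
        (dominated_expi (f := fun xi => (dotprod x xi + s * phi xi)%R) _ dpg).
      apply; apply: measurable_funD; first exact: measurable_dotprodr.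
      exact: measurable_funM.
    by apply: eq_cint => xi; rewrite /h /= [expi (_ + pi / 2)]expiD; ring.
  (* The time and frequency integrals are exchanged; the majorant is the indicator of [[0, 1]] times
     the decay of [phi * g]. *)
  rewrite -(@cint_Fubini _ _ _ _ _ mu lam h (fun xi => C * weight xi)%R I01)//; last 2 first.
  - move=> xi s; rewrite /h !Normc.normcM normc_expi mul1r normc_real ger0_norm// mulrC.
    by rewrite ler_pM// ?normc_ge0.
  - exact: integrable_weightZ.
  have E xi : cint lam (fun s => h (xi, s)) =
      ((expi (dotprod x xi + tau * phi xi) - expi (dotprod x xi)) * g xi).
    rewrite expi_increment// [RHS]mulrC -cintZ; last first.
      apply: (cintegrable_le _ _ (integrableZl measurableT `|phi xi|%R iI1)).
        apply: cmeasM; first exact: (cmeas_real mIt).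
        apply: cmeasM; first exact: cmeas_cst.
        apply: cmeas_expi; apply: measurable_funD => //; apply: measurable_funD => //.
        exact: measurable_funM.
      move=> s; rewrite !Normc.normcM normc_expi mulr1 !normc_real ger0_norm ?It0// mulrC.
      by rewrite ler_wpM2l.
    by apply: eq_cint => s; rewrite /h pgE /=; ring.
  under [X in (_ + X)%R]eq_cint do rewrite E.
  have dt : dominated (fun xi => expi (dotprod x xi + tau * phi xi) * g xi).
    apply: dominated_expi => //.
    by apply: measurable_funD; [exact: measurable_dotprodr|exact: measurable_funM].
  have dx : dominated (fun xi => expi (dotprod x xi) * g xi).
    by apply: dominated_expi => //; exact: measurable_dotprodr.
  rewrite /osc -cintD//; last 2 first.
  - exact: dominated_integrable.
  - apply: dominated_integrable.
    have b1 : exists C, forall y : V, normc (cst (-1 : R[i]) y) <= C.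
      by exists (normc (-1 : R[i])).
    have := dominatedD dt (dominatedM (cmeas_cst _) b1 dx).
    by congr dominated; apply/funext => xi; rewrite /= mulN1r mulrBl.
  by apply: eq_cint => xi; rewrite mulrBl addrCA subrr addr0.
have mW : cmeas (fun s : measurableTypeR R => wave phi s pg x).
  apply: (@cmeas_cint _ _ (measurableTypeR R) V R mu
    (fun p => expi (dotprod x p.2 + p.1 * phi p.2) * pg p.2)%R).
  apply: cmeasM; last exact: (cmeas_comp measurable_snd mpg).
  apply: cmeas_expi; apply: measurable_funD.
    exact: (measurableT_comp (measurable_dotprodr x) measurable_snd).
  apply: measurable_funM; first exact: measurable_fst.
  exact: (measurableT_comp mphi measurable_snd).
have [C' C'0 WC] : exists2 C, 0 <= C & forall s, normc (wave phi s pg x) <= C.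
  exists (C * pi ^+ n) => [|s].
    rewrite mulr_ge0 ?exprn_ge0 ?pi_ge0//.
    by have := le_trans (normc_ge0 _) (pgC 0); rewrite pmulr_lge0// weight_gt0.
  have d : dominated (fun xi => expi (dotprod x xi + s * phi xi) * pg xi).
    apply: dominated_expi => //.
    by apply: measurable_funD; [exact: measurable_dotprodr|exact: measurable_funM].
  rewrite -lee_fin; apply: (le_trans (normc_cint_le (dominated_integrable d))).
  have -> : ((C * pi ^+ n)%:E = \int[mu]_xi (C%:E * (weight xi)%:E))%E.
    rewrite ge0_integralZl//; last 3 first.
    - by apply/measurable_EFinP; exact: measurable_weight.
    - by move=> xi _; rewrite lee_fin weight_ge0.
    - rewrite lee_fin; have := le_trans (normc_ge0 _) (pgC 0).
      by rewrite pmulr_lge0// weight_gt0.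
    by rewrite integral_weight EFinM.
  apply: ge0_le_integral => //.
  - by move=> xi _; rewrite lee_fin normc_ge0.
  - by apply/measurable_EFinP; apply: measurable_normc; case: d.
  - by apply/measurable_EFinP; apply: measurable_funM => //; exact: measurable_weight.
  - by move=> xi _; rewrite Normc.normcM normc_expi mul1r lee_fin.
have mWn := measurable_normc mW.
set J := (X in (_ <= _ + _ * X)%E).
set Q := cint lam _ in D.
(* Cauchy-Schwarz in time, over an interval of length 1. *)
have JQ : ((normc Q ^+ 2)%:E <= J)%E.
  have sc := @sqr_integral_le _ (measurableTypeR R) R lam I01 _ mI1 mWn I10 (fun s => normc_ge0 _).
  have e1 : (\int[lam]_s (I01 s)%:E = 1)%E by rewrite /I01 integral_indic_cc// subr0.
  rewrite e1 mul1e in sc; apply: le_trans sc.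
  have i : cintegrable lam (fun s => ((It s)%:C)%C * (expi (pi / 2) * wave phi s pg x)).
    apply: (cintegrable_le _ _ (integrableZl measurableT C' iI1)).
      by apply: cmeasM; [exact: (cmeas_real mIt)|apply: cmeasM => //; exact: cmeas_cst].
    move=> s; rewrite !Normc.normcM normc_expi mul1r normc_real ger0_norm// mulrC.
    by rewrite ler_pM// ?normc_ge0.
  have q : ((normc Q)%:E <= \int[lam]_s (I01 s * normc (wave phi s pg x))%:E)%E.
    apply: (le_trans (normc_cint_le i)); apply: ge0_le_integral => //.
    - by move=> s _; rewrite lee_fin normc_ge0.
    - by apply/measurable_EFinP; apply: measurable_normc; case: i.
    - by apply/measurable_EFinP; apply: measurable_funM.
    - move=> s _; rewrite !Normc.normcM normc_expi mul1r normc_real ger0_norm// lee_fin.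
      by rewrite ler_wpM2r// normc_ge0.
  by rewrite expr2 EFinM; apply: lee_pmul => //; rewrite lee_fin normc_ge0.
apply: (@le_trans _ _ ((2 * normc (osc g x) ^+ 2)%:E + (2 * normc Q ^+ 2)%:E)%E); last first.
  by rewrite leeD2l// EFinM lee_wpmul2l.
rewrite -EFinD lee_fin D.
have h1 := le_normcD (osc g x) Q.
have h0 := normc_ge0 (osc g x + Q).
apply: (@le_trans _ _ ((normc (osc g x) + normc Q) ^+ 2)).
  by rewrite lerXn2r ?nnegrE// addr_ge0 ?normc_ge0.
have := sqr_ge0 (normc (osc g x) - normc Q); lra.
Qed.

(** The pointwise majorant no longer contains [t]: it is Borel in the pair (point, time), Tonelli
    exchanges the two, and Plancherel applies at each frozen time. The factor 2 is that of
    [(p + q)^2 <= 2 p^2 + 2 q^2]. *)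
Lemma wave_low (phi t : V -> R) (g : V -> R[i]) :
  measurable_fun setT phi -> lebesgue_measurable t -> (forall x, 0 <= t x <= 1) ->
  dominated g -> dominated (fun xi => ((phi xi)%:C)%C * g xi) ->
  (\int[nu]_x (normc (wave phi (t x) g x) ^+ 2)%:E <=
   (2 * @fmass R n)%:E * (\int[mu]_x (normc (g x) ^+ 2)%:E +
     \int[mu]_x (normc (((phi x)%:C)%C * g x) ^+ 2)%:E))%E.
Proof.
move=> mphi mt t01 dg dpg.
set pg := (fun xi => ((phi xi)%:C)%C * g xi) in dpg *.
have [mg _] := dg; have [mpg _] := dpg.
pose I01 : measurableTypeR R -> R := \1_(`[0, 1]%classic : set R).
have mI1 : measurable_fun setT I01 by exact: measurable_indic.
have I10 s : 0 <= I01 s by rewrite /I01 indicE.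
pose k (p : V * measurableTypeR R) := I01 p.2 * normc (wave phi p.2 pg p.1) ^+ 2.
have mk : measurable_fun setT k.
  apply: measurable_funM; first exact: (measurableT_comp mI1 measurable_snd).
  apply: measurable_funX; apply: measurable_normc.
  apply: (@cmeas_cint _ _ (V * measurableTypeR R)%type V R mu
    (fun p => expi (dotprod p.1.1 p.2 + p.1.2 * phi p.2) * pg p.2)).
  apply: cmeasM; last exact: (cmeas_comp measurable_snd mpg).
  apply: cmeas_expi; apply: measurable_funD.
    have h : measurable_fun setT (fun p : (V * measurableTypeR R) * V => (p.1.1, p.2)).
      apply: measurable_fun_pair; last exact: measurable_snd.
      exact: (measurableT_comp measurable_fst measurable_fst).
    exact: (measurableT_comp (@measurable_dotprod R n) h).
  apply: measurable_funM; last exact: (measurableT_comp mphi measurable_snd).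
  exact: (measurableT_comp measurable_snd measurable_fst).
have mkE : measurable_fun setT (EFin \o k) by exact/measurable_EFinP.
have k0 p : (0 <= (EFin \o k) p)%E by rewrite lee_fin mulr_ge0// sqr_ge0.
pose A x := (2 * normc (osc g x) ^+ 2)%:E.
pose B x := (\int[lam]_s (k (x, s))%:E)%E.
have B0 x : (0 <= B x)%E by apply: integral_ge0 => s _; exact: (k0 (x, s)).
have mB : measurable_fun setT B by exact: (measurable_fun_fubini_tonelli_F (m2 := lam) _ mkE k0).
have mA : measurable_fun setT A.
  apply/measurable_EFinP; apply: measurable_funM => //; apply: measurable_funX.
  by apply: measurable_normc; exact: cmeas_osc.
have A0 x : (0 <= A x)%E by rewrite lee_fin mulr_ge0// sqr_ge0.
have mAB : measurable_fun setT (fun x => A x + 2%:E * B x)%E.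
  by apply: emeasurable_funD => //; apply: emeasurable_funM => //; exact: measurable_cst.
have AB0 x : (0 <= A x + 2%:E * B x)%E by rewrite adde_ge0// mule_ge0.
apply: (@le_trans _ _ (\int[nu]_x (A x + 2%:E * B x)%E)%E).
  apply: (@ge0_le_integral _ _ _ nu _ measurableT).
  - by move=> x _; rewrite lee_fin sqr_ge0.
  - apply/measurable_EFinP; apply: measurable_funX; apply: measurable_normc.
    exact: cmeas_wave.
  - exact: lebesgue_measurable_borel.
  - by move=> x _; exact: wave_low_pointwise.
rewrite ge0_integral_lebesgue_rV// ge0_integralD//; last 2 first.
- by move=> x _; rewrite mule_ge0.
- by apply: emeasurable_funM => //; exact: measurable_cst.
set X := (\int[mu]_x (normc (g x) ^+ 2)%:E)%E.
set Y := (X in (_ <= _ * (_ + X))%E).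
have F0 : (0 <= (@fmass R n)%:E)%E by rewrite lee_fin ltW// fmass_gt0.
have X0 : (0 <= X)%E by apply: integral_ge0 => x _; rewrite lee_fin sqr_ge0.
have Y0 : (0 <= Y)%E by apply: integral_ge0 => x _; rewrite lee_fin sqr_ge0.
have -> : ((2 * @fmass R n)%:E * (X + Y) = 2%:E * ((@fmass R n)%:E * X) + 2%:E * ((@fmass R n)%:E * Y))%E.
  by rewrite EFinM -muleA ge0_muleDr// ge0_muleDr// mule_ge0.
rewrite ge0_integralZl//.
apply: leeD.
  rewrite /A ge0_integralZ_real//; last 2 first.
  - by apply: measurable_funX; apply: measurable_normc; exact: cmeas_osc.
  - by move=> x; rewrite sqr_ge0.
  by rewrite lee_wpmul2l// plancherel_le.
rewrite lee_wpmul2l// /B.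
rewrite (fubini_tonelli (m1 := mu) (m2 := lam) (EFin \o k))//.
apply: (@le_trans _ _ (\int[lam]_s ((I01 s)%:E * ((@fmass R n)%:E * \int[mu]_x (normc (pg x) ^+ 2)%:E)))%E).
  apply: ge0_le_integral => //.
  - by move=> s _; apply: integral_ge0 => x _; exact: (k0 (x, s)).
  - exact: (measurable_fun_fubini_tonelli_G (m1 := mu) _ mkE k0).
  - by apply: emeasurable_funM; [exact/measurable_EFinP|exact: measurable_cst].
  move=> s _; rewrite [X in (X <= _)%E](_ : _ =
      \int[mu]_x (I01 s * normc (wave phi s pg x) ^+ 2)%:E)%E//.
  rewrite ge0_integralZ_real; [|exact: I10| |by move=> x; exact: sqr_ge0]; last first.
    apply: measurable_funX; apply: measurable_normc.
    have -> : wave phi s pg = osc (fun xi => expi (s * phi xi) * pg xi).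
      by apply/funext => x; exact: wave_osc.
    apply: cmeas_osc; apply: cmeasM => //.
    by apply: cmeas_expi; exact: measurable_funM.
  by rewrite lee_wpmul2l ?lee_fin//; exact: wave_plancherel.
rewrite ge0_integralZr//; last 3 first.
- exact/measurable_EFinP.
- by move=> s _; rewrite lee_fin.
- by rewrite mule_ge0 ?lee_fin ?(ltW (@fmass_gt0 R n))//; apply: integral_ge0 => x _; rewrite lee_fin sqr_ge0.
by rewrite /I01 integral_indic_cc// subr0 mul1e.
Qed.

End low_frequency.

(** * From local to global estimates *)

Section cubes.
Context {R : realType} {n : nat}.
Notation V := 'rV[R]_n.
Notation mu := (borel_lebesgue R n).

(* The average over translates is taken on each cube of side [1/n] separately:
   [t] is only Lebesgue measurable, so Tonelli is not available for the pair
   (point, translate). *)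
Definition lattice_point (x : V) : {ffun 'I_n -> int} :=
  [ffun i => Num.floor (x ord0 i * n%:R)].

(** The numbering by [pickle] gives a partition indexed by natural numbers, as countable sums
    require; indices that encode no lattice point give the empty set, whence the alternative in
    [cubeP]. *)
Definition cube (k : nat) : set V := [set x | pickle (lattice_point x) = k].

Lemma trivIset_cube : trivIset setT cube.
Proof. by move=> i j _ _ [x [/= <- <-]]. Qed.

Lemma bigcup_cube : \bigcup_k cube k = setT.
Proof. by apply/seteqP; split => // x _; exists (pickle (lattice_point x)). Qed.

Lemma cubeE (n0 : (0 < n)%N) (x : V) : cube (pickle (lattice_point x)) =
  [set y | forall i, [set` `[(lattice_point x i)%:~R / n%:R, (lattice_point x i + 1)%:~R / n%:R[%R] (y ord0 i)].
Proof.
have N0 : (0 : R) < n%:R by rewrite ltr0n.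
apply/seteqP; split => y /=.
  move=> /(pcan_inj pickleK) E i; rewrite in_itv /= -E ffunE.
  rewrite ler_pdivrMr// ltr_pdivlMr// floor_le_tmp lt_succ_floor//.
move=> H; congr pickle; apply/ffunP => i.
have := H i; rewrite in_itv /= ler_pdivrMr// ltr_pdivlMr// => /andP[a b].
by rewrite [LHS]ffunE; apply: Num.Theory.floor_def; rewrite a.
Qed.

Lemma cubeP (n0 : (0 < n)%N) k :
  cube k = set0 \/ (measurable (cube k) /\ mu (cube k) = ((n%:R ^- n)%:E)).
Proof.
have N0 : (0 : R) < n%:R by rewrite ltr0n.
have [[x xk]|nx] := pselect (exists x, cube k x); last first.
  by left; apply/seteqP; split => // x xk; apply: nx; exists x.
right; rewrite -xk cubeE//; pose A i : set R := [set` `[(lattice_point x i)%:~R / n%:R, (lattice_point x i + 1)%:~R / n%:R[%R].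
have mA i : measurable (A i : set (measurableTypeR R)) by exact: measurable_itv.
split.
  rewrite [X in measurable X](_ : _ = \bigcap_(i in [set: 'I_n])
     ((fun y : V => y ord0 i) @^-1` A i)); last first.
    apply/seteqP; split => y /= H i; first by move=> _; exact: H.
    exact: (H i I).
  apply: fin_bigcap_measurable => // i _.
  by rewrite -[X in measurable X]setTI; exact: measurable_coord_rV.
rewrite (borel_lebesgue_box (A := A))//.
rewrite (eq_bigr (fun=> (n%:R^-1)%:E)) => [|i _].
  by rewrite prodEFin prodr_const card_ord exprVn.
rewrite /A lebesgue_measure_itv /= lte_fin ltr_pM2r ?invr_gt0// intrD ltrDl ltr01.
by rewrite -EFinB mulrDl addrAC subrr add0r mul1r.
Qed.

(** The reason for the side [1 / n]: the sum of [n] squares below [n^-2] is less than [1 / n <= 1],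
    so each cube lies in the unit ball about any of its points. *)
Lemma enorm_cube (n0 : (0 < n)%N) k (x y : V) : cube k x -> cube k y -> unit_ball (x - y).
Proof.
move=> <- yx; have N0 : (0 : R) < n%:R by rewrite ltr0n.
have xx : cube (pickle (lattice_point x)) x by [].
rewrite cubeE//= in yx xx.
have H i : (x - y) ord0 i ^+ 2 < n%:R ^- 2.
  have := yx i; have := xx i; rewrite !in_itv /= !mxE => /andP[a b] /andP[c d].
  rewrite -real_normK ?num_real// -exprVn ltrXn2r// ?nnegrE ?invr_ge0 ?ltW//.
  have E : (lattice_point x i + 1)%:~R / n%:R = (lattice_point x i)%:~R / n%:R + n%:R^-1 :> R.
    by rewrite intrD mulrDl mul1r.
  by rewrite ltr_norml; move: a b c d; rewrite E; lra.
have S : \sum_i (x - y) ord0 i ^+ 2 < 1.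
  apply: (@lt_le_trans _ _ (\sum_(i < n) (n%:R ^- 2 : R))).
    rewrite (bigD1 (Ordinal n0))//= [ltRHS](bigD1 (Ordinal n0))//=.
    by apply: ltr_leD => //; apply: ler_sum => i _; exact: ltW.
  rewrite sumr_const card_ord -[leLHS]mulr_natl expr2 invfM mulrA mulfV ?gt_eqF// mul1r.
  by rewrite invf_le1// ler1n.
by rewrite /unit_ball /mkset /enorm -(@sqrtr1 R) ltr_sqrt.
Qed.

End cubes.

(** * Windows, convolution kernels and averaging over cubes *)

Section local_to_global.
Context {R : realType} {n : nat}.
Notation V := 'rV[R]_n.
Notation mu := (borel_lebesgue R n).
Notation nu := (lebesgue_rV R n).

Definition cutoff (P : V -> R) (w : V -> R[i]) (xi : V) : R[i] :=
  ((P xi)%:C)%C * osc w (- xi).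

Definition wave_kernel (phi : V -> R) (tau : R) (P : V -> R) : V -> R[i] :=
  wave phi tau (fun xi => ((P xi)%:C)%C).

Lemma rapid_compact (b : V -> R) (C r : R) : measurable_fun setT b ->
  (forall x, `|b x| <= C) -> (forall x : V, r < `|x| -> b x = 0) -> rapid b.
Proof.
move=> mb bC br; split => // s.
have [C' sC] : exists C', forall x, `|moment s b x| <= C'.
  elim: s => [|i s [C' IH]] /=; first by exists C.
  exists (`|r| * C') => x; have [xr|xr] := leP `|x| r; last first.
    rewrite momentE br// !mulr0 normr0 mulr_ge0//.
    exact: le_trans (normr_ge0 _) (IH 0).
  rewrite normrM ler_pM// (le_trans (normr_coord x i))// (le_trans xr)//.
  exact: ler_norm.
have ms : measurable_fun setT (moment s b).
  by elim: s {sC} => //= i s IH; apply: measurable_funM => //; exact: measurable_coord.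
have sr x : r < `|x| -> moment s b x = 0 by move=> xr; rewrite momentE br// mulr0.
have [_ [D H]] := dominated_real ms sC sr.
by exists D => x; rewrite -momentE -normc_real.
Qed.

Lemma test_dominated (P : V -> R) : test P -> dominated (fun xi => ((P xi)%:C)%C).
Proof.
move=> tP; split; first by apply: cmeas_real; apply: smooth_on_measurable; case: tP.
by have [C H] := test_bound tP; exists C => x; rewrite normc_real.
Qed.

(** Smoothness of the transform uses only the decay of [w], and the compact support comes from [P].
    Hence [w] may be discontinuous, and a sharp spatial window still yields an admissible
    amplitude. *)
Lemma ctest_cutoff (P : V -> R) (w : V -> R[i]) : test P -> crapid w -> ctest (cutoff P w).
Proof.
move=> tP rw; have [sr si] := smooth_osc_opp rw; split.
  have := testM tP sr; congr test; apply/funext => x.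
  by rewrite /cutoff fctE [RHS]ReZ.
have := testM tP si; congr test; apply/funext => x.
by rewrite /cutoff fctE [RHS]ImZ.
Qed.

Lemma measurable_phase (phi : V -> R) (tau : R) (x : V) : measurable_fun setT phi ->
  measurable_fun setT (fun xi => dotprod x xi + tau * phi xi).
Proof.
by move=> mphi; apply: measurable_funD; [exact: measurable_dotprodr|exact: measurable_funM].
Qed.

(** Fubini turns the Fourier multiplier into a convolution, so that locality in space can be read
    off the size of the kernel. *)
Lemma wave_cutoff (phi P : V -> R) tau (h : V -> R[i]) x : measurable_fun setT phi ->
  test P -> dominated h ->
  wave phi tau (cutoff P h) x = cint mu (fun z => h z * wave_kernel phi tau P (x - z)).
Proof.
move=> mphi tP dh; have dP := test_dominated tP.
have [mP [CP HP]] := dP; have [mh [Ch Hh]] := dh.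
pose F (p : V * V) : R[i] := (expi (dotprod x p.1 + tau * phi p.1) * ((P p.1)%:C)%C) *
  (expi (- dotprod p.1 p.2) * h p.2).
have mF : cmeas F.
  apply: cmeasM.
    apply: (cmeas_comp measurable_fst (g := fun xi => expi (dotprod x xi + tau * phi xi) * ((P xi)%:C)%C)).
    by apply: cmeasM => //; apply: cmeas_expi; exact: measurable_phase.
  apply: cmeasM; last exact: (cmeas_comp measurable_snd mh).
  by apply: cmeas_expi; apply: measurableT_comp => //; exact: measurable_dotprod.
transitivity (cint mu (fun xi => cint mu (fun z => F (xi, z)))).
  apply: eq_cint => xi; rewrite /cutoff /osc /F /= mulrA -cintZ.
    by apply: eq_cint => z; rewrite dotprodNl.
  by apply: dominated_integrable; apply: dominated_expi => //; exact: measurable_dotprodr.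
rewrite (cint_Fubini (a := fun xi => CP * weight xi) (b := fun z => Ch * weight z))//; last 3 first.
- move=> xi z; rewrite /F /= 3!Normc.normcM !normc_expi !mul1r.
  by apply: ler_pM; rewrite ?normc_ge0.
- exact: integrable_weightZ.
- exact: integrable_weightZ.
apply: eq_cint => z; rewrite /wave_kernel /wave -cintZ; last first.
  by apply: dominated_integrable; apply: dominated_expi => //; exact: measurable_phase.
apply: eq_cint => xi; rewrite /F /= dotprodDl dotprodNl [dotprod xi z]dotprodC.
by rewrite (addrAC _ (- dotprod z xi)) [in RHS]expiD; ring.
Qed.

Lemma cmeas_wave_kernel (phi P : V -> R) tau : measurable_fun setT phi -> test P ->
  cmeas (wave_kernel phi tau P).
Proof.
move=> mphi tP; have [mP _] := test_dominated tP.
have -> : wave_kernel phi tau P = osc (fun xi => expi (tau * phi xi) * ((P xi)%:C)%C).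
  by apply/funext => x; exact: wave_osc.
by apply: cmeas_osc; apply: cmeasM => //; apply: cmeas_expi; exact: measurable_funM.
Qed.

Lemma wave_kernel_bounded (phi P : V -> R) tau : measurable_fun setT phi -> test P ->
  exists C, forall x, normc (wave_kernel phi tau P x) <= C.
Proof.
move=> mphi tP; have dP := test_dominated tP.
have -> : wave_kernel phi tau P = osc (fun xi => expi (tau * phi xi) * ((P xi)%:C)%C).
  by apply/funext => x; exact: wave_osc.
by apply: osc_bounded; apply: dominated_expi => //; exact: measurable_funM.
Qed.

Lemma cmeas_subr (g : V -> R[i]) (x : V) : cmeas g -> cmeas (fun z : V => g (x - z)).
Proof.
move=> mg; have := cmeas_comp (measurable_affine_rV (-1) x) mg.
by congr cmeas; apply/funext => z; rewrite /= /affine_rV scaleN1r addrC.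
Qed.

Lemma addrKK (x y z : V) : x + y - (z + y) = x - z.
Proof. by rewrite opprD addrACA subrr addr0. Qed.

Lemma wave_cutoff_shift (phi P : V -> R) tau (h : V -> R[i]) (x y : V) : measurable_fun setT phi ->
  test P -> dominated h ->
  wave phi tau (cutoff P h) (x + y) = cint mu (fun z => h (z + y) * wave_kernel phi tau P (x - z)).
Proof.
move=> mphi tP dh; rewrite wave_cutoff; [|exact: mphi|exact: tP|exact: dh].
have i : cintegrable mu (fun z => h z * wave_kernel phi tau P (x + y - z)).
  have [C KC] := wave_kernel_bounded tau mphi tP.
  have := dominatedM (cmeas_subr (x + y) (cmeas_wave_kernel tau mphi tP)) (ex_intro _ C (fun z => KC _)) dh.
  by move=> /dominated_integrable; congr cintegrable; apply/funext => z; rewrite mulrC.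
have := cint_affine y (oner_neq0 R) i; rewrite normr1 expr1n invr1 mul1r => <-.
by apply: eq_cint => z; rewrite scale1r addrKK.
Qed.

Lemma indic_ball_max (z : V) : \1_[set z : V | `|z| <= 2] z = ((`|z| <= 2)%R)%:R :> R.
Proof.
rewrite indicE; case: (boolP (`|z| <= 2)) => z2; first by rewrite mem_set.
by rewrite memNset//; exact/negP.
Qed.

(** The data near [y], truncated sharply in the max norm and translated to the origin, where the
    local hypothesis is stated. *)
Definition window (h : V -> R[i]) (y z : V) : R[i] :=
  ((\1_[set z : V | `|z| <= 2] z)%:C)%C * h (z + y).

Lemma cmeas_shift (h : V -> R[i]) (y : V) : cmeas h -> cmeas (fun z : V => h (z + y)).
Proof.
move=> mh; have := cmeas_comp (measurable_affine_rV 1 y) mh.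
by congr cmeas; apply/funext => z; rewrite /= /affine_rV scale1r.
Qed.

Lemma measurable_ball_max : measurable [set z : V | `|z| <= 2].
Proof.
rewrite (_ : [set z | _] = ~` [set z : V | 2 < `|z|]).
  apply: measurableC; apply: measurable_rV_open.
  have := @open_comp _ _ (fun x : V => `|x|) [set y : R | 2 < y].
  by apply; [move=> x _; exact: norm_continuous|exact: open_gt].
by apply/seteqP; split => z /=; rewrite leNgt => /negP.
Qed.

Lemma cmeas_window (h : V -> R[i]) (y : V) : cmeas h -> cmeas (window h y).
Proof.
move=> mh; apply: cmeasM; last exact: cmeas_shift.
by apply: cmeas_real; exact: measurable_indic measurable_ball_max.
Qed.

Lemma normc_window (h : V -> R[i]) y z :
  normc (window h y z) = \1_[set z : V | `|z| <= 2] z * normc (h (z + y)).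
Proof. by rewrite /window Normc.normcM normc_real ger0_norm// indicE. Qed.

Lemma crapid_window (h : V -> R[i]) (y : V) : dominated h -> crapid (window h y).
Proof.
move=> [mh [C hC]]; have [mr mi] := cmeas_window y mh.
have C0 : 0 <= C.
  by have := le_trans (normc_ge0 _) (hC 0); rewrite pmulr_lge0// weight_gt0.
have wC z : normc (window h y z) <= C.
  rewrite normc_window (@le_trans _ _ (normc (h (z + y))))//.
    by rewrite ler_piMl ?normc_ge0// indicE; case: (_ \in _).
  by rewrite (le_trans (hC _))// ler_piMr// weight_le1.
have w0 z : 2 < `|z| -> window h y z = 0.
  by move=> z2; rewrite /window indic_ball_max leNgt z2; exact: mul0r.
split.
- apply: (rapid_compact mr (C := C) (r := 2)) => z; last by move=> /w0 /= ->.
  exact: le_trans (normc_Re _) (wC z).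
- apply: (rapid_compact mi (C := C) (r := 2)) => z; last by move=> /w0 /= ->.
  exact: le_trans (normc_Im _) (wC z).
Qed.

(* Outside a window of radius 2 around the centre [y], the kernel is only used
   at points of max norm at least 1. *)
Lemma wave_cutoff_split (phi P : V -> R) (tau B : R) (h : V -> R[i]) (x y : V) :
  measurable_fun setT phi -> test P -> dominated h -> 0 <= B ->
  (forall x : V, 1 <= `|x| -> normc (wave_kernel phi tau P x) <= B * weight x) ->
  `|x| <= 1 ->
  ((normc (wave phi tau (cutoff P h) (x + y)) ^+ 2)%:E <=
   (2 * normc (wave phi tau (cutoff P (window h y)) x) ^+ 2)%:E +
   2%:E * ((\int[mu]_z (B * weight (x + y - z) * normc (h z))%:E) *
           (\int[mu]_z (B * weight (x + y - z) * normc (h z))%:E)))%E.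
Proof.
move=> mphi tP dh B0 KB x1; have [mh [C hC]] := dh.
have dw := crapid_dominated (crapid_window y dh).
pose K z := wave_kernel phi tau P (x - z).
have [CK KC] := wave_kernel_bounded tau mphi tP.
have mK : cmeas K by apply: cmeas_subr; exact: cmeas_wave_kernel.
pose r z := (1 - ((\1_[set z : V | `|z| <= 2] z)%:C)%C) * h (z + y).
have rE z : r z = ((1 - \1_[set z : V | `|z| <= 2] z)%:C)%C * h (z + y).
  by rewrite /r rmorphB.
have mr : cmeas r.
  have -> : r = (fun z => ((1 - \1_[set z : V | `|z| <= 2] z)%:C)%C * h (z + y)) by apply/funext.
  apply: cmeasM; last exact: cmeas_shift.
  by apply: cmeas_real; apply: measurable_funB => //; exact: measurable_indic measurable_ball_max.
have C0 : 0 <= C.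
  by have := le_trans (normc_ge0 _) (hC 0); rewrite pmulr_lge0// weight_gt0.
have mrK : cmeas (fun z => r z * K z) by exact: cmeasM.
have rKB z : normc (r z * K z) <= B * weight (x - z) * normc (h (z + y)).
  rewrite rE !Normc.normcM normc_real indic_ball_max; have [z2|z2] := leP `|z| 2.
    by rewrite subrr normr0 !mul0r mulr_ge0 ?normc_ge0// mulr_ge0// weight_ge0.
  rewrite subr0 normr1 mul1r mulrC ler_wpM2r ?normc_ge0//; apply: KB.
  have := ler_normD (z - x) x; rewrite subrK distrC; move: x1 z2; lra.
have irK : cintegrable mu (fun z => r z * K z).
  split => //; apply: (@le_lt_trans _ _ (\int[mu]_z ((B * C) * weight (z + y))%:E)%E).
    apply: ge0_le_integral => //.
    - by move=> z _; rewrite lee_fin normc_ge0.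
    - by apply/measurable_EFinP; exact: measurable_normc.
    - apply/measurable_EFinP; apply: measurable_funM => //.
      have := measurableT_comp (@measurable_weight R n) (measurable_affine_rV 1 y).
      by congr measurable_fun; apply/funext => z; rewrite /= /affine_rV scale1r.
    - move=> z _; rewrite lee_fin; apply: (le_trans (rKB z)); rewrite -!mulrA; apply: ler_wpM2l => //.
      rewrite mulrC; apply: (@le_trans _ _ (normc (h (z + y)))); last exact: hC.
      by rewrite ler_piMr ?normc_ge0// weight_le1.
  have := ge0_integral_affine y (f := fun z => ((B * C) * weight z)%:E) (oner_neq0 R).
  rewrite normr1 expr1n invr1 mul1e => H.
  under eq_integral do rewrite -[z in weight (z + _)]scale1r.
  rewrite H.
  - by have /integrableP[_] := @integrable_weightZ R n (B * C); under eq_integral do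
      rewrite /= ger0_norm ?mulr_ge0 ?weight_ge0//.
  - by apply/measurable_EFinP; apply: measurable_funM => //; exact: measurable_weight.
  - by move=> z; rewrite lee_fin mulr_ge0 ?weight_ge0// mulr_ge0.
have iwK : cintegrable mu (fun z => window h y z * K z).
  have := dominatedM mK (ex_intro _ CK (fun z => KC _)) dw.
  by move=> /dominated_integrable; congr cintegrable; apply/funext => z; rewrite mulrC.
have D : wave phi tau (cutoff P h) (x + y) =
    wave phi tau (cutoff P (window h y)) x + cint mu (fun z => r z * K z).
  rewrite wave_cutoff_shift; [|exact: mphi|exact: tP|exact: dh].
  rewrite (wave_cutoff tau x mphi tP dw) -cintD; [|exact: iwK|exact: irK].
  by apply: eq_cint => z; rewrite -mulrDl /window /r -mulrDl [_ + (1 - _)]addrC subrK mul1r.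
rewrite D; set a := wave _ _ _ _; set e := cint _ _.
set E := (\int[mu]_z _)%E.
have eE : ((normc e)%:E <= E)%E.
  apply: (le_trans (normc_cint_le irK)).
  have := ge0_integral_affine y (f := fun z => (B * weight (x + y - z) * normc (h z))%:E) (oner_neq0 R).
  rewrite normr1 expr1n invr1 mul1e /E => <-; last 2 first.
  - apply/measurable_EFinP; apply: measurable_funM; last exact: measurable_normc.
    apply: measurable_funM => //.
    have := measurableT_comp (@measurable_weight R n) (measurable_affine_rV (-1) (x + y)).
    by congr measurable_fun; apply/funext => z; rewrite /= /affine_rV scaleN1r addrC.
  - by move=> z; rewrite lee_fin mulr_ge0 ?normc_ge0// mulr_ge0// weight_ge0.
  apply: ge0_le_integral => //.
  - by move=> z _; rewrite lee_fin normc_ge0.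
  - by apply/measurable_EFinP; exact: measurable_normc.
  - apply/measurable_EFinP; apply: measurable_funM; last first.
      apply: measurable_normc; have := cmeas_shift y mh; congr cmeas.
      by apply/funext => z; rewrite scale1r.
    apply: measurable_funM => //.
    have := measurableT_comp (@measurable_weight R n) (measurable_affine_rV (-1) x).
    congr measurable_fun; apply/funext => z; rewrite /= /affine_rV scaleN1r scale1r.
    by rewrite addrKK addrC.
  - move=> z _; by rewrite lee_fin scale1r addrKK.
apply: (@le_trans _ _ ((2 * normc a ^+ 2)%:E + 2%:E * ((normc e)%:E * (normc e)%:E))%E); last first.
  by rewrite leeD2l// lee_wpmul2l// lee_pmul// lee_fin normc_ge0.
rewrite -!EFinM -EFinD lee_fin.
have h1 := le_normcD a e; have h0 := normc_ge0 (a + e).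
apply: (@le_trans _ _ ((normc a + normc e) ^+ 2)).
  by rewrite lerXn2r ?nnegrE// addr_ge0 ?normc_ge0.
have := sqr_ge0 (normc a - normc e); lra.
Qed.

(** Each point of [h] is counted with the volume of the window. The indicator of [|z| <= 2] is
    bounded by [5^n * weight z], since [1 + z_i^2 <= 5] there, which gives [(5 pi)^n] without
    computing that volume. *)
Lemma integral_window_le (h : V -> R[i]) : dominated h ->
  (\int[mu]_y \int[mu]_z (normc (window h y z) ^+ 2)%:E <=
   ((5 * pi) ^+ n)%:E * \int[mu]_z (normc (h z) ^+ 2)%:E)%E.
Proof.
move=> [mh _].
have mhn : measurable_fun setT (fun z => (normc (h z) ^+ 2)%:E).
  by apply/measurable_EFinP; apply: measurable_funX; exact: measurable_normc.
have hn0 z : (0 <= (normc (h z) ^+ 2)%:E)%E by rewrite lee_fin sqr_ge0.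
pose f (p : V * V) := (5 ^+ n * weight p.2 * normc (h (p.2 + p.1)) ^+ 2)%:E.
have mf : measurable_fun setT f.
  apply/measurable_EFinP; apply: measurable_funM.
    by apply: measurable_funM => //; exact: (measurableT_comp (@measurable_weight R n) measurable_snd).
  apply: measurable_funX; apply: measurable_normc.
  have ma : measurable_fun setT (fun p : V * V => p.2 + p.1).
    apply: measurable_fun_rV => i; under eq_fun do rewrite mxE.
    by apply: measurable_funD; apply: (measurableT_comp (measurable_coord_rV i)).
  exact: (cmeas_comp ma mh).
have f0 p : (0 <= f p)%E.
  by rewrite lee_fin mulr_ge0 ?sqr_ge0// mulr_ge0 ?exprn_ge0// weight_ge0.
apply: (@le_trans _ _ (\int[mu]_y \int[mu]_z f (y, z))%E).
  apply: ge0_le_integral => //.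
  - by move=> y _; apply: integral_ge0 => z _; rewrite lee_fin sqr_ge0.
  - apply: (measurable_fun_fubini_tonelli_F (m2 := mu)
      (fun p : V * V => (normc (window h p.1 p.2) ^+ 2)%:E)).
      apply/measurable_EFinP; apply: measurable_funX; apply: measurable_normc.
      apply: cmeasM; last first.
        have ma : measurable_fun setT (fun p : V * V => p.2 + p.1).
          apply: measurable_fun_rV => i; under eq_fun do rewrite mxE.
          by apply: measurable_funD; apply: (measurableT_comp (measurable_coord_rV i)).
        exact: (cmeas_comp ma mh).
      apply: cmeas_real.
      have mI : measurable_fun setT (\1_[set z : V | `|z| <= 2] : V -> R).
        exact: measurable_indic measurable_ball_max.
      exact: (measurableT_comp mI measurable_snd).
    by move=> p; rewrite lee_fin sqr_ge0.
  - exact: (measurable_fun_fubini_tonelli_F (m2 := mu) _ mf f0).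
  move=> y _; apply: ge0_le_integral => //.
  - by move=> z _; rewrite lee_fin sqr_ge0.
  - by apply/measurable_EFinP; apply: measurable_funX; apply: measurable_normc; exact: cmeas_window.
  - by apply: (measurableT_comp mf); exact: pair1_measurable.
  move=> z _; rewrite lee_fin normc_window indic_ball_max exprMn ler_wpM2r ?sqr_ge0//.
  have [z2|z2] /= := leP `|z| 2; last first.
    by rewrite expr0n/= mulr_ge0 ?exprn_ge0// weight_ge0.
  rewrite expr1n /weight -[5 ^+ n](_ : \prod_(i < n) 5 = _); last by rewrite prodr_const card_ord.
  rewrite -big_split /= -[leLHS](_ : \prod_(i < n) 1 = _); last by rewrite big1.
  apply: ler_prod => i _; rewrite ler01 /weight1 ler_pdivlMr ?mul1r; last first.
    by rewrite ltr_pwDl// sqr_ge0.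
  have := le_trans (normr_coord z i) z2; rewrite -(@ler_pXn2r _ 2)// ?nnegrE//.
  by rewrite real_normK ?num_real//; lra.
rewrite (fubini_tonelli (m1 := mu) (m2 := mu) f)//.
have E z : (\int[mu]_y f (y, z) = (5 ^+ n * weight z)%:E * \int[mu]_z (normc (h z) ^+ 2)%:E)%E.
  rewrite /f /=; have := ge0_integral_affine z (oner_neq0 R) mhn hn0.
  rewrite normr1 expr1n invr1 mul1e => <-.
  rewrite -ge0_integralZ_real.
  - by apply: eq_integral => y _; rewrite scale1r addrC.
  - by rewrite mulr_ge0 ?exprn_ge0// weight_ge0.
  - apply: measurable_funX; apply: measurable_normc.
    by have := cmeas_shift z mh; congr cmeas; apply/funext => y; rewrite scale1r.
  - by move=> y; exact: sqr_ge0.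
under eq_integral do rewrite E.
rewrite ge0_integralZr//; last 3 first.
- by apply/measurable_EFinP; apply: measurable_funM => //; exact: measurable_weight.
- by move=> z _; rewrite lee_fin mulr_ge0 ?exprn_ge0// weight_ge0.
- by apply: integral_ge0 => z _; exact: hn0.
rewrite ge0_integralZ_real//.
- by rewrite integral_weight -EFinM exprMn.
- exact: measurable_weight.
- exact: weight_ge0.
Qed.

Lemma integral_cutoff_le (P : V -> R) (s1 K : R) (w : V -> R[i]) : dominated w ->
  measurable_fun setT P -> 0 <= K ->
  (forall xi, bracket xi `^ s1 * `|P xi| <= K) ->
  (\int[mu]_xi ((bracket xi `^ s1 * normc (cutoff P w xi)) ^+ 2)%:E <=
   (K ^+ 2 * @fmass R n)%:E * \int[mu]_z (normc (w z) ^+ 2)%:E)%E.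
Proof.
move=> dw mP K0 HK; have [mw _] := dw; have mo := cmeas_osc mw.
have mon : measurable_fun setT (fun xi => (normc (osc w xi) ^+ 2)%:E).
  by apply/measurable_EFinP; apply: measurable_funX; exact: measurable_normc.
have F0 : 0 <= @fmass R n by rewrite ltW// fmass_gt0.
apply: (@le_trans _ _ (\int[mu]_xi ((K ^+ 2)%:E * (normc (osc w (- xi)) ^+ 2)%:E))%E).
  apply: ge0_le_integral => //.
  - by move=> xi _; rewrite lee_fin sqr_ge0.
  - apply/measurable_EFinP; apply: measurable_funX; apply: measurable_funM.
      exact: measurable_bracket_powR.
    apply: measurable_normc; apply: cmeasM; first exact: cmeas_real.
    exact: cmeas_opp.
  - apply: emeasurable_funM; first exact: measurable_cst.
    by apply/measurable_EFinP; apply: measurable_funX; apply: measurable_normc; exact: cmeas_opp.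
  move=> xi _; rewrite -EFinM lee_fin /cutoff Normc.normcM normc_real -exprMn.
  rewrite lerXn2r ?nnegrE ?mulr_ge0 ?normc_ge0 ?powR_ge0//.
  by rewrite mulrA ler_wpM2r ?normc_ge0.
rewrite ge0_integralZl//; last 3 first.
- by apply/measurable_EFinP; apply: measurable_funX; apply: measurable_normc; exact: cmeas_opp.
- by move=> xi _; rewrite lee_fin sqr_ge0.
- by rewrite lee_fin sqr_ge0.
rewrite [(K ^+ 2 * _)%:E]EFinM -muleA lee_wpmul2l ?lee_fin ?sqr_ge0//.
apply: le_trans (plancherel_le dw).
have N1 : -1 != 0 :> R by rewrite oppr_eq0 oner_eq0.
have := ge0_integral_affine (0 : V) N1 mon (fun xi => _).
rewrite normrN1 expr1n invr1 mul1e => <-; last by move=> xi; rewrite lee_fin sqr_ge0.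
rewrite le_eqVlt; apply/orP; left; apply/eqP.
by apply: eq_integral => xi _; rewrite scaleN1r addr0.
Qed.

Lemma ge0_integral_combination d (T : measurableType d) (m : {measure set T -> \bar R})
    (D : set T) (f g : T -> \bar R) : measurable D ->
  measurable_fun D f -> (forall x, 0 <= f x)%E ->
  measurable_fun D g -> (forall x, 0 <= g x)%E ->
  (\int[m]_(x in D) (2%:E * f x + 2%:E * g x) =
   2%:E * \int[m]_(x in D) f x + 2%:E * \int[m]_(x in D) g x)%E.
Proof.
move=> mD mf f0 mg g0; rewrite ge0_integralD//; last 4 first.
- by move=> x _; rewrite mule_ge0.
- by apply: emeasurable_funM => //; exact: measurable_cst.
- by move=> x _; rewrite mule_ge0.
- by apply: emeasurable_funM => //; exact: measurable_cst.
by rewrite !ge0_integralZl.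
Qed.

Lemma unit_ball_max (x : V) : unit_ball x -> `|x| <= 1.
Proof.
move=> x1; apply: normr_rV_le; first exact: ler01.
move=> i; apply: ltW; apply: le_lt_trans x1.
rewrite -sqrtr_sqr /enorm ler_sqrt; last by apply: sumr_ge0 => j _; exact: sqr_ge0.
by rewrite (bigD1 i)//= lerDl; apply: sumr_ge0 => j _; exact: sqr_ge0.
Qed.

(** Both terms carry the 2 of [wave_cutoff_split]. In the near term, [C * K^2 * fmass] is the
    hypothesis followed by Plancherel, [(5 pi)^n] the overlap of the windows, and [n^n] the inverse
    volume of a cube. The far term is Young's inequality for a kernel of mass [B * pi^n]; it does
    not depend on the centre, so averaging costs nothing there. *)
Lemma local_to_global (phi P t : V -> R) (T B C K s1 : R) (h : V -> R[i]) :
  (0 < n)%N -> measurable_fun setT phi -> test P -> lebesgue_measurable t ->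
  (forall x, 0 <= t x <= T) -> dominated h -> 0 <= B -> 0 <= C -> 0 <= K ->
  (forall xi, bracket xi `^ s1 * `|P xi| <= K) ->
  (forall tau, 0 <= tau <= T -> forall x : V, 1 <= `|x| ->
    normc (wave_kernel phi tau P x) <= B * weight x) ->
  (forall t' : V -> R, lebesgue_measurable t' -> (forall x, 0 <= t' x <= T) ->
    forall G, ctest G ->
    (\int[nu]_x (\1_unit_ball x * normc (wave phi (t' x) G x) ^+ 2)%:E <=
     C%:E * \int[mu]_xi ((bracket xi `^ s1 * normc (G xi)) ^+ 2)%:E)%E) ->
  (\int[nu]_x (normc (wave phi (t x) (cutoff P h) x) ^+ 2)%:E <=
   (n%:R ^+ n * (2 * C * (K ^+ 2 * @fmass R n)) * (5 * pi) ^+ n + 2 * (B * pi ^+ n) ^+ 2)%:E *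
   \int[mu]_z (normc (h z) ^+ 2)%:E)%E.
Proof.
move=> n0 mphi tP mt tT dh B0 C0 K0 HK HB hyp; have [mh _] := dh.
have mP : measurable_fun setT P by apply: smooth_on_measurable; case: tP.
have F0 : 0 <= @fmass R n by rewrite ltW// fmass_gt0.
have mcut w : dominated w -> cmeas (cutoff P w).
  move=> [mw _]; apply: cmeasM; first exact: cmeas_real.
  exact/cmeas_opp/cmeas_osc.
pose u x : \bar R := (normc (wave phi (t x) (cutoff P h) x) ^+ 2)%:E.
have u0 x : (0 <= u x)%E by rewrite lee_fin sqr_ge0.
have mu_ : measurable_fun [set: lebesgue_rVType R n] u.
  apply/measurable_EFinP; apply: measurable_funX; apply: measurable_normc.
  by apply: cmeas_wave => //; exact: mcut.
pose kB (p : V * V) : R := B * weight (p.1 - p.2).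
have mkB : measurable_fun setT kB.
  apply: measurable_funM => //; apply: (measurableT_comp (@measurable_weight R n)).
  apply: measurable_fun_rV => i; under eq_fun do rewrite !mxE.
  by apply: measurable_funB; apply: (measurableT_comp (measurable_coord_rV i)).
have kB0 p : 0 <= kB p by rewrite mulr_ge0// weight_ge0.
have mhn : measurable_fun setT (normc \o h) by exact: measurable_normc.
have hn0 x : 0 <= (normc \o h) x by exact: normc_ge0.
pose E x : \bar R := (\int[mu]_z (kB (x, z) * (normc \o h) z)%:E)%E.
have E0 x : (0 <= E x)%E by apply: integral_ge0 => z _; rewrite lee_fin mulr_ge0.
have mE : measurable_fun setT E.
  apply: (measurable_fun_fubini_tonelli_F (m2 := mu) (fun p : V * V => (kB p * (normc \o h) p.2)%:E)).
    apply/measurable_EFinP; apply: measurable_funM => //.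
    exact: (measurableT_comp mhn measurable_snd).
  by move=> p; rewrite lee_fin mulr_ge0.
pose EE x : \bar R := (E x * E x)%E.
have EE0 x : (0 <= EE x)%E by rewrite mule_ge0.
have mEE : measurable_fun setT EE by exact: emeasurable_funM.
have mEEn : measurable_fun [set: lebesgue_rVType R n] EE by exact: lebesgue_measurable_borel.
set H2 := (\int[mu]_z (normc (h z) ^+ 2)%:E)%E.
have H20 : (0 <= H2)%E by apply: integral_ge0 => z _; rewrite lee_fin sqr_ge0.
have W x : (\int[mu]_z (weight (x - z))%:E = (pi ^+ n)%:E)%E.
  have N1 : -1 != 0 :> R by rewrite oppr_eq0 oner_eq0.
  have mw : measurable_fun setT (fun x : V => (weight x)%:E).
    by apply/measurable_EFinP; exact: measurable_weight.
  have := ge0_integral_affine x N1 mw (fun x => _).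
  rewrite normrN1 expr1n invr1 mul1e integral_weight => <-; last first.
    by move=> y; rewrite lee_fin weight_ge0.
  by apply: eq_integral => z _; rewrite scaleN1r addrC.
have W' z : (\int[mu]_x (weight (x - z))%:E = (pi ^+ n)%:E)%E.
  rewrite -(W z); apply: eq_integral => x _; rewrite -weightN opprB//.
have mwx (f : V -> V) : measurable_fun setT f -> measurable_fun setT (fun x => weight (f x)).
  by move=> mf; exact: (measurableT_comp (@measurable_weight R n) mf).
have msub1 x : measurable_fun setT (fun z : V => x - z).
  have := measurable_affine_rV (-1) x.
  by congr measurable_fun; apply/funext => z; rewrite /affine_rV scaleN1r addrC.
have msub2 z : measurable_fun setT (fun x : V => x - z).
  have := measurable_affine_rV 1 (- z).
  by congr measurable_fun; apply/funext => x; rewrite /affine_rV scale1r.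
have EEle : (\int[mu]_x EE x <= ((B * pi ^+ n) ^+ 2)%:E * H2)%E.
  have Y := @young _ _ _ mu kB (B * pi ^+ n)%:E (normc \o h) mkB kB0 mhn hn0.
  rewrite (_ : (_ * H2 = (B * pi ^+ n)%:E * ((B * pi ^+ n)%:E * H2))%E); last first.
    by rewrite expr2 EFinM muleA.
  apply: Y.
  - by rewrite lee_fin mulr_ge0// exprn_ge0// pi_ge0.
  - move=> x; rewrite ge0_integralZ_real//; last 2 first.
    + exact: mwx (msub1 x).
    + by move=> z; exact: weight_ge0.
    by rewrite W.
  - move=> z; rewrite ge0_integralZ_real//; last 2 first.
    + exact: mwx (msub2 z).
    + by move=> x; exact: weight_ge0.
    by rewrite W'.
pose Phi y : \bar R := (\int[mu]_z (normc (window h y z) ^+ 2)%:E)%E.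
have Phi0 y : (0 <= Phi y)%E by apply: integral_ge0 => z _; rewrite lee_fin sqr_ge0.
pose c := 2 * C * (K ^+ 2 * @fmass R n).
have c0 : 0 <= c by rewrite !mulr_ge0// sqr_ge0.
have mcube k : measurable (cube k : set V).
  by have [->|[mk _]] := @cubeP R n n0 k; [exact: measurable0|exact: mk].
have mcuben k : measurable (cube k : set (lebesgue_rVType R n)).
  exact: measurable_lebesgue_rV.
have mus (k : nat) : measurable_fun (cube k : set (lebesgue_rVType R n)) u by exact: measurable_funTS.
have mEEs (k : nat) : measurable_fun (cube k : set (lebesgue_rVType R n)) EE by exact: measurable_funTS.
(* The left side does not depend on the centre [y] in the cube. Averaging can therefore be done
   afterwards, on a bound measurable in [y] alone. *)
have local k y : cube k y -> (\int[nu]_(x in cube k) u x <=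
    c%:E * Phi y + 2%:E * \int[nu]_(x in cube k) EE x)%E.
  move=> ky; set w := window h y; have rw := crapid_window y dh.
  have dw : dominated w by exact: crapid_dominated.
  pose t' x := t (x + y).
  have mt' : lebesgue_measurable t'.
    have := measurableT_comp mt (measurable_affine_lebesgue y (oner_neq0 R)).
    by congr measurable_fun; apply/funext => x; rewrite /= /affine_rV scale1r.
  pose v x : \bar R := (\1_unit_ball x * normc (wave phi (t' x) (cutoff P w) x) ^+ 2)%:E.
  have v0 x : (0 <= v x)%E by rewrite lee_fin sqn_ge0.
  have mv : measurable_fun [set: lebesgue_rVType R n] v.
    apply/measurable_EFinP; apply: measurable_funM.
      by apply: lebesgue_measurable_borel; exact: measurable_indic measurable_unit_ball.
    apply: measurable_funX; apply: measurable_normc; apply: cmeas_wave => //.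
    exact: mcut.
  have vle : (\int[nu]_x v x <= (C * (K ^+ 2 * @fmass R n))%:E * Phi y)%E.
    apply: (le_trans (hyp t' mt' (fun x => tT _) _ (ctest_cutoff tP rw))).
    rewrite EFinM -muleA lee_wpmul2l ?lee_fin//.
    exact: integral_cutoff_le.
  (* The localized evolution moved back to [y]; on the cube, which lies in the unit ball about [y],
     its indicator equals 1. *)
  pose v' x : \bar R := v (1 *: x + - y).
  have mv' : measurable_fun [set: lebesgue_rVType R n] v'.
    exact: (measurableT_comp mv (measurable_affine_lebesgue (- y) (oner_neq0 R))).
  have v'E : (\int[nu]_x v' x = \int[nu]_x v x)%E.
    rewrite (ge0_integral_affine_lebesgue (- y) (oner_neq0 R) mv v0).
    by rewrite normr1 expr1n invr1 mul1e.
  have mv's : measurable_fun (cube k : set (lebesgue_rVType R n)) v' by exact: measurable_funTS.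
  have v'E1 (x : V) : unit_ball (x - y) ->
      v' x = (normc (wave phi (t x) (cutoff P w) (x - y)) ^+ 2)%:E.
    move=> b; rewrite /v' (scale1r x) /v /t' (subrK y x) indicE (mem_set b).
    by rewrite mul1r.
  have pw (x : V) : cube k x -> (u x <= 2%:E * v' x + 2%:E * EE x)%E.
    move=> kx; have bxy : unit_ball (x - y) := enorm_cube n0 kx ky.
    have := wave_cutoff_split y mphi tP dh B0 (HB (t x) (tT x)) (unit_ball_max bxy).
    by rewrite (subrK y x) (v'E1 x bxy) -EFinM; exact.
  apply: (@le_trans _ _ (\int[nu]_(x in cube k) (2%:E * v' x + 2%:E * EE x))%E).
    apply: (@ge0_le_integral _ _ _ nu _ (mcuben k)).
    - by move=> x _; exact: u0.
    - exact: mus.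
    - by apply: emeasurable_funD; apply: emeasurable_funM => //; exact: measurable_cst.
    exact: pw.
  have v'0 x : (0 <= v' x)%E by exact: v0.
  clearbody v'.
  have CI := ge0_integral_combination nu (mcuben k) mv's v'0 (mEEs k) EE0.
  rewrite CI; apply: leeD; last exact: lexx.
  rewrite /c -mulrA EFinM -muleA lee_wpmul2l//.
  apply: (le_trans _ vle); rewrite -v'E.
  by apply: (ge0_subset_integral nu (mcuben k) measurableT mv') => // x _; exact: v'0.
pose d : R := n%:R ^- n.
have d0 : 0 < d by rewrite invr_gt0 exprn_gt0// ltr0n.
have mPhi : measurable_fun setT Phi.
  apply: (measurable_fun_fubini_tonelli_F (m2 := mu)
      (fun p : V * V => (normc (window h p.1 p.2) ^+ 2)%:E)).
    apply/measurable_EFinP; apply: measurable_funX; apply: measurable_normc.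
    apply: cmeasM; last first.
      have ma : measurable_fun setT (fun p : V * V => p.2 + p.1).
        apply: measurable_fun_rV => i; under eq_fun do rewrite mxE.
        by apply: measurable_funD; apply: (measurableT_comp (measurable_coord_rV i)).
      exact: (cmeas_comp ma mh).
    apply: cmeas_real.
    have mI : measurable_fun setT (\1_[set z : V | `|z| <= 2] : V -> R).
      exact: measurable_indic measurable_ball_max.
    exact: (measurableT_comp mI measurable_snd).
  by move=> p; rewrite lee_fin sqr_ge0.
have PhiI : (\int[mu]_y Phi y <= ((5 * pi) ^+ n)%:E * H2)%E by exact: integral_window_le.
have EEE : (\int[nu]_x EE x = \int[mu]_x EE x)%E by exact: ge0_integral_lebesgue_rV.
rewrite -[leLHS]/(\int[nu]_x u x)%E.
clearbody u EE Phi H2.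
(* Integration in [y] over the cube: terms constant in [y] acquire the volume [d = n^-n], while the
   integrals of [Phi] over the cubes will add up to one over the whole space. *)
have average k : (d%:E * \int[nu]_(x in cube k) u x <=
    c%:E * \int[mu]_(y in cube k) Phi y + (d * 2)%:E * \int[nu]_(x in cube k) EE x)%E.
  have [k0|[mk vk]] := @cubeP R n n0 k.
    by rewrite k0 !integral_set0 !mule0 adde0.
  set U := (\int[nu]_(x in cube k) u x)%E; set Q := (\int[nu]_(x in cube k) EE x)%E.
  have U0 : (0 <= U)%E by apply: integral_ge0 => x _; exact: u0.
  have Q0 : (0 <= Q)%E by apply: integral_ge0 => x _; exact: EE0.
  have mPk : measurable_fun (cube k : set V) Phi by exact: measurable_funTS.
  have -> : (d%:E * U = \int[mu]_(y in cube k) (cst U y))%E.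
    rewrite integral_cst// muleC; congr (_ * _)%E; exact: esym vk.
  have -> : ((d * 2)%:E * Q = \int[mu]_(y in cube k) (cst (2%:E * Q) y))%E.
    rewrite integral_cst// [RHS]muleC EFinM -muleA; congr (_ * _)%E; exact: esym vk.
  rewrite -ge0_integralZl// -ge0_integralD//; last 3 first.
  - by move=> y _; rewrite mule_ge0.
  - by apply: emeasurable_funM => //; exact: measurable_cst.
  - by move=> y _; rewrite mule_ge0.
  apply: ge0_le_integral => //.
  - apply: emeasurable_funD; last exact: measurable_cst.
    by apply: emeasurable_funM => //; exact: measurable_cst.
  - by move=> y ky; exact: local.
have total : (d%:E * \int[nu]_x u x <=
    c%:E * \int[mu]_y Phi y + (d * 2)%:E * \int[nu]_x EE x)%E.
  have nbig (f : V -> \bar R) : measurable_fun [set: lebesgue_rVType R n] f -> (forall x, 0 <= f x)%E ->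
      (\int[nu]_x f x = \sum_(k <oo) \int[nu]_(x in cube k) f x)%E.
    move=> mf f0; rewrite -[X in integral _ X]bigcup_cube ge0_integral_bigcup//.
    - by rewrite bigcup_cube.
    - exact: trivIset_cube.
  rewrite nbig// (nbig EE)// -[X in (_ <= _ * integral _ X _ + _)%E]bigcup_cube.
  rewrite ge0_integral_bigcup//; last 2 first.
  - by rewrite bigcup_cube.
  - exact: trivIset_cube.
  have Uk0 k : (0 <= \int[nu]_(x in cube k) u x)%E by apply: integral_ge0 => x _; exact: u0.
  have Qk0 k : (0 <= \int[nu]_(x in cube k) EE x)%E by apply: integral_ge0 => x _; exact: EE0.
  have Pk0 k : (0 <= \int[mu]_(x in cube k) Phi x)%E by apply: integral_ge0 => x _; exact: Phi0.
  have d0' : (0 <= d%:E)%E by rewrite lee_fin ltW.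
  have d20 : (0 <= (d * 2)%:E)%E by rewrite lee_fin mulr_ge0// ltW.
  have c0' : (0 <= c%:E)%E by rewrite lee_fin.
  rewrite -(nneseriesZl d 0 (P := xpredT) (fun k _ => Uk0 k)) -(nneseriesZl c 0 (P := xpredT) (fun k _ => Pk0 k)).
  rewrite -(nneseriesZl (d * 2) 0 (P := xpredT) (fun k _ => Qk0 k)) -nneseriesD; last 2 first.
  - by move=> k _ _; rewrite mule_ge0.
  - by move=> k _ _; rewrite mule_ge0.
  by apply: lee_nneseries => k _; [move=> _; rewrite mule_ge0|exact: average].
have dE : (\int[nu]_x u x = (n%:R ^+ n)%:E * (d%:E * \int[nu]_x u x))%E.
  by rewrite muleA -EFinM mulfV ?mul1e// expf_neq0// pnatr_eq0 -lt0n.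
rewrite dE.
have N0 : 0 <= n%:R ^+ n :> R by rewrite exprn_ge0.
apply: (@le_trans _ _ ((n%:R ^+ n)%:E *
   (c%:E * (((5 * pi) ^+ n)%:E * H2) + (d * 2)%:E * (((B * pi ^+ n) ^+ 2)%:E * H2)))%E).
  rewrite lee_wpmul2l ?lee_fin//; apply: (le_trans total); apply: leeD.
    by rewrite lee_wpmul2l ?lee_fin.
  by rewrite EEE lee_wpmul2l// lee_fin mulr_ge0// ltW.
rewrite !muleA -!EFinM ge0_muleDr; last 2 first.
- by rewrite mule_ge0// lee_fin mulr_ge0// exprn_ge0// mulr_ge0// pi_ge0.
- by rewrite mule_ge0// lee_fin mulr_ge0 ?sqr_ge0// mulr_ge0// (ltW d0).
rewrite !muleA -!EFinM EFinD ge0_muleDl; last 2 first.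
- by rewrite lee_fin !mulr_ge0// ?exprn_ge0// ?sqr_ge0// mulr_ge0// pi_ge0.
- by rewrite lee_fin mulr_ge0// sqr_ge0.
rewrite -/c !mulrA mulfV ?mul1r// expf_neq0// pnatr_eq0 -lt0n//.
Qed.

End local_to_global.

(** * Dyadic pieces *)

Section dyadic.
Context {R : realType} {n : nat}.
Notation V := 'rV[R]_n.
Notation mu := (borel_lebesgue R n).
Notation nu := (lebesgue_rV R n).

(** The differences telescope: for [k < K] the functions [annulus (2^k)] add up to
    [bump (2^-K xi) - bump xi]. *)
Definition annulus (L : R) (xi : V) : R := bump ((2 * L)^-1 *: xi) - bump (L^-1 *: xi).

(* Equal to 1 on the support of [annulus L]. *)
Definition fat_annulus (L : R) (xi : V) : R :=
  bump ((4 * L)^-1 *: xi) - bump ((L / 2)^-1 *: xi).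

Lemma bumpB_le1 (x y : V) : `|bump x - bump y| <= 1.
Proof.
rewrite ler_norml; have := bump_ge0 x; have := bump_ge0 y.
have := bump_le1 x; have := bump_le1 y; lra.
Qed.

Lemma annulus_le1 L xi : `|annulus L xi| <= 1.
Proof. exact: bumpB_le1. Qed.

Lemma fat_annulus_le1 L xi : `|fat_annulus L xi| <= 1.
Proof. exact: bumpB_le1. Qed.

Lemma normrZV (c : R) (xi : V) : 0 < c -> `|c^-1 *: xi| = `|xi| / c.
Proof. by move=> c0; rewrite normrZ gtr0_norm ?invr_gt0// mulrC. Qed.

Lemma bumpZV_eq1 (c : R) (xi : V) : 0 < c -> `|xi| <= c -> bump (c^-1 *: xi) = 1.
Proof. by move=> c0 xc; rewrite bump_eq1// normrZV// ler_pdivrMr// mul1r. Qed.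

Lemma bumpZV_eq0 (c : R) (xi : V) : 0 < c -> 2 * c <= `|xi| -> bump (c^-1 *: xi) = 0.
Proof. by move=> c0 xc; rewrite bump_eq0// normrZV// ler_pdivlMr. Qed.

Lemma annulus_supp L xi : 0 < L -> annulus L xi != 0 -> L <= `|xi| <= 4 * L.
Proof.
move=> L0; apply: contraR; rewrite negb_and -!ltNge => /orP[xL|xL].
  by rewrite /annulus !bumpZV_eq1 ?subrr//; lra.
by rewrite /annulus !bumpZV_eq0 ?subrr//; lra.
Qed.

Lemma fat_annulus_eq1 L xi : 0 < L -> L <= `|xi| <= 4 * L -> fat_annulus L xi = 1.
Proof.
move=> L0 /andP[xL Lx]; rewrite /fat_annulus bumpZV_eq1//; last by lra.
by rewrite bumpZV_eq0 ?subr0//; lra.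
Qed.

Lemma annulusM_fat L xi : 0 < L -> annulus L xi * fat_annulus L xi = annulus L xi.
Proof.
move=> L0; have [->|/(annulus_supp L0) H] := eqVneq (annulus L xi) 0; first by rewrite mul0r.
by rewrite fat_annulus_eq1// mulr1.
Qed.

Lemma fat_annulus_supp L xi : 0 < L -> fat_annulus L xi != 0 -> L / 2 <= `|xi|.
Proof.
move=> L0; apply: contraR; rewrite -ltNge => xL.
by rewrite /fat_annulus !bumpZV_eq1 ?subrr//; lra.
Qed.

Lemma test_bumpB (c d : R) : 0 < c -> c <= d -> test (fun xi : V => bump (d^-1 *: xi) - bump (c^-1 *: xi)).
Proof.
move=> c0 cd; have d0 : 0 < d by exact: lt_le_trans cd.
split; last first.
  by exists (2 * d) => x dx; rewrite !bumpZV_eq0 ?subrr//; lra.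
have := smooth_onD (@openT _) (smooth_on_bump (n := n) d^-1)
   (smooth_onZ (@openT _) (-1) (smooth_on_bump (n := n) c^-1)).
by congr smooth_on; apply/funext => x; rewrite fctE mulN1r.
Qed.

Lemma test_annulus L : 0 < L -> test (annulus L).
Proof. by move=> L0; apply: test_bumpB => //; lra. Qed.

Lemma test_fat_annulus L : 0 < L -> test (fat_annulus L).
Proof. by move=> L0; apply: test_bumpB; lra. Qed.

Lemma annulusZ L M xi : L != 0 -> annulus (L * M) (L *: xi) = annulus M xi.
Proof.
move=> L0; have E c : (L * c)^-1 *: (L *: xi) = c^-1 *: xi.
  by rewrite scalerA invfM mulrAC mulVf// mul1r.
by rewrite /annulus (mulrCA 2 L M) !E.
Qed.

Lemma cint_dilate (c : R) (g : V -> R[i]) : 0 < c -> cintegrable mu g ->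
  cint mu g = ((c ^+ n)%:C)%C * cint mu (fun x => g (c *: x)).
Proof.
move=> c0 ig; have cn0 : c != 0 by rewrite gt_eqF.
have := cint_affine (0 : V) cn0 ig; rewrite (gtr0_norm c0).
under eq_cint do rewrite addr0; move=> ->.
by rewrite mulrA -rmorphM/= mulfV ?expf_neq0// mul1r.
Qed.

(** * Kernel and dilation at one frequency scale *)

Section phase.
Variables (a : R) (phi : V -> R).
Hypothesis sphi : smooth_on [set xi : V | xi != 0] phi.
Hypothesis hphi : forall (r : R) (xi : V), 0 < r -> xi != 0 -> phi (r *: xi) = r `^ a * phi xi.

(** Turns the phase, singular at 0 and unbounded at infinity, into a test function that agrees with
    it on the support of [annulus 1]; integration by parts sees nothing else. *)
Definition phase_cut (xi : V) : R := phi xi * fat_annulus 1 xi.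

Lemma test_phase_cut : test phase_cut.
Proof.
have [sf [r fr]] := test_fat_annulus (@ltr01 R).
split; last by exists r => x rx; rewrite /phase_cut fr// mulr0.
have oU : open [set xi : V | xi != 0].
  have := @open_comp _ _ (fun x : V => `|x|) [set y : R | 0 < y].
  rewrite (_ : _ @^-1` _ = [set xi : V | xi != 0]); last first.
    by apply/seteqP; split => x /=; rewrite normr_gt0.
  by apply; [move=> y _; exact: norm_continuous|exact: open_gt].
have oU' : open [set xi : V | `|xi| < 2^-1].
  have := @open_comp _ _ (fun x : V => `|x|) [set y : R | y < 2^-1].
  by apply; [move=> y _; exact: norm_continuous|exact: open_lt].
rewrite (_ : setT = [set xi : V | xi != 0] `|` [set xi : V | `|xi| < 2^-1]); last first.
  apply/seteqP; split => // x _; have [->|x0] := eqVneq x 0; [right|left] => //=.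
  by rewrite normr0 invr_gt0.
apply: smooth_onU.
  by apply: smooth_onM => //; exact: smooth_onS sf.
apply: smooth_on0 => // x /= x2; rewrite /phase_cut.
have [->|] := eqVneq (fat_annulus 1 x) 0; first by rewrite mulr0.
by move=> /(fat_annulus_supp ltr01); move: x2; lra.
Qed.

(** The substitution [xi = L eta] produces [L^n] and, by homogeneity, the phase
    [(L x) . eta + tau L^a phi(eta)] on a fixed annulus. There [oscint_decay] applies with parameter
    [tau L^a <= sigma], and [|L x_i|^N] gives the factor [L^-N]. The 2 accounts for the real and
    imaginary parts. *)
Lemma kernel_decay N : exists2 C, 0 <= C & forall (L tau sigma : R) (x : V) i,
  0 < L -> 0 <= tau -> tau * L `^ a <= sigma -> 1 <= sigma ->
  `|x ord0 i| ^+ N * normc (wave_kernel phi tau (annulus L) x) <=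
  C * (L ^+ n * (sigma / L) ^+ N).
Proof.
have tA := test_annulus (@ltr01 R).
have /choice[C HC] : forall i, exists C, forall (sigma tau delta : R) (x : V), 1 <= sigma ->
    `|tau| <= sigma -> `|x ord0 i| ^+ N * `|oscint phase_cut (annulus 1) tau delta x| <= C * sigma ^+ N.
  by move=> i; apply: oscint_decay; [exact: test_phase_cut|exact: test_decays].
exists (2 * \sum_i `|C i|) => [|L tau sigma x i L0 t0 tL s1].
  by rewrite mulr_ge0// sumr_ge0.
have mphi := measurable_punctured sphi.
have Ln0 : L != 0 by rewrite gt_eqF.
set s := tau * L `^ a; have s0 : 0 <= s by rewrite mulr_ge0// powR_ge0.
have sabs : `|s| <= sigma by rewrite ger0_norm.
pose g xi := expi (dotprod x xi + tau * phi xi) * ((annulus L xi)%:C)%C.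
have ig : cintegrable mu g.
  apply: dominated_integrable; apply: dominated_expi; first exact: measurable_phase.
  exact/test_dominated/test_annulus.
have E : wave_kernel phi tau (annulus L) x = ((L ^+ n)%:C)%C *
   cint mu (fun eta => expi (dotprod (L *: x) eta + s * phase_cut eta) * ((annulus 1 eta)%:C)%C).
  transitivity (((L ^+ n)%:C)%C * cint mu (fun eta => g (L *: eta))); first exact: (cint_dilate L0 ig).
  apply: (congr1 ( *%R _)).
  apply: eq_cint => eta; rewrite /g -[X in annulus X (_ *: _)]mulr1 annulusZ//.
  have [->|A0] := eqVneq (annulus 1 eta) 0; first by rewrite !mulr0.
  have H := annulus_supp ltr01 A0; congr (expi _ * _).
  have e0 : eta != 0.
    by rewrite -normr_gt0; case/andP: H => + _; apply: lt_le_trans.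
  by rewrite hphi// dotprodZr dotprodZl /phase_cut fat_annulus_eq1// mulr1 /s mulrA.
rewrite E Normc.normcM normc_real (ger0_norm (exprn_ge0 _ (ltW L0))).
set w := cint _ _.
have Hw : `|L * x ord0 i| ^+ N * normc w <= 2 * (\sum_j `|C j|) * sigma ^+ N.
  have CC : C i <= \sum_j `|C j|.
    by rewrite (bigD1 i)//= (le_trans (ler_norm _))// lerDl sumr_ge0.
  have sN : 0 <= sigma ^+ N by rewrite exprn_ge0// (le_trans ler01).
  apply: (@le_trans _ _ (`|L * x ord0 i| ^+ N * (`|Re w| + `|Im w|))).
    by rewrite ler_wpM2l ?exprn_ge0// normc_le.
  rewrite mulrDr mulr2n mulrDl mul1r mulrDl; apply: lerD.
    have := HC i sigma s 0 (L *: x) s1 sabs; rewrite mxE => H.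
    apply: (le_trans _ (ler_wpM2r sN CC)); apply: le_trans H; rewrite le_eqVlt; apply/orP; left; apply/eqP.
    congr (_ * `|_|); apply: eq_Rintegral => eta _.
    by rewrite ReM /expi /= mulr0 subr0 addr0.
  have := HC i sigma s (- (pi / 2)) (L *: x) s1 sabs; rewrite mxE => H.
  apply: (le_trans _ (ler_wpM2r sN CC)); apply: le_trans H; rewrite le_eqVlt; apply/orP; left; apply/eqP.
  congr (_ * `|_|); apply: eq_Rintegral => eta _.
  by rewrite ImM /expi /= mulr0 add0r cosBpihalf.
rewrite expr_div_n mulrCA [leRHS]mulrCA ler_wpM2l ?exprn_ge0 ?(ltW L0)//.
rewrite mulrA ler_pdivlMr ?exprn_gt0//.
move: Hw; rewrite normrM exprMn (gtr0_norm L0) => Hw.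
by rewrite mulrC mulrA.
Qed.

Lemma max_coord (x : V) : 1 <= `|x| -> exists i, `|x| <= `|x ord0 i|.
Proof.
move=> x1; apply: contrapT => /forallNP H.
have : `|x| < `|x| by apply: normr_rV_lt => [|i]; [exact: lt_le_trans x1|rewrite ltNge; exact/negP].
by rewrite ltxx.
Qed.

(** For [|x| >= 1] each [1 + x_i^2] is at most [2 |x|^2]; hence decay of order [2 n] in the max norm
    is decay like [weight]. *)
Lemma weight_lower (x : V) N : (2 * n <= N)%N -> 1 <= `|x| -> 1 <= 2 ^+ n * `|x| ^+ N * weight x.
Proof.
move=> nN x1; have x0 : 0 <= `|x| by [].
apply: (@le_trans _ _ (2 ^+ n * `|x| ^+ (2 * n) * weight x)); last first.
  by rewrite ler_wpM2r ?weight_ge0// ler_wpM2l ?exprn_ge0// ler_weXn2l.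
rewrite exprM -exprMn /weight -[X in X * _](_ : \prod_(i < n) (2 * `|x| ^+ 2) = _); last first.
  by rewrite prodr_const card_ord.
rewrite -big_split /= -[leLHS](_ : \prod_(i < n) 1 = _); last by rewrite big1.
apply: ler_prod => i _; rewrite ler01 /weight1 ler_pdivlMr ?mul1r; last first.
  by rewrite ltr_pwDl// sqr_ge0.
have := normr_coord x i; rewrite -(@ler_pXn2r _ 2)// ?nnegrE// real_normK ?num_real//.
have : 1 <= `|x| ^+ 2 by rewrite expr_ge1.
by move=> + /= => ? ?; lra.
Qed.

(** The decay is used in the coordinate that realizes the max norm. The smallness condition absorbs
    all dependence on the scale, so that [B] serves for every dyadic piece. *)
Lemma kernel_weight N : (2 * n <= N)%N -> exists2 B, 0 <= B & forall (L tau sigma : R) (x : V),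
  0 < L -> 0 <= tau -> tau * L `^ a <= sigma -> 1 <= sigma -> L ^+ n * (sigma / L) ^+ N <= 1 ->
  1 <= `|x| -> normc (wave_kernel phi tau (annulus L) x) <= B * weight x.
Proof.
move=> nN; have [C C0 HC] := kernel_decay N.
exists (2 ^+ n * C) => [|L tau sigma x L0 t0 tL s1 LN x1]; first by rewrite mulr_ge0// exprn_ge0.
have [i xi] := max_coord x1.
have H := HC L tau sigma x i L0 t0 tL s1.
set K := normc _ in H *; have K0 : 0 <= K by exact: normc_ge0.
have K1 : `|x| ^+ N * K <= C.
  apply: (@le_trans _ _ (`|x ord0 i| ^+ N * K)).
    by rewrite ler_wpM2r// lerXn2r ?nnegrE.
  by apply: (le_trans H); rewrite ler_piMr.
apply: (@le_trans _ _ (K * (2 ^+ n * `|x| ^+ N * weight x))).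
  by rewrite ler_peMr// weight_lower.
rewrite (_ : K * _ = 2 ^+ n * (`|x| ^+ N * K) * weight x); last by ring.
by rewrite ler_wpM2r ?weight_ge0// ler_wpM2l ?exprn_ge0.
Qed.

Lemma dominated_dilate (h : V -> R[i]) L : 1 <= L -> dominated h ->
  dominated (fun z => h (L *: z)).
Proof.
move=> L1 [mh [C hC]]; split.
  have := cmeas_comp (measurable_affine_rV L (0 : V)) mh.
  by congr cmeas; apply/funext => z; rewrite /= /affine_rV addr0.
have C0 : 0 <= C by have := le_trans (normc_ge0 _) (hC 0); rewrite pmulr_lge0// weight_gt0.
exists C => z; apply: (le_trans (hC _)); rewrite ler_wpM2l//.
apply: ler_prod => i _; rewrite (ltW (weight1_gt0 _)) /weight1 mxE lef_pV2 ?posrE ?ltr_pwDl ?sqr_ge0//.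
rewrite lerD2l exprMn ler_peMl ?sqr_ge0//; exact: exprn_ege1.
Qed.

(** Substitution [xi = eta / L] and homogeneity of the phase. Homogeneity says nothing at the
    origin, and [H 0 = 0] disposes of that point. *)
Lemma wave_dilate (tau L : R) (H : V -> R[i]) (y : V) : 0 < L -> dominated H -> H 0 = 0 ->
  wave phi tau H (L *: y) =
  ((L ^- n)%:C)%C * wave phi (tau * L `^ (- a)) (fun eta => H (L^-1 *: eta)) y.
Proof.
move=> L0 dH H0; have Li0 : 0 < L^-1 by rewrite invr_gt0.
have mphi := measurable_punctured sphi.
pose g xi := expi (dotprod (L *: y) xi + tau * phi xi) * H xi.
have ig : cintegrable mu g.
  by apply: dominated_integrable; apply: dominated_expi => //; exact: measurable_phase.
transitivity (((L^-1 ^+ n)%:C)%C * cint mu (fun eta => g (L^-1 *: eta))).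
  exact: (cint_dilate Li0 ig).
rewrite exprVn; apply: (congr1 ( *%R _)); apply: eq_cint => eta; rewrite /g.
have [->|e0] := eqVneq eta 0; first by rewrite scaler0 H0 !mulr0.
rewrite hphi// dotprodZl dotprodZr mulrA divff ?gt_eqF// mul1r mulrA.
by congr (expi (_ + _ * _) * _); rewrite powRN -powR_inv1 ?ltW// powRAC powR_inv1 ?powR_ge0.
Qed.

(** Here [l] is the frequency scale and [L] the spatial dilation. The datum given to
    [local_to_global] is built from the fat annulus and the thin one is the cutoff: the product is
    the wanted piece, while the right side keeps a frequency localization, from which the gain in
    [l] will come. *)
Lemma high_piece (t : V -> R) (f : V -> R[i]) (l L B C K s1 : R) :
  (0 < n)%N -> 0 < l -> 1 <= L -> schwartz f ->
  lebesgue_measurable t -> (forall x, 0 <= t x <= 1) -> 0 <= B -> 0 <= C -> 0 <= K ->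
  (forall xi, bracket xi `^ s1 * `|annulus (L * l) xi| <= K) ->
  (forall tau, 0 <= tau <= L `^ (- a) -> forall x : V, 1 <= `|x| ->
    normc (wave_kernel phi tau (annulus (L * l)) x) <= B * weight x) ->
  (forall t' : V -> R, lebesgue_measurable t' -> (forall x, 0 <= t' x <= L `^ (- a)) ->
    forall G, ctest G ->
    (\int[nu]_x (\1_unit_ball x * normc (wave phi (t' x) G x) ^+ 2)%:E <=
     C%:E * \int[mu]_xi ((bracket xi `^ s1 * normc (G xi)) ^+ 2)%:E)%E) ->
  (\int[nu]_x (normc (wave phi (t x) (fun xi => ((annulus l xi)%:C)%C * fourier f xi) x) ^+ 2)%:E <=
   ((n%:R ^+ n * (2 * C * (K ^+ 2 * @fmass R n)) * (5 * pi) ^+ n + 2 * (B * pi ^+ n) ^+ 2) / @fmass R n)%:E *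
   \int[mu]_xi (normc (((fat_annulus l xi)%:C)%C * fourier f xi) ^+ 2)%:E)%E.
Proof.
move=> n0 l0 L1 sf mt t01 B0 C0 K0 HK HB hyp.
set M := _ + 2 * _.
have L0 : 0 < L by exact: lt_le_trans L1.
have Ln0 : L != 0 by rewrite gt_eqF.
have mphi := measurable_punctured sphi.
have f0 := @fmass_gt0 R n; have fn0 : @fmass R n != 0 by rewrite gt_eqF.
have dff := dominated_fourier sf.
set ff := fourier f in dff *.
pose F xi := ((fat_annulus l xi)%:C)%C * ff xi.
pose H xi := ((annulus l xi)%:C)%C * ff xi.
have tF : ctest F.
  have [sr si] := smooth_fourier sf; have tf := test_fat_annulus l0; split.
    by have := testM tf sr; congr test; apply/funext => x; rewrite /F fctE [RHS]ReZ.
  by have := testM tf si; congr test; apply/funext => x; rewrite /F fctE [RHS]ImZ.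
have rF := ctest_crapid tF; have dF := crapid_dominated rF.
have dOF := dominated_osc rF (ctest_cdecays tF).
have [cFr cFi] : continuous (Re \o F) /\ continuous (Im \o F).
  by case: tF => -[sr _] [si _]; split; exact: smooth_on_continuous.
have dH : dominated H.
  apply: dominatedM => //; first by case: (test_dominated (test_annulus l0)).
  by exists 1 => x; rewrite normc_real annulus_le1.
have H00 : H 0 = 0.
  rewrite /H (_ : annulus l 0 = 0) ?mul0r//; apply: contraTeq isT => /(annulus_supp l0).
  by rewrite normr0 leNgt l0.
(* The dilated datum in physical space, up to normalization; [F] is a test amplitude, so [osc F] is
   dominated and inversion is available. *)
pose h z := osc F (L *: z).
have dh : dominated h by exact: dominated_dilate.
have tA : test (annulus (L * l)) by apply: test_annulus; exact: mulr_gt0.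
have cutE eta : cutoff (annulus (L * l)) h eta = ((L ^- n * @fmass R n)%:C)%C * H (L^-1 *: eta).
  rewrite /cutoff /h (osc_dilate _ L0 dOF) scalerN osc_inversion//.
  have -> : annulus (L * l) eta = annulus l (L^-1 *: eta).
    by rewrite -(annulusZ l (L^-1 *: eta) Ln0) scalerA mulfV// scale1r.
  rewrite /F /H -[in RHS](annulusM_fat _ l0) !rmorphM/=; ring.
have [mh _] := dh.
have dcut : dominated (cutoff (annulus (L * l)) h).
  have [CO oC] := osc_bounded dh.
  have mo : cmeas (fun xi : V => osc h (- xi)) by apply: cmeas_opp; exact: cmeas_osc.
  have := dominatedM mo (ex_intro _ CO (fun xi => oC (- xi))) (test_dominated tA).
  by congr dominated; apply/funext => xi; rewrite /cutoff mulrC.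
(* The time function seen after dilation: by homogeneity times are divided by [L^a]. *)
pose t' y := t (L *: y) * L `^ (- a).
have P0 : 0 <= L `^ (- a) by exact: powR_ge0.
have t'P y : 0 <= t' y <= L `^ (- a).
  by have /andP[u0 u1] := t01 (L *: y); rewrite mulr_ge0// ler_piMl.
have mt' : lebesgue_measurable t'.
  apply: measurable_funM; [|exact: measurable_cst].
  have := measurableT_comp mt (measurable_affine_lebesgue (0 : V) Ln0).
  by congr measurable_fun; apply/funext => y; rewrite /= /affine_rV addr0.
have main := local_to_global n0 mphi tA mt' t'P dh B0 C0 K0 HK HB hyp.
rewrite -/M in main.
pose u x : \bar R := (normc (wave phi (t x) H x) ^+ 2)%:E.
have u0 x : (0 <= u x)%E by rewrite lee_fin sqr_ge0.
have mu_ : measurable_fun [set: lebesgue_rVType R n] u.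
  apply/measurable_EFinP; apply: measurable_funX; apply: measurable_normc.
  by apply: cmeas_wave => //; case: dH.
have uE y : u (L *: y + 0) =
    ((@fmass R n)^-1 ^+ 2 * normc (wave phi (t' y) (cutoff (annulus (L * l)) h) y) ^+ 2)%:E.
  (* Inverts [cutE]: the dilated amplitude is a constant multiple of the cutoff of [h]. Squared, the
     constant leaves [fmass^-2], one power of which is compensated by Plancherel for [h]. *)
  have HE : (fun eta => H (L^-1 *: eta)) =
      (fun eta => ((L ^+ n / @fmass R n)%:C)%C * cutoff (annulus (L * l)) h eta).
    apply/funext => eta; rewrite cutE mulrA -rmorphM/=.
    have -> : L ^+ n / @fmass R n * (L ^- n * @fmass R n) = 1.
      by field; rewrite fn0 expf_neq0.
    by rewrite mul1r.
  rewrite /u addr0 (wave_dilate (t (L *: y)) y L0 dH H00) HE waveZ//.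
  rewrite !Normc.normcM !normc_real mulrA -normrM exprMn real_normK ?num_real//.
  have -> : L ^- n * (L ^+ n / @fmass R n) = (@fmass R n)^-1.
    by rewrite mulrA mulVf ?expf_neq0// mul1r.
  by [].
have Lp : (0 < L ^- n) by rewrite invr_gt0 exprn_gt0.
have uI := ge0_integral_affine_lebesgue (0 : V) Ln0 mu_ u0.
rewrite (gtr0_norm L0) in uI.
rewrite -(@lee_pmul2l _ (L ^- n)%:E)// -[X in (_ * X <= _)%E]/(\int[nu]_x u x)%E -uI.
under eq_integral do rewrite uE.
rewrite ge0_integralZ_real; [|exact: sqr_ge0| |by move=> x; exact: sqr_ge0]; last first.
  apply: measurable_funX; apply: measurable_normc.
  by apply: cmeas_wave => //; case: dcut.
have M0 : 0 <= M.
  by rewrite addr_ge0// !mulr_ge0 ?exprn_ge0 ?pi_ge0 ?sqr_ge0// ?mulr_ge0 ?pi_ge0// ltW.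
have hE : (\int[mu]_z (normc (h z) ^+ 2)%:E <= (L ^- n * @fmass R n)%:E *
    \int[mu]_xi (normc (F xi) ^+ 2)%:E)%E.
  have mo : measurable_fun setT (fun z => (normc (osc F z) ^+ 2)%:E).
    apply/measurable_EFinP; apply: measurable_funX; apply: measurable_normc.
    by case: dOF.
  have o0 z : (0 <= (normc (osc F z) ^+ 2)%:E)%E by rewrite lee_fin sqr_ge0.
  have := ge0_integral_affine (0 : V) Ln0 mo o0; rewrite (gtr0_norm L0).
  under eq_integral do rewrite addr0; rewrite /h => ->.
  by rewrite EFinM -muleA lee_wpmul2l ?lee_fin ?(ltW Lp)// plancherel_le.
apply: (le_trans (lee_wpmul2l _ main)); first by rewrite lee_fin sqr_ge0.
apply: (@le_trans _ _ (((@fmass R n)^-1 ^+ 2)%:E * (M%:E * ((L ^- n * @fmass R n)%:E *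
    \int[mu]_xi (normc (F xi) ^+ 2)%:E)))%E).
  by rewrite lee_wpmul2l ?lee_fin ?sqr_ge0// lee_wpmul2l ?lee_fin.
rewrite !muleA -!EFinM le_eqVlt; apply/orP; left; apply/eqP; congr (_%:E * _)%E.
have Lnn : L ^+ n != 0 by exact: expf_neq0.
by move: Lnn fn0; clear; clearbody M; move=> ? ?; field; apply/andP.
Qed.

End phase.
End dyadic.

(** * Summation of the dyadic pieces *)

Section summation.
Context {R : realType} {n : nat}.
Notation V := 'rV[R]_n.
Notation mu := (borel_lebesgue R n).
Notation nu := (lebesgue_rV R n).

(** Minkowski's inequality for squared norms. The weights in the pointwise inequality are tuned to
    the known bounds [A] and [b], which avoids square roots of possibly infinite integrals. *)
Lemma integral_normcD d (T : measurableType d) (m : {measure set T -> \bar R})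
    (u v : T -> R[i]) (A b : R) (S : \bar R) : cmeas u -> cmeas v -> 0 < A -> 0 < b ->
  (\int[m]_x (normc (u x) ^+ 2)%:E <= (A ^+ 2)%:E * S)%E ->
  (\int[m]_x (normc (v x) ^+ 2)%:E <= (b ^+ 2)%:E * S)%E ->
  (\int[m]_x (normc (u x + v x) ^+ 2)%:E <= ((A + b) ^+ 2)%:E * S)%E.
Proof.
move=> cu cv A0 b0 uS vS; have Ab0 : 0 < A + b by exact: addr_gt0.
have mu2 : measurable_fun setT (fun x => normc (u x) ^+ 2).
  by apply: measurable_funX; exact: measurable_normc.
have mv2 : measurable_fun setT (fun x => normc (v x) ^+ 2).
  by apply: measurable_funX; exact: measurable_normc.
(* [|u + v|^2 <= ((A + b) / A) |u|^2 + ((A + b) / b) |v|^2] *)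
pose p := (A + b) / A; pose q := (A + b) / b.
have p0 : 0 <= p by rewrite divr_ge0 ?ltW.
have q0 : 0 <= q by rewrite divr_ge0 ?ltW.
have pu0 x : 0 <= p * normc (u x) ^+ 2 by rewrite mulr_ge0 ?sqr_ge0.
have qv0 x : 0 <= q * normc (v x) ^+ 2 by rewrite mulr_ge0 ?sqr_ge0.
apply: (@le_trans _ _ (\int[m]_x ((p * normc (u x) ^+ 2)%:E + (q * normc (v x) ^+ 2)%:E))%E).
  apply: (@ge0_le_integral _ _ _ m _ measurableT).
  - by move=> x _; rewrite lee_fin sqr_ge0.
  - by apply/measurable_EFinP; apply: measurable_funX; apply: measurable_normc; exact: cmeasD.
  - apply/measurable_EFinP; apply: measurable_funD; apply: measurable_funM;
      first [exact: measurable_cst | assumption].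
  move=> x _; rewrite -EFinD lee_fin.
  have U0 := normc_ge0 (u x); have W0 := normc_ge0 (v x).
  apply: (@le_trans _ _ ((normc (u x) + normc (v x)) ^+ 2)).
    by rewrite lerXn2r ?nnegrE ?addr_ge0 ?normc_ge0// le_normcD.
  rewrite -subr_ge0 /p /q.
  set U := normc (u x); set W := normc (v x).
  rewrite (_ : _ - _ = (b * U - A * W) ^+ 2 / (A * b)); last first.
    by field; rewrite !gt_eqF.
  by rewrite divr_ge0 ?sqr_ge0// mulr_ge0 ?ltW.
rewrite ge0_integralD; [|exact: measurableT| | | |]; last 4 first.
- by move=> x _; rewrite lee_fin.
- by apply/measurable_EFinP; apply: measurable_funM; [exact: measurable_cst|].
- by move=> x _; rewrite lee_fin.
- by apply/measurable_EFinP; apply: measurable_funM; [exact: measurable_cst|].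
rewrite !ge0_integralZ_real; [|done|assumption|by move=> x; exact: sqr_ge0
  |done|assumption|by move=> x; exact: sqr_ge0].
apply: (@le_trans _ _ (p%:E * ((A ^+ 2)%:E * S) + q%:E * ((b ^+ 2)%:E * S))%E).
  by apply: leeD; apply: lee_wpmul2l => //; rewrite lee_fin.
have pA : (0 <= (p * A ^+ 2)%:E)%E by rewrite lee_fin; exact: mulr_ge0 p0 (sqr_ge0 _).
have qb : (0 <= (q * b ^+ 2)%:E)%E by rewrite lee_fin; exact: mulr_ge0 q0 (sqr_ge0 _).
rewrite !muleA -!EFinM -(ge0_muleDl _ pA qb) -EFinD le_eqVlt; apply/orP; left; apply/eqP; congr (_%:E * _)%E.
by rewrite /p /q; field; rewrite !gt_eqF.
Qed.

Lemma waveD (phi : V -> R) tau (g h : V -> R[i]) x : measurable_fun setT phi ->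
  dominated g -> dominated h ->
  wave phi tau (fun xi => g xi + h xi) x = wave phi tau g x + wave phi tau h x.
Proof.
move=> mphi dg dh; rewrite /wave -cintD.
- by apply: eq_cint => xi; rewrite mulrDr.
- by apply: dominated_integrable; apply: dominated_expi => //; exact: measurable_phase.
- by apply: dominated_integrable; apply: dominated_expi => //; exact: measurable_phase.
Qed.

Lemma geometric_le (c r : R) K : 0 <= c -> 0 <= r < 1 ->
  \sum_(k < K) c * r ^+ k <= c / (1 - r).
Proof.
move=> c0 /andP[r0 r1]; have r10 : 0 < 1 - r by rewrite subr_gt0.
rewrite -mulr_sumr ler_wpM2l// -[leRHS]div1r ler_pdivlMr// mulrC.
have := subrXX 1 r K; rewrite expr1n.
under eq_bigr do rewrite expr1n mul1r.
by move=> <-; rewrite gerBl exprn_ge0.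
Qed.

Lemma cvg_bump (xi : V) : (fun k : nat => bump ((2 ^+ k)^-1 *: xi)) @ \oo --> (1 : R).
Proof.
apply: cvg_near_cst.
have [m xm] : exists m : nat, `|xi| <= 2 ^+ m.
  exists (Num.bound `|xi|); apply: (le_trans (ltW (archi_boundP (normr_ge0 xi)))).
  by rewrite -natrX ler_nat ltnW// ltn_expl.
exists m => // k /= mk; apply: bumpZV_eq1; rewrite ?exprn_gt0//.
by apply: (le_trans xm); rewrite ler_eXn2l// ltr1n.
Qed.

(** Finite partial sums are bounded by Minkowski and a geometric series. For each [x], at its own
    time [t x], they converge by dominated convergence in the frequency variable, and Fatou passes
    the bound to the limit. *)
Lemma dyadic_sum (phi t : V -> R) (g : V -> R[i]) (A c r : R) (S : \bar R) :
  measurable_fun setT phi -> lebesgue_measurable t -> dominated g ->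
  0 < A -> 0 < c -> 0 < r < 1 -> (0 <= S)%E ->
  (\int[nu]_x (normc (wave phi (t x) (fun xi => ((bump xi)%:C)%C * g xi) x) ^+ 2)%:E <=
    (A ^+ 2)%:E * S)%E ->
  (forall k, \int[nu]_x
     (normc (wave phi (t x) (fun xi => ((annulus (2 ^+ k) xi)%:C)%C * g xi) x) ^+ 2)%:E <=
    ((c * r ^+ k) ^+ 2)%:E * S)%E ->
  (\int[nu]_x (normc (wave phi (t x) g x) ^+ 2)%:E <= ((A + c / (1 - r)) ^+ 2)%:E * S)%E.
Proof.
move=> mphi mt dg A0 c0 /andP[r0 r1] S0 low high.
have [mg [Cg gC]] := dg.
have mbump k : measurable_fun setT (fun xi : V => bump ((2 ^+ k)^-1 *: xi)).
  exact: smooth_on_measurable (smooth_on_bump _).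
have mann k : measurable_fun setT (fun xi : V => annulus (2 ^+ k) xi).
  have L0 : 0 < 2 ^+ k :> R by exact: exprn_gt0.
  by have [sa _] := @test_annulus R n _ L0; exact: smooth_on_measurable sa.
pose G k xi := ((bump ((2 ^+ k)^-1 *: xi))%:C)%C * g xi.
have dG k : dominated (G k).
  apply: dominatedM => //; first exact: cmeas_real.
  by exists 1 => x; rewrite normc_real ger0_norm ?bump_ge0 ?bump_le1.
have dP k : dominated (fun xi => ((annulus (2 ^+ k) xi)%:C)%C * g xi).
  apply: dominatedM => //; first exact: cmeas_real.
  by exists 1 => x; rewrite normc_real annulus_le1.
have mW h : dominated h -> cmeas (fun x : lebesgue_rVType R n => wave phi (t x) h x).
  by case=> mh _; exact: cmeas_wave.
have partial_sum K : (\int[nu]_x (normc (wave phi (t x) (G K) x) ^+ 2)%:E <=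
    ((A + \sum_(k < K) c * r ^+ k) ^+ 2)%:E * S)%E.
  elim: K => [|K IH].
    have -> : G 0%N = fun xi => ((bump xi)%:C)%C * g xi.
      by apply/funext => xi; rewrite /G expr0 invr1 scale1r.
    by rewrite big_ord0 addr0.
  have -> : A + \sum_(k < K.+1) c * r ^+ k = A + \sum_(k < K) c * r ^+ k + c * r ^+ K.
    by rewrite big_ord_recr addrA.
  have GS x : wave phi (t x) (G K.+1) x = wave phi (t x) (G K) x +
      wave phi (t x) (fun xi => ((annulus (2 ^+ K) xi)%:C)%C * g xi) x.
    rewrite -(waveD _ _ mphi (dG K) (dP K)); congr (wave _ _ _ _).
    by apply/funext => xi; rewrite -mulrDl -rmorphD/= /annulus addrC subrK -exprS.
  rewrite (@eq_integral _ _ _ nu setT (fun x => (normc (wave phi (t x) (G K) x +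
    wave phi (t x) (fun xi => ((annulus (2 ^+ K) xi)%:C)%C * g xi) x) ^+ 2)%:E)); last first.
    by move=> x _; rewrite GS.
  apply: integral_normcD; [exact: mW|exact: mW| | |exact: IH|exact: high].
    by rewrite ltr_pwDl// sumr_ge0// => k _; rewrite mulr_ge0 ?exprn_ge0 ?ltW.
  by rewrite mulr_gt0// exprn_gt0.
apply: (@fatou_le R _ _ nu (fun k x => normc (wave phi (t x) (G k) x) ^+ 2)).
- move=> k; apply: measurable_funX; apply: measurable_normc; exact: mW.
- by move=> k x; exact: sqr_ge0.
- move=> x.
  pose E xi := expi (dotprod x xi + t x * phi xi) * g xi.
  pose F k xi := expi (dotprod x xi + t x * phi xi) * G k xi.
  have FE k xi : F k xi = ((bump ((2 ^+ k)^-1 *: xi))%:C)%C * E xi by rewrite /F /G mulrCA.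
  have mex : cmeas (fun xi => expi (dotprod x xi + t x * phi xi)).
    by apply: cmeas_expi; exact: measurable_phase.
  have cR xi : (fun k => Re (F k xi)) @ \oo --> Re (E xi).
    have -> : (fun k => Re (F k xi)) = (fun k => bump ((2 ^+ k)^-1 *: xi) * Re (E xi)).
      by apply/funext => k; rewrite FE ReZ.
    by rewrite -[X in _ --> X]mul1r; apply: cvgM; [exact: cvg_bump|exact: cvg_cst].
  have cI xi : (fun k => Im (F k xi)) @ \oo --> Im (E xi).
    have -> : (fun k => Im (F k xi)) = (fun k => bump ((2 ^+ k)^-1 *: xi) * Im (E xi)).
      by apply/funext => k; rewrite FE ImZ.
    by rewrite -[X in _ --> X]mul1r; apply: cvgM; [exact: cvg_bump|exact: cvg_cst].
  have cN k xi : normc (F k xi) <= Cg * weight xi.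
    rewrite FE /E !Normc.normcM normc_real normc_expi mul1r.
    rewrite ger0_norm ?bump_ge0//; apply: le_trans (gC xi).
    by rewrite ler_piMl ?normc_ge0 ?bump_le1.
  have [cr ci] := cint_dominated_cvg (fun k => cmeasM mex (proj1 (dG k))) (cmeasM mex mg)
    cR cI (integrable_weightZ Cg) cN.
  have -> : (fun k => normc (wave phi (t x) (G k) x) ^+ 2) = (fun k =>
      Re (cint mu (F k)) * Re (cint mu (F k)) + Im (cint mu (F k)) * Im (cint mu (F k))).
    by apply/funext => k; rewrite sqr_normc !expr2.
  by rewrite sqr_normc !expr2; apply: cvgD; apply: cvgM.
- move=> k; apply: (le_trans (partial_sum k)).
  have s0 : 0 <= \sum_(i < k) c * r ^+ i.
    by apply: sumr_ge0 => i _; rewrite mulr_ge0 ?exprn_ge0 ?(ltW c0) ?(ltW r0).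
  have sle : \sum_(i < k) c * r ^+ i <= c / (1 - r) by rewrite geometric_le ?(ltW c0) ?(ltW r0).
  rewrite (@lee_wpmul2r _ S)// lee_fin lerXn2r ?lerD2l// nnegrE addr_ge0 ?(ltW A0)//.
  exact: le_trans sle.
Qed.

End summation.

(** * Japanese brackets, exponents and the low-frequency bound *)

Section low_frequency_piece.
Context {R : realType} {n : nat}.
Notation V := 'rV[R]_n.
Notation mu := (borel_lebesgue R n).
Notation nu := (lebesgue_rV R n).

Lemma sqr_bracket (xi : V) : bracket xi ^+ 2 = 1 + \sum_i xi ord0 i ^+ 2.
Proof.
have s0 : 0 <= \sum_i xi ord0 i ^+ 2 by apply: sumr_ge0 => i _; exact: sqr_ge0.
by rewrite /bracket /enorm !sqr_sqrtr// addr_ge0.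
Qed.

Lemma bracket_ge0 (xi : V) : 0 <= bracket xi.
Proof. exact: sqrtr_ge0. Qed.

Lemma bracket_ge1 (xi : V) : 1 <= bracket xi.
Proof.
rewrite -(@ler_pXn2r _ 2)// ?nnegrE ?bracket_ge0// expr1n sqr_bracket lerDl.
by apply: sumr_ge0 => i _; exact: sqr_ge0.
Qed.

Lemma bracket_ge_norm (xi : V) : `|xi| <= bracket xi.
Proof.
have [->|x0] := eqVneq xi 0; first by rewrite normr0 bracket_ge0.
have n0 : 0 < `|xi| by rewrite normr_gt0.
have [i xi_i] : exists i, `|xi| <= `|xi ord0 i|.
  apply/existsP; apply: contraT => /existsPn H.
  suff : `|xi| < `|xi| by rewrite ltxx.
  by apply: normr_rV_lt => // i; rewrite ltNge H.
apply: (le_trans xi_i).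
rewrite -(@ler_pXn2r _ 2)// ?nnegrE ?bracket_ge0// sqr_bracket real_normK ?num_real//.
rewrite (bigD1 i)//= addrCA lerDl addr_ge0//.
by apply: sumr_ge0 => j _; exact: sqr_ge0.
Qed.

(** The support of an annulus is measured in the max norm: [n] squares of size at most [16 L^2], and
    [1 <= L^2]. *)
Lemma bracket_le (L : R) (xi : V) : 1 <= L -> `|xi| <= 4 * L ->
  bracket xi <= Num.sqrt (1 + 16 * n%:R) * L.
Proof.
move=> L1 xL; have L0 : 0 <= L by exact: le_trans L1.
have c0 : 0 <= 1 + 16 * n%:R :> R by rewrite addr_ge0// mulr_ge0.
rewrite -(@ler_pXn2r _ 2)// ?nnegrE ?bracket_ge0 ?mulr_ge0 ?sqrtr_ge0//.
rewrite sqr_bracket exprMn sqr_sqrtr// mulrDl mul1r lerD ?exprn_ege1//.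
apply: (@le_trans _ _ (\sum_(i < n) 16 * L ^+ 2)).
  apply: ler_sum => i _; rewrite -real_normK ?num_real// (_ : 16 * _ = (4 * L) ^+ 2); last by ring.
  by rewrite lerXn2r ?nnegrE ?mulr_ge0// (le_trans (normr_coord xi i)).
rewrite sumr_const card_ord -mulr_natr le_eqVlt; apply/orP; left; apply/eqP; ring.
Qed.

Lemma exponent_choice (a s0 s : R) : 1 <= a -> 0 < s0 -> a * s0 < s ->
  exists eps s1, [/\ 0 < eps, s0 < s1 & (a + eps) * s1 < s].
Proof.
(* For [e <= 1], [(a + e) (s0 + e) <= a s0 + e (a + s0 + 1)]; the 2 in the denominator makes the
   increment at most half of the available gap. *)
move=> a1 s00 as0; pose q := (s - a * s0) / (2 * (a + s0 + 1)).
have d0 : 0 < 2 * (a + s0 + 1) by lra.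
have q0 : 0 < q by rewrite divr_gt0 ?subr_gt0.
have qE : q * (2 * (a + s0 + 1)) = s - a * s0 by rewrite divfK// gt_eqF.
pose e := Num.min 1 q.
have e0 : 0 < e by rewrite lt_min ltr01 q0.
have e1 : e <= 1 by rewrite ge_min lexx.
have eq : e <= q by rewrite ge_min lexx orbT.
exists e, (s0 + e); split => //; first by rewrite ltrDl.
have h1 : e * (2 * (a + s0 + 1)) <= s - a * s0 by rewrite -qE ler_wpM2r// ltW.
have h2 : e * e <= e by rewrite ler_piMl// ltW.
have h3 : 0 < e * (a + s0 + 1) by rewrite mulr_gt0//; lra.
nra.
Qed.

(** [wave_low] requires [phi] only through its size on the support of [bump], where it is at most
    [Mp]; since [s >= 0], the bracket power is at least 1 and the plain norm of the amplitude is
    below the Sobolev one. *)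
Lemma low_piece (phi : V -> R) (s Mp : R) : measurable_fun setT phi -> 0 <= s ->
  (forall xi, `|xi| <= 2 -> `|phi xi| <= Mp) ->
  exists2 A : R, 0 < A & forall t : V -> R, lebesgue_measurable t -> (forall x, 0 <= t x <= 1) ->
  forall f : V -> R[i], schwartz f ->
  (\int[nu]_x (normc (wave phi (t x) (fun xi => ((bump xi)%:C)%C * fourier f xi) x) ^+ 2)%:E <=
   (A ^+ 2)%:E * \int[mu]_xi ((bracket xi `^ s * normc (fourier f xi)) ^+ 2)%:E)%E.
Proof.
move=> mphi s0 phiM.
have M0 : 0 <= Mp by apply: le_trans (phiM 0 _); rewrite ?normr0.
pose c : R := 2 * @fmass R n * (1 + Mp ^+ 2).
have f0 := @fmass_gt0 R n.
have c0 : 0 < c by rewrite !mulr_gt0// ltr_pwDl// sqr_ge0.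
exists (Num.sqrt c); first by rewrite sqrtr_gt0.
move=> t mt t01 f sf; rewrite (sqr_sqrtr (ltW c0)).
have dff := dominated_fourier sf; set ff := fourier f in dff *; clearbody ff.
have mb : cmeas (fun xi : V => ((bump xi)%:C)%C).
  have := cmeas_real (smooth_on_measurable (smooth_on_bump (n := n) (1 : R))).
  by congr cmeas; apply/funext => xi; rewrite scale1r.
have dg : dominated (fun xi => ((bump xi)%:C)%C * ff xi).
  apply: dominatedM => //.
  by exists 1 => x; rewrite normc_real ger0_norm ?bump_ge0 ?bump_le1.
have bM xi : `|phi xi * bump xi| <= Mp.
  have [x2|x2] := leP `|xi| 2.
    rewrite normrM (ger0_norm (bump_ge0 _)) -[leRHS]mulr1.
    by rewrite ler_pM ?bump_ge0 ?bump_le1 ?phiM.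
  by rewrite bump_eq0 ?mulr0 ?normr0// ltW.
have mpb : measurable_fun setT (fun xi : V => phi xi * bump xi).
  by apply: measurable_funM => //; case: mb.
have dpg : dominated (fun xi => ((phi xi)%:C)%C * (((bump xi)%:C)%C * ff xi)).
  have := dominatedM (cmeas_real mpb) (ex_intro _ Mp _) dff.
  have H : forall xi, normc (((phi xi * bump xi)%:C)%C) <= Mp by move=> xi; rewrite normc_real.
  move=> /(_ H); congr dominated; apply/funext => xi.
  by rewrite rmorphM/= mulrA.
apply: (le_trans (wave_low mphi mt t01 dg dpg)).
have mff : measurable_fun setT (fun xi => normc (ff xi) ^+ 2).
  by apply: measurable_funX; apply: measurable_normc; case: dff.
have mS : measurable_fun setT (fun xi => (bracket xi `^ s * normc (ff xi)) ^+ 2).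
  apply: measurable_funX; apply: measurable_funM; first exact: measurable_bracket_powR.
  by apply: measurable_normc; case: dff.
have ffS xi : normc (ff xi) ^+ 2 <= (bracket xi `^ s * normc (ff xi)) ^+ 2.
  rewrite lerXn2r ?nnegrE ?mulr_ge0 ?powR_ge0 ?normc_ge0//.
  rewrite ler_peMl ?normc_ge0//.
  by rewrite -(powRr0 (bracket xi)) ler_powR// bracket_ge1.
set S := (\int[mu]_xi ((bracket xi `^ s * normc (ff xi)) ^+ 2)%:E)%E.
have I1 : (\int[mu]_x (normc (((bump x)%:C)%C * ff x) ^+ 2)%:E <= S)%E.
  apply: (@ge0_le_integral _ _ _ mu _ measurableT).
  - by move=> x _; rewrite lee_fin sqr_ge0.
  - by apply/measurable_EFinP; apply: measurable_funX; apply: measurable_normc; case: dg.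
  - exact/measurable_EFinP.
  move=> x _; rewrite lee_fin; apply: le_trans (ffS x).
  rewrite lerXn2r ?nnegrE ?normc_ge0// Normc.normcM normc_real ger0_norm ?bump_ge0//.
  by rewrite ler_piMl ?normc_ge0 ?bump_le1.
have I2 : (\int[mu]_x (normc (((phi x)%:C)%C * (((bump x)%:C)%C * ff x)) ^+ 2)%:E <=
    (Mp ^+ 2)%:E * S)%E.
  rewrite /S -ge0_integralZ_real ?sqr_ge0//; last by move=> x; exact: sqr_ge0.
  apply: (@ge0_le_integral _ _ _ mu _ measurableT).
  - by move=> x _; rewrite lee_fin sqr_ge0.
  - by apply/measurable_EFinP; apply: measurable_funX; apply: measurable_normc; case: dpg.
  - by apply/measurable_EFinP; apply: measurable_funM; [exact: measurable_cst|].
  move=> x _; rewrite lee_fin.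
  apply: (@le_trans _ _ (Mp ^+ 2 * normc (ff x) ^+ 2)); last by rewrite ler_wpM2l ?sqr_ge0.
  rewrite -exprMn lerXn2r ?nnegrE ?mulr_ge0 ?normc_ge0//.
  by rewrite mulrA -rmorphM/= Normc.normcM normc_real ler_wpM2r ?normc_ge0.
have S0 : (0 <= S)%E by apply: integral_ge0 => x _; rewrite lee_fin sqr_ge0.
apply: (le_trans (lee_wpmul2l _ (leeD I1 I2))); first by rewrite lee_fin mulr_ge0// ltW.
rewrite /c [in leRHS]EFinM -muleA; apply: lee_wpmul2l; first by rewrite lee_fin mulr_ge0// ltW.
by rewrite EFinD ge0_muleDl ?mul1e ?lee_fin ?sqr_ge0.
Qed.

End low_frequency_piece.

(** * Bookkeeping of powers for one dyadic piece *)

Section dyadic_piece.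
Context {R : realType} {n : nat}.
Notation V := 'rV[R]_n.
Notation mu := (borel_lebesgue R n).
Notation nu := (lebesgue_rV R n).

Lemma powR2D (x y : R) : 2 `^ (x + y) = 2 `^ x * 2 `^ y.
Proof. by rewrite powRD// pnatr_eq0 implybT. Qed.

Lemma powR2_ge1 (x : R) : 0 <= x -> 1 <= 2 `^ x.
Proof. by move=> x0; rewrite -[leLHS](powRr0 2) ler_powR// ler1n. Qed.

(** On the support [|xi| >= l / 2], so [l <= 2 * bracket xi]: the Sobolev weight pays for the factor
    [l^-s] that sums the pieces. *)
Lemma integral_fat_annulus_le (l s : R) (g : V -> R[i]) : 0 < l -> 0 <= s -> cmeas g ->
  (\int[mu]_xi (normc (((fat_annulus l xi)%:C)%C * g xi) ^+ 2)%:E <=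
   ((2 `^ s * l `^ (- s)) ^+ 2)%:E *
     \int[mu]_xi ((bracket xi `^ s * normc (g xi)) ^+ 2)%:E)%E.
Proof.
move=> l0 s0 mg; pose c := 2 `^ s * l `^ (- s).
have c0 : 0 <= c by rewrite mulr_ge0 ?powR_ge0.
have mS : measurable_fun setT (fun xi => (bracket xi `^ s * normc (g xi)) ^+ 2).
  apply: measurable_funX; apply: measurable_funM; first exact: measurable_bracket_powR.
  exact: measurable_normc.
rewrite -/c -ge0_integralZ_real ?sqr_ge0//; last by move=> x; exact: sqr_ge0.
have [sa _] := @test_fat_annulus R n _ l0.
apply: (@ge0_le_integral _ _ _ mu _ measurableT).
- by move=> x _; rewrite lee_fin sqr_ge0.
- apply/measurable_EFinP; apply: measurable_funX; apply: measurable_normc; apply: cmeasM => //.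
  by apply: cmeas_real; exact: smooth_on_measurable sa.
- by apply/measurable_EFinP; apply: measurable_funM; [exact: measurable_cst|].
move=> x _; rewrite lee_fin -exprMn lerXn2r ?nnegrE ?mulr_ge0 ?powR_ge0 ?normc_ge0//.
rewrite Normc.normcM normc_real mulrA; apply: ler_wpM2r; first exact: normc_ge0.
have [->|/(fat_annulus_supp l0) lx] := eqVneq (fat_annulus l x) 0.
  by rewrite normr0 mulr_ge0 ?powR_ge0.
apply: (le_trans (fat_annulus_le1 _ _)).
rewrite /c powRN mulrAC ler_pdivlMr ?powR_gt0// mul1r -powRM ?bracket_ge0//.
apply: ge0_ler_powR => //; rewrite ?nnegrE ?mulr_ge0 ?bracket_ge0 ?(ltW l0)//.
have := bracket_ge_norm x; lra.
Qed.

Lemma dyadic_piece (a s s1 eps C : R) (phi : V -> R) : (0 < n)%N -> 1 <= a -> 0 < eps ->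
  0 <= s1 -> 0 <= s ->
  smooth_on [set xi : V | xi != 0] phi ->
  (forall (r : R) (xi : V), 0 < r -> xi != 0 -> phi (r *: xi) = r `^ a * phi xi) ->
  0 <= C ->
  (forall t : V -> R, lebesgue_measurable t -> (forall x, 0 <= t x <= 1) ->
    forall G, ctest G ->
    (\int[nu]_x (\1_unit_ball x * normc (wave phi (t x) G x) ^+ 2)%:E <=
     C%:E * \int[mu]_xi ((bracket xi `^ s1 * normc (G xi)) ^+ 2)%:E)%E) ->
  exists2 c : R, 0 < c & forall k (t : V -> R), lebesgue_measurable t ->
    (forall x, 0 <= t x <= 1) -> forall f : V -> R[i], schwartz f ->
  (\int[nu]_x
     (normc (wave phi (t x) (fun xi => ((annulus (2 ^+ k) xi)%:C)%C * fourier f xi) x) ^+ 2)%:E <=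
   ((c * (2 `^ ((a + eps) * s1 - s)) ^+ k) ^+ 2)%:E *
     \int[mu]_xi ((bracket xi `^ s * normc (fourier f xi)) ^+ 2)%:E)%E.
Proof.
move=> n0 a1 eps0 s10 s0 sphi hphi C0 hyp.
(* The term [2 * n] is what converting decay into [weight] requires; the other makes [eps * N] at
   least [(a + eps) * n], so that the kernel is bounded uniformly in the scale. *)
pose N := (2 * n + Num.bound ((a + eps) * n%:R / eps))%N.
have ae0 : 0 <= a + eps by lra.
have epsN : (a + eps) * n%:R <= eps * N%:R.
  have x0 : 0 <= (a + eps) * n%:R / eps by rewrite divr_ge0 ?(ltW eps0)// mulr_ge0.
  have := archi_boundP x0; rewrite ltr_pdivrMr// => /ltW h; apply: (le_trans h).
  by rewrite mulrC ler_pM2l// ler_nat leq_addl.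
have [B B0 HB] := @kernel_weight R n a phi sphi hphi N (leq_addr _ _).
have f0 := @fmass_gt0 R n.
pose b0 : R := Num.sqrt (1 + 16 * n%:R) `^ s1.
have b00 : 0 <= b0 by exact: powR_ge0.
pose P : R := n%:R ^+ n * (2 * C) * (5 * pi) ^+ n.
have P0 : 0 <= P by rewrite !mulr_ge0 ?exprn_ge0 ?mulr_ge0 ?pi_ge0.
pose Q : R := 2 * (B * pi ^+ n) ^+ 2 / @fmass R n.
have Q0 : 0 <= Q by rewrite divr_ge0 ?(ltW f0)// mulr_ge0 ?sqr_ge0.
(* [P * b0^2] collects the near part and [Q] the far part of [high_piece]; the added 1 only makes
   the constant positive. *)
pose c1 : R := Num.sqrt (P * b0 ^+ 2 + Q + 1).
have c1p : 0 < P * b0 ^+ 2 + Q + 1 by rewrite ltr_pwDr// addr_ge0// mulr_ge0 ?sqr_ge0.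
exists (c1 * 2 `^ s) => [|k t mt t01 f sf]; first by rewrite mulr_gt0 ?sqrtr_gt0 ?powR_gt0.
pose l : R := 2 ^+ k; have l0 : 0 < l by exact: exprn_gt0.
have lE : l = 2 `^ k%:R by rewrite powR_mulrn.
pose L : R := 2 `^ (k%:R * (a - 1 + eps)).
have L1 : 1 <= L by apply: powR2_ge1; rewrite mulr_ge0//; lra.
have L0 : 0 < L by exact: powR_gt0.
have LlE : L * l = 2 `^ (k%:R * (a + eps)).
  by rewrite lE -powR2D; congr (_ `^ _); ring.
have Ll0 : 0 < L * l by exact: mulr_gt0.
have Ll1 : 1 <= L * l by rewrite LlE; apply: powR2_ge1; exact: mulr_ge0.
(* The size of the rescaled phase: [tau <= L^-a] gives [tau * (L l)^a <= l^a]. *)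
pose sigma := l `^ a.
have sE : sigma = 2 `^ (k%:R * a) by rewrite /sigma lE -powRrM.
have sig1 : 1 <= sigma by rewrite sE; apply: powR2_ge1; rewrite mulr_ge0//; lra.
pose W := (L * l) `^ s1.
have W0 : 0 <= W by exact: powR_ge0.
have W1 : 1 <= W by rewrite /W LlE -powRrM; apply: powR2_ge1; rewrite !mulr_ge0.
have HK (xi : V) : bracket xi `^ s1 * `|annulus (L * l) xi| <= b0 * W.
  have [->|/(annulus_supp Ll0)/andP[_ xL]] := eqVneq (annulus (L * l) xi) 0.
    by rewrite normr0 mulr0 mulr_ge0.
  apply: (@le_trans _ _ (bracket xi `^ s1)).
    by rewrite ler_piMr ?powR_ge0 ?annulus_le1.
  rewrite /b0 /W -powRM ?sqrtr_ge0 ?(ltW Ll0)//.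
  apply: ge0_ler_powR => //; rewrite ?nnegrE ?bracket_ge0 ?(mulr_ge0 (sqrtr_ge0 _) (ltW Ll0))//.
  exact: bracket_le.
have HB' tau : 0 <= tau <= L `^ (- a) -> forall x : V, 1 <= `|x| ->
    normc (wave_kernel phi tau (annulus (L * l)) x) <= B * weight x.
  move=> /andP[tau0 tauL] x x1; apply: (HB _ tau sigma) => //.
    rewrite (powRM _ (ltW L0) (ltW l0)) mulrA -/sigma ler_piMl ?powR_ge0//.
    apply: (@le_trans _ _ (L `^ (- a) * L `^ a)); first by rewrite ler_wpM2r ?powR_ge0.
    by rewrite powRN mulVf// gt_eqF// powR_gt0.
  (* As powers of 2: [(L l)^n (sigma / (L l))^N] has exponent [k ((a + eps) n - eps N)], nonpositive
     by the choice of [N]. *)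
  rewrite LlE sE -powRN -powR2D -!powR_mulrn ?powR_ge0// -!powRrM -powR2D.
  rewrite -[leRHS](powRr0 2) ler_powR ?ler1n//.
  rewrite (_ : _ + _ = k%:R * ((a + eps) * n%:R - eps * N%:R)); last by ring.
  by rewrite mulr_ge0_le0// subr_le0.
have La : L `^ (- a) <= 1.
  by rewrite powRN invf_le1 ?powR_gt0// -(powRr0 L) ler_powR//; lra.
have hyp' (t' : V -> R) : lebesgue_measurable t' -> (forall x, 0 <= t' x <= L `^ (- a)) ->
    forall G, ctest G ->
    (\int[nu]_x (\1_unit_ball x * normc (wave phi (t' x) G x) ^+ 2)%:E <=
     C%:E * \int[mu]_xi ((bracket xi `^ s1 * normc (G xi)) ^+ 2)%:E)%E.
  move=> mt' t'1; apply: hyp => // x; have /andP[-> h] := t'1 x.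
  exact: le_trans La.
have K0 : 0 <= b0 * W by exact: mulr_ge0.
have H := high_piece sphi hphi n0 l0 L1 sf mt t01 B0 C0 K0 HK HB' hyp'.
apply: (le_trans H); clear H.
have [mff _] := dominated_fourier sf.
set S := (X in (_ <= _ * X)%E).
have S0 : (0 <= S)%E by apply: integral_ge0 => x _; rewrite lee_fin sqr_ge0.
set M := (X in (X / _)%:E).
have ME : M / @fmass R n = P * (b0 * W) ^+ 2 + Q.
  by rewrite /M /P /Q; field; rewrite gt_eqF.
have M0 : 0 <= M / @fmass R n by rewrite ME addr_ge0// mulr_ge0// sqr_ge0.
apply: (le_trans (lee_wpmul2l _ (integral_fat_annulus_le l0 s0 mff))); first by rewrite lee_fin.
rewrite -/S muleA -EFinM lee_wpmul2r// lee_fin ME.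
(* Loss [(L l)^s1] against gain [l^-s]: this is where the common ratio of the geometric series
   arises. *)
have WlE : W * l `^ (- s) = (2 `^ ((a + eps) * s1 - s)) ^+ k.
  rewrite /W LlE lE -!powRrM -powR2D -powR_mulrn ?powR_ge0// -powRrM.
  by congr (_ `^ _); ring.
rewrite -WlE [leRHS](_ : _ = (c1 ^+ 2 * W ^+ 2) * (2 `^ s * l `^ (- s)) ^+ 2); last by ring.
apply: ler_wpM2r; first exact: sqr_ge0.
rewrite sqr_sqrtr ?(ltW c1p)// exprMn !mulrDl mulrA -addrA lerD2l mul1r.
(* The far part carries no loss [W]; since [W >= 1] it is absorbed into the same power. *)
have W2 : 1 <= W ^+ 2 by exact: exprn_ege1.
apply: (@le_trans _ _ (Q * W ^+ 2)); first by rewrite ler_peMr.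
by rewrite lerDl sqr_ge0.
Qed.

End dyadic_piece.

(** * Assembly of the low and high frequencies *)

Theorem theorem2p2 (R : realType) (n : nat) (a s0 : R) (phi : 'rV[R]_n -> R) :
  (1 <= n)%N -> 1 <= a -> 0 < s0 ->
  smooth_on [set xi : 'rV[R]_n | xi != 0] phi ->
  (forall (r : R) (xi : 'rV[R]_n), 0 < r -> xi != 0 ->
     phi (r *: xi) = r `^ a * phi xi) ->
  (forall alpha : 'I_n -> nat, exists c : R, forall xi : 'rV[R]_n, xi != 0 ->
     `|mderiv alpha phi xi| <= c * enorm xi `^ (a - (mdegree alpha)%:R)) ->
  (exists2 m : R,
     is_minimum [set enorm (grad phi xi) | xi in unit_sphere] m & 0 < m) ->
  (forall s : R, s0 < s -> exists C : R,
     forall t : 'rV[R]_n -> R, lebesgue_measurable t ->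
       (forall x, 0 <= t x <= 1) ->
     forall f : 'rV[R]_n -> R[i], schwartz f ->
       (L2norm unit_ball (propagator phi t f) <= C%:E * sobolev_norm s f)%E) ->
  (forall s : R, a * s0 < s -> exists C : R,
     forall t : 'rV[R]_n -> R, lebesgue_measurable t ->
       (forall x, 0 <= t x <= 1) ->
     forall f : 'rV[R]_n -> R[i], schwartz f ->
       (L2norm setT (propagator phi t f) <= C%:E * sobolev_norm s f)%E).
Proof.
move=> n1 a1 s00 sphi hphi dphi _ hyp s as0.
have [eps [s1 [e0 s01 ks]]] := exponent_choice a1 s00 as0.
have mphi := measurable_punctured sphi.
have [C HC] := hyp s1 s01.
have hc := hypothesis_ctest mphi HC.
have s1_ge0 : 0 <= s1 by rewrite ltW// (lt_trans s00).
have s_ge0 : 0 <= s by rewrite ltW// (lt_trans _ as0)// mulr_gt0//; lra.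
have [c c0 Hc] := dyadic_piece n1 a1 e0 s1_ge0 s_ge0 sphi hphi (sqr_ge0 C) hc.
have a_ge0 : 0 <= a by lra.
(* The symbol bound of order zero controls [phi] away from the origin only; the summand [|phi 0|]
   covers the arbitrary value there. The square root is [bracket_le] at scale 1, which passes from
   the max norm to the Euclidean one. *)
have [M phiM] : exists M, forall xi : 'rV[R]_n, `|xi| <= 2 -> `|phi xi| <= M.
  have [b Hb] := dphi (fun=> 0%N); rewrite mderiv0 /mdegree big1// subr0 in Hb.
  exists (`|b| * Num.sqrt (1 + 16 * n%:R) `^ a + `|phi 0|) => xi x2.
  have [->|x0] := eqVneq xi 0; first by rewrite lerDr mulr_ge0 ?powR_ge0.
  apply: (le_trans (Hb xi x0)); rewrite ler_wpDr//.
  apply: (le_trans (ler_wpM2r (powR_ge0 _ _) (ler_norm b))).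
  rewrite ler_wpM2l// ge0_ler_powR ?nnegrE ?sqrtr_ge0//.
  apply: (@le_trans _ _ (bracket xi)).
    rewrite /bracket -[leLHS](ger0_norm (sqrtr_ge0 _)) -sqrtr_sqr ler_wsqrtr//.
    by rewrite lerDr.
  by rewrite -[leRHS]mulr1 bracket_le//; lra.
have [A A0 HA] := low_piece mphi s_ge0 phiM.
pose r : R := 2 `^ ((a + eps) * s1 - s).
(* The geometric ratio is below 1 precisely because [(a + eps) * s1 < s]. *)
have r01 : 0 < r < 1.
  have h : 0 < s - (a + eps) * s1 by rewrite subr_gt0.
  rewrite powR_gt0//= /r -opprB powRN invf_lt1 ?powR_gt0//.
  have /(_ 1 2) := gt0_ltr_powR h; rewrite powR1 !nnegrE ler01 ler0n ltr1n.
  by apply.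
exists (A + c / (1 - r)) => t mt t01 f sf.
have D0 : 0 <= A + c / (1 - r).
  by case/andP: r01 => r0 r1; rewrite addr_ge0 ?(ltW A0)// divr_ge0 ?(ltW c0)// subr_ge0 ltW.
have dff := dominated_fourier sf; have [mff _] := dff.
rewrite (L2norm_le setT setT _ _ D0).
rewrite (@eq_integral _ _ _ (lebesgue_rV R n) setT
  (fun x => (normc (wave phi (t x) (fourier f) x) ^+ 2)%:E)); last first.
  by move=> x _; rewrite indicT mul1r propagatorE.
have -> : (\int[lebesgue_rV R n]_x (\1_setT x *
      normc ((bracket x `^ s)%:C%C * fourier f x) ^+ 2)%:E =
    \int[borel_lebesgue R n]_xi ((bracket xi `^ s * normc (fourier f xi)) ^+ 2)%:E)%E.
  rewrite -ge0_integral_lebesgue_rV.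
  - apply: eq_integral => x _; rewrite indicT mul1r Normc.normcM normc_real.
    by rewrite ger0_norm ?powR_ge0.
  - apply/measurable_EFinP; apply: measurable_funX; apply: measurable_funM.
      exact: measurable_bracket_powR.
    exact: measurable_normc.
  - by move=> x; rewrite lee_fin sqr_ge0.
apply: dyadic_sum => //.
- by apply: integral_ge0 => x _; rewrite lee_fin sqr_ge0.
- exact: HA.
- by move=> k; exact: Hc.
Qed.
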